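(* Let $k\geq 2$ and let $\{\Omega_i\}_{i\geq 1}$ be a sequence of domains in $\mathbb{C}^k$, each biholomorphic to the unit ball of $\mathbb{C}^k$, such that $\Omega_i\subseteq\Omega_{i+1}$ for all $i\geq 1$. Put $\Omega=\bigcup_{i\geq 1}\Omega_i$ and assume that the Kobayashi (infinitesimal) metric of $\Omega$ vanishes identically. Then $\Omega$ has infinite Lebesgue volume, and the Bergman space \[ A^2(\Omega)=\Big\{f:\Omega\to\mathbb{C}\ \text{holomorphic}:\ \int_\Omega |f|^2\,dV<\infty\Big\} \] consists only of the zero function.
   Context: The Kobayashi metric vanishing identically means that the Kobayashi–Royden infinitesimal pseudometric of $\Omega$ is zero at every point and for every tangent vector. *)

(* Defs.v *)
From HB Require Import structures.
From mathcomp Require Import all_boot all_order all_algebra.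
From mathcomp Require Import all_classical all_reals.
From mathcomp Require Import ereal topology normedtype sequences measure
  lebesgue_measure lebesgue_integral.
From mathcomp Require Import complex.

Set Implicit Arguments.
Unset Strict Implicit.
Unset Printing Implicit Defensive.

Import Order.TTheory GRing.Theory Num.Theory.
Local Open Scope classical_set_scope.
Local Open Scope ring_scope.

Section Defs.
Variable R : realType.
Local Notation C := (R[i]).

Definition cabs (z : C) : R :=
  let: (a +i* b)%C := z in Num.sqrt (a ^+ 2 + b ^+ 2).

Definition normv n (z : 'rV[C]_n) : R := \sum_(j < n) cabs (z 0 j).

Definition openC n (U : set 'rV[C]_n) : Prop :=
  forall z, U z -> exists2 r : R, 0 < r & forall w, normv (w - z) < r -> U w.

Definition connectedC n (U : set 'rV[C]_n) : Prop :=
  forall A B : set 'rV[C]_n, openC A -> openC B ->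
    U `<=` A `|` B -> U `&` A `&` B = set0 ->
    U `<=` A \/ U `<=` B.

Definition domainC n (U : set 'rV[C]_n) : Prop :=
  U !=set0 /\ openC U /\ connectedC U.

Definition cderiv n m (f : 'rV[C]_n -> 'rV[C]_m) (z : 'rV[C]_n)
  (L : 'M[C]_(n, m)) : Prop :=
  forall e : R, 0 < e -> exists2 d : R, 0 < d &
    forall h : 'rV[C]_n, normv h < d ->
      normv (f (z + h) - f z - h *m L) <= e * normv h.

Definition holo_on n m (U : set 'rV[C]_n) (f : 'rV[C]_n -> 'rV[C]_m) : Prop :=
  forall z, U z -> exists L, cderiv f z L.

Definition unit_ball n : set 'rV[C]_n :=
  [set z | \sum_(j < n) cabs (z 0 j) ^+ 2 < 1].

Definition unit_disc : set 'rV[C]_1 := @unit_ball 1.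

Definition biholomorphic n (U V : set 'rV[C]_n) : Prop :=
  exists (F G : 'rV[C]_n -> 'rV[C]_n),
    [/\ holo_on U F, holo_on V G, (F @` U `<=` V), (G @` V `<=` U) &
        ((forall z, U z -> G (F z) = z) /\ (forall w, V w -> F (G w) = w))].

Definition kobayashi n (U : set 'rV[C]_n) (p v : 'rV[C]_n) : \bar R :=
  ereal_inf [set a%:E | a in [set a : R | 0 < a /\
    exists phi : 'rV[C]_1 -> 'rV[C]_n,
      [/\ holo_on unit_disc phi, (phi @` unit_disc `<=` U), phi 0 = p &
          exists L : 'M[C]_(1, n), cderiv phi 0 L /\ (a%:C)%C *: L = v]]].

(* Lebesgue integral of a nonnegative function on R^n, computed as an
   iterated one-dimensional Lebesgue integral (Tonelli).  Points of R^n are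
   the first n coordinates of a sequence nat -> R. *)
Fixpoint iint (n : nat) (g : (nat -> R) -> \bar R) : \bar R :=
  match n with
  | 0 => g (fun _ => 0)
  | n'.+1 => (\int[@lebesgue_measure R]_x
                iint n' (fun v => g (fun j => if j is j'.+1 then v j' else x)))%E
  end.

Definition toC n (x : nat -> R) : 'rV[C]_n :=
  \row_(j < n) (x (2 * j)%N +i* x (2 * j).+1)%C.

Definition volC n (U : set 'rV[C]_n) : \bar R :=
  iint (2 * n) (fun x => ((toC n x \in U)%:R)%:E).

Definition L2normsq n (U : set 'rV[C]_n) (f : 'rV[C]_n -> C) : \bar R :=
  iint (2 * n) (fun x => ((toC n x \in U)%:R * cabs (f (toC n x)) ^+ 2)%:E).

Definition bergman n (U : set 'rV[C]_n) : set ('rV[C]_n -> C) :=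
  [set f | holo_on U (fun z => \row_(j < 1) f z) /\ (L2normsq U f < +oo)%E].

End Defs.

Arguments unit_ball {R} n.
Arguments unit_disc {R}.

(* Main.v *)
(** Let [Phi] map the unit ball biholomorphically onto [Om i] with [Phi 0 = p],
   and let [f] be in the Bergman space of the union.  Since [f \o Phi] times the
   Jacobian determinant of [Phi] is holomorphic on the ball with L^2 norm at most that of [f],
   the mean value inequality bounds [|f p| * |det Phi'(0)|] by a constant,
   depending only on the dimension, times the norm of [f].  If the Kobayashi
   metric vanishes there are discs through [p] with arbitrarily large derivative
   in every direction; each of them lies, after shrinking, in some [Om i], so
   Cauchy's estimate for their images in the ball shows that the derivative of
   the inverse of [Phi] at [p] tends to 0.  Hence [|det Phi'(0)|] tends to
   infinity and [f p = 0].  The constant function 1 then shows that the volume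
   is infinite.

   The change of variables is only needed as a lower bound: the image of the
   ball contains disjoint affine images of small balls centered at the images
   of the points of a fine grid.  Integrals of nonnegative functions are suprema
   over simple functions, hence monotone and superadditive without any
   measurability assumption, which is all that this argument uses. *)

Require Import Defs.
From HB Require Import structures.
From mathcomp Require Import all_boot all_order all_algebra.
From mathcomp Require Import all_classical all_reals.
From mathcomp Require Import ereal topology normedtype sequences measure
  lebesgue_measure lebesgue_integral.
From mathcomp Require Import complex.
From mathcomp Require Import perm sesquilinear spectral ring lra.

Set Implicit Arguments.
Unset Strict Implicit.
Unset Printing Implicit Defensive.

Import Order.TTheory GRing.Theory Num.Theory.
Local Open Scope classical_set_scope.
Local Open Scope ring_scope.
Local Notation Re := complex.Re.
Local Notation Im := complex.Im.

(** * Moduli, norms and compactness of cubes *)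

(** Holomorphy is bare complex differentiability at each point, with no continuity of the
    derivative, so the Cauchy theory has to start from Goursat's lemma. Contour integrals are
    replaced by finite sums: dyadic sums for Goursat, sums over a grid of N steps for the mean
    value. Their errors are controlled by second order Taylor estimates, which themselves come from
    Cauchy's estimate. Compactness enters only through bisection of cubes.

    The mean value inequality is stated on the grid because the integral is only bounded below, by
    finitely many disjoint cells around the images of the grid points. A cell has radius of order
    1/N, hence volume of order N^(-2k) times the Jacobian, and there are (4 N^2)^k of them: N
    cancels, which is why the constant depends on the dimension alone.

    The order of integration in [iint] is fixed, so the volume of an affine image of a ball is
    bounded below through a triangular matrix instead of a general linear change of variables.

    No limit over the stages is taken: one stage is fixed, chosen from |f p|, the norm of f and the
    dimension. *)

Section ComplexModulus.
Variable R : realType.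
Local Notation C := (R[i]).
Implicit Types z w : C.

Lemma cabsE z : (cabs z)%:C%C = `|z|.
Proof. by []. Qed.

Lemma cabs_ge0 z : 0 <= cabs z.
Proof. by case: z => a b; exact: sqrtr_ge0. Qed.

Lemma cabs0 : cabs (0 : C) = 0.
Proof. exact: Normc.normc0. Qed.

Lemma cabs1 : cabs (1 : C) = 1.
Proof. exact: Normc.normc1. Qed.

Lemma cabsM z w : cabs (z * w) = cabs z * cabs w.
Proof. exact: Normc.normcM. Qed.

Lemma cabsV z : cabs z^-1 = (cabs z)^-1.
Proof. exact: Normc.normcV. Qed.

Lemma cabsD z w : cabs (z + w) <= cabs z + cabs w.
Proof. exact: le_normcD. Qed.

Lemma cabsN z : cabs (- z) = cabs z.
Proof. exact: normcN. Qed.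

Lemma cabsBC z w : cabs (z - w) = cabs (w - z).
Proof. by rewrite -cabsN opprB. Qed.

Lemma cabsB z w : cabs (z - w) <= cabs z + cabs w.
Proof. by rewrite -(cabsN w) cabsD. Qed.

Lemma cabs_sub_le z w : cabs z - cabs w <= cabs (z - w).
Proof. by rewrite lerBlDr -{1}(subrK w z) cabsD. Qed.

Lemma cabs_eq0 z : (cabs z == 0) = (z == 0).
Proof.
by apply/eqP/eqP => [/Normc.eq0_normc//|->]; rewrite cabs0.
Qed.

Lemma cabs_gt0 z : (0 < cabs z) = (z != 0).
Proof. by rewrite lt0r cabs_ge0 andbT cabs_eq0. Qed.

Lemma cabs_real (x : R) : cabs x%:C%C = `|x|.
Proof. by rewrite /cabs /= expr0n /= addr0 sqrtr_sqr. Qed.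

Lemma cabs_i : cabs ('i%C : C) = 1.
Proof. by rewrite /cabs expr0n /= add0r expr1n sqrtr1. Qed.

Lemma cabsX z n : cabs (z ^+ n) = cabs z ^+ n.
Proof. by elim: n => [|n IH]; rewrite ?cabs1// !exprS cabsM IH. Qed.

Lemma cabs_sum I (r : seq I) (P : pred I) (F : I -> C) :
  cabs (\sum_(i <- r | P i) F i) <= \sum_(i <- r | P i) cabs (F i).
Proof.
elim/big_ind2 : _ => [|x a y b xa yb|//]; first by rewrite cabs0.
by rewrite (le_trans (cabsD _ _))// lerD.
Qed.

Lemma cabs_prod I (r : seq I) (P : pred I) (F : I -> C) :
  cabs (\prod_(i <- r | P i) F i) = \prod_(i <- r | P i) cabs (F i).
Proof. by apply: (big_morph (@cabs R)); [exact: cabsM|exact: cabs1]. Qed.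

Lemma cabs_sqr z : cabs z ^+ 2 = Re z ^+ 2 + Im z ^+ 2.
Proof. by case: z => a b; rewrite /cabs sqr_sqrtr// addr_ge0// sqr_ge0. Qed.

Lemma Re_le_cabs z : `|Re z| <= cabs z.
Proof.
by rewrite -(ler_pXn2r (ltn0Sn 1)) ?nnegrE ?cabs_ge0// cabs_sqr real_normK ?num_real// lerDl sqr_ge0.
Qed.

Lemma Im_le_cabs z : `|Im z| <= cabs z.
Proof.
by rewrite -(ler_pXn2r (ltn0Sn 1)) ?nnegrE ?cabs_ge0// cabs_sqr real_normK ?num_real// lerDr sqr_ge0.
Qed.

Lemma complexRI z : z = (Re z)%:C%C + 'i%C * (Im z)%:C%C.
Proof. exact: complexE. Qed.

Lemma cabs_le z : cabs z <= `|Re z| + `|Im z|.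
Proof.
rewrite [in leLHS](complexRI z) (le_trans (cabsD _ _))// cabsM cabs_i mul1r.
by rewrite !cabs_real.
Qed.

End ComplexModulus.

Section SumNorm.
Variable R : realType.
Local Notation C := (R[i]).
Variable n : nat.
Implicit Types z w : 'rV[C]_n.

Lemma normv_ge0 z : 0 <= normv z.
Proof. by apply: sumr_ge0 => j _; exact: cabs_ge0. Qed.

Lemma normv0 : normv (0 : 'rV[C]_n) = 0.
Proof. by rewrite /normv big1// => j _; rewrite mxE cabs0. Qed.

Lemma normvD z w : normv (z + w) <= normv z + normv w.
Proof.
by rewrite /normv -big_split/=; apply: ler_sum => j _; rewrite mxE cabsD.
Qed.

Lemma normvN z : normv (- z) = normv z.
Proof. by apply: eq_bigr => j _; rewrite mxE cabsN. Qed.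

Lemma normvZ (a : C) z : normv (a *: z) = cabs a * normv z.
Proof. by rewrite /normv mulr_sumr; apply: eq_bigr => j _; rewrite mxE cabsM. Qed.

Lemma normv_coord z j : cabs (z 0 j) <= normv z.
Proof.
by rewrite /normv (bigD1 j)//= lerDl; apply: sumr_ge0 => i _; exact: cabs_ge0.
Qed.

Lemma normv_delta j : normv (delta_mx 0 j : 'rV[C]_n) = 1.
Proof.
rewrite /normv (bigD1 j)//= mxE !eqxx mulr1n cabs1 big1 ?addr0// => i ij.
by rewrite mxE (negbTE ij) andbF mulr0n cabs0.
Qed.

Lemma normv_eq0 z : normv z = 0 -> z = 0.
Proof.
move=> z0; apply/rowP => j; rewrite mxE; apply/eqP; rewrite -cabs_eq0.
by rewrite eq_le cabs_ge0 andbT -z0 normv_coord.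
Qed.

End SumNorm.

Definition mx_mass (R : realType) m n (A : 'M[R[i]]_(m, n)) : R :=
  \sum_(i < m) \sum_(j < n) cabs (A i j).

Lemma normv_mul (R : realType) m n (z : 'rV[R[i]]_m) (A : 'M[R[i]]_(m, n)) :
  normv (z *m A) <= normv z * mx_mass A.
Proof.
rewrite /normv; under eq_bigr do rewrite mxE.
rewrite (@le_trans _ _ (\sum_(j < n) \sum_(i < m) cabs (z 0 i) * cabs (A i j)))//.
  apply: ler_sum => j _; rewrite (le_trans (cabs_sum _ _ _))//.
  by apply: ler_sum => i _; rewrite cabsM.
rewrite exchange_big/= /mx_mass mulr_sumr; apply: ler_sum => i _.
rewrite -mulr_sumr ler_wpM2r ?normv_coord//.
by apply: sumr_ge0 => ? _; exact: cabs_ge0.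
Qed.

Section CubeBisection.
Variables (R : realType) (I : finType).
Implicit Types (a x : I -> R) (l : R).

Definition cube a l : set (I -> R) := [set x | forall i, a i <= x i <= a i + l].

Definition subcube_corner a l (b : {ffun I -> bool}) : I -> R :=
  fun i => a i + (b i)%:R * (l / 2).

(* A dyadic substitute for the compactness of closed cubes. *)
Lemma cube_bisection (P : (I -> R) -> R -> Prop) a l :
  (forall a l, 0 < l -> (forall b, P (subcube_corner a l b) (l / 2)) -> P a l) ->
  0 < l ->
  (forall x, cube a l x -> exists2 d, 0 < d &
     forall a' l', 0 < l' -> l' < d -> cube a' l' x -> P a' l') ->
  P a l.
Proof.
move=> Psub l0 Ploc; apply: contrapT => nP.
have step (q : {q : (I -> R) * R | 0 < q.2 /\ ~ P q.1 q.2}) :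
    {b : {ffun I -> bool} | ~ P (subcube_corner (sval q).1 (sval q).2 b) ((sval q).2 / 2)}.
  case: q => -[a' l'] [/= l'0 nP']; apply: cid; apply: contrapT => h.
  by apply/nP'/Psub => // b; apply: contrapT => ?; apply: h; exists b.
pose nxt q : {q : (I -> R) * R | 0 < q.2 /\ ~ P q.1 q.2} :=
  exist _ (subcube_corner (sval q).1 (sval q).2 (sval (step q)), (sval q).2 / 2)
    (conj (divr_gt0 (svalP q).1 (ltr0Sn _ 1)) (svalP (step q))).
pose q0 : {q : (I -> R) * R | 0 < q.2 /\ ~ P q.1 q.2} := exist _ (a, l) (conj l0 nP).
pose s n := iter n nxt q0.
pose A n := (sval (s n)).1; pose L n := (sval (s n)).2.
have Lpos n : 0 < L n by exact: (svalP (s n)).1.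
have LE n : L n = l / 2 ^+ n.
  elim: n => [|n IH]; first by rewrite /L/= expr0 divr1.
  by rewrite /L/= -/(L n) IH exprS; field; rewrite expf_neq0.
have AS n i : A n i <= A n.+1 i /\ A n.+1 i + L n.+1 <= A n i + L n.
  have -> : A n.+1 i = A n i + (sval (step (s n)) i)%:R * (L n / 2) by [].
  have -> : L n.+1 = L n / 2 by [].
  by have := Lpos n; case: (sval (step (s n)) i) => Ln; split; rewrite ?mul1r ?mul0r; lra.
have Amono i n m : A n i <= A (n + m)%N i /\ A (n + m)%N i + L (n + m)%N <= A n i + L n.
  elim: m => [|m [IH1 IH2]]; first by rewrite addn0.
  by rewrite addnS; have [h1 h2] := AS (n + m)%N i; split; lra.
have Aub i n m : A n i <= A m i + L m.
  have [nm|/ltnW mn] := leqP n m.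
    by have [] := Amono i n (m - n)%N; rewrite subnKC//; have := Lpos m; lra.
  by have [] := Amono i m (n - m)%N; rewrite subnKC//; have := Lpos n; lra.
(* The nested cubes have the supremum of their lower corners as a common point. *)
pose x i := sup [set A n i | n in [set: nat]].
have Ax n : cube (A n) (L n) x.
  move=> i; apply/andP; split.
    apply: ub_le_sup; last by exists n.
    by exists (A 0%N i + L 0%N) => _ [m _ <-]; exact: Aub.
  apply: ge_sup; first by exists (A 0%N i), 0%N.
  by move=> _ [m _ <-]; exact: Aub.
have [d d0 hd] := Ploc x (Ax 0%N).
have [n Ln] : exists n, L n < d.
  have [n hn] : exists n, l / d < 2 ^+ n.
    have := archi_boundP (ltW (divr_gt0 l0 d0)); set m := Num.bound _ => hm.
    by exists m; rewrite (lt_le_trans hm)// -natrX ler_nat ltnW// ltn_expl.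
  by exists n; rewrite LE ltr_pdivrMr ?exprn_gt0// mulrC -ltr_pdivrMr.
by apply: (svalP (s n)).2; exact: (hd (A n) (L n)).
Qed.

End CubeBisection.

(** * Differential calculus *)

Section Differentials.
Variable R : realType.
Local Notation C := (R[i]).

(** The calculus below rests on these four facts, so that [cabs] on scalars and [normv] on row
    vectors are treated at once. *)
Definition is_norm (V : zmodType) (N : V -> R) :=
  [/\ N 0 = 0, forall x, 0 <= N x, forall x y, N (x + y) <= N x + N y &
      forall x, N (- x) = N x].

(* [r w <= o(N w)] as [N w] tends to 0; [r] need not be nonnegative. *)
Definition is_oo (V : Type) (N r : V -> R) :=
  forall e, 0 < e -> exists2 d : R, 0 < d & forall w, N w < d -> r w <= e * N w.

(** [L] is any map with a linear bound; complex linearity comes with the forms given to [L] later,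
    such as [q * w], [pairing^~ g] or [w *m L]. *)
Definition dif (V W : zmodType) (NV : V -> R) (NW : W -> R) (f : V -> W) (z : V)
    (L : V -> W) :=
  (exists K : R, forall w, NW (L w) <= K * NV w) /\
  is_oo NV (fun w => NW (f (z + w) - f z - L w)).

Lemma cabs_is_norm : is_norm (@cabs R).
Proof. by split; [exact: cabs0|exact: cabs_ge0|exact: cabsD|exact: cabsN]. Qed.

Lemma normv_is_norm n : is_norm (@normv R n).
Proof. by split; [exact: normv0|exact: normv_ge0|exact: normvD|exact: normvN]. Qed.

Section LittleO.
Variables (V : Type) (N : V -> R).
Hypothesis N0 : forall x, 0 <= N x.
Implicit Types r s : V -> R.

Lemma is_ooD r s : is_oo N r -> is_oo N s -> is_oo N (fun w => r w + s w).
Proof.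
move=> hr hs e e0; have e20 : 0 < e / 2 by lra.
have [d d0 hd] := hr _ e20; have [d' d'0 hd'] := hs _ e20.
exists (Num.min d d'); first by rewrite lt_min d0.
move=> w; rewrite lt_min => /andP[wd wd'].
by have := hd _ wd; have := hd' _ wd'; have := N0 w; nra.
Qed.

Lemma is_ooZ c r : 0 <= c -> is_oo N r -> is_oo N (fun w => c * r w).
Proof.
move=> c0 hr e e0; have [|d d0 hd] := hr (e / (c + 1)); first by rewrite divr_gt0//; lra.
exists d => // w /hd h; rewrite (le_trans (ler_wpM2l c0 h))// mulrA ler_wpM2r//.
by rewrite mulrCA ger_pMr// ler_pdivrMr ?mul1r; lra.
Qed.

Lemma is_oo_le r s d : 0 < d -> (forall w, N w < d -> s w <= r w) ->
  is_oo N r -> is_oo N s.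
Proof.
move=> d0 sr hr e e0; have [d' d'0 hd'] := hr _ e0.
exists (Num.min d d'); first by rewrite lt_min d0.
by move=> w; rewrite lt_min => /andP[/sr + /hd']; exact: le_trans.
Qed.

Lemma is_oo_quad K : is_oo N (fun w => K * N w * N w).
Proof.
move=> e e0; have K0 : 0 < `|K| + 1 by have := normr_ge0 K; lra.
exists (e / (`|K| + 1)); first by rewrite divr_gt0.
move=> w; rewrite ltr_pdivlMr// => h; rewrite ler_wpM2r//.
have := ler_norm K; have := N0 w; nra.
Qed.

End LittleO.

Section Dif.
Variables (V : zmodType) (NV : V -> R).
Hypothesis hV : is_norm NV.

Let NV0 x : 0 <= NV x. Proof. by case: hV. Qed.

Section Codomain.
Variables (W : zmodType) (NW : W -> R).
Hypothesis hW : is_norm NW.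
Let NW0 x : 0 <= NW x. Proof. by case: hW. Qed.

Lemma dif_bound f z (L : V -> W) : dif NV NW f z L ->
  exists2 K : R, 0 <= K & forall w, NW (L w) <= K * NV w.
Proof.
case=> -[K hK] _; exists `|K| => // w; rewrite (le_trans (hK w))//.
by rewrite ler_wpM2r// ler_norm.
Qed.

Lemma dif_lip f z (L : V -> W) : dif NV NW f z L ->
  exists K d : R, [/\ 0 <= K, 0 < d &
    forall w, NV w < d -> NW (f (z + w) - f z) <= K * NV w].
Proof.
move=> h; have [K K0 hK] := dif_bound h; have [d d0 hd] := h.2 1 ltr01.
exists (K + 1), d; split=> //; first lra.
move=> w /hd hw; rewrite -(subrK (L w) (_ - _)).
have [_ _ tri _] := hW; have := tri (f (z + w) - f z - L w) (L w).
by have := hK w; lra.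
Qed.

Lemma dif_continuous f z (L : V -> W) e : dif NV NW f z L -> 0 < e ->
  exists2 d : R, 0 < d & forall w, NV w < d -> NW (f (z + w) - f z) < e.
Proof.
move=> /dif_lip[K [d [K0 d0 hd]]] e0; have K1 : 0 < K + 1 by lra.
exists (Num.min d (e / (K + 1))); first by rewrite lt_min d0 divr_gt0.
move=> w; rewrite lt_min ltr_pdivlMr// => /andP[/hd + h].
by move/le_lt_trans; apply; have := NV0 w; nra.
Qed.

Lemma dif_eq_near f g z (L : V -> W) d : 0 < d ->
  (forall w, NV w < d -> f (z + w) = g (z + w)) ->
  dif NV NW f z L -> dif NV NW g z L.
Proof.
move=> d0 fg [Lb hf]; split=> //; apply: (is_oo_le d0 _ hf) => w wd.
by rewrite -!fg// -[z in g z]addr0 -fg ?addr0//; have [-> _ _ _] := hV.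
Qed.

Lemma dif_eq f z (L L' : V -> W) : L =1 L' ->
  dif NV NW f z L -> dif NV NW f z L'.
Proof. by move=> /funext ->. Qed.

Lemma dif_comp (X : zmodType) (NX : X -> R) (f : V -> W) (g : W -> X) z L M :
  is_norm NX -> (forall a b, M (a - b) = M a - M b) ->
  dif NV NW f z L -> dif NW NX g (f z) M ->
  dif NV NX (g \o f) z (M \o L).
Proof.
move=> hX Mlin hf hg; have [NX0 NXge NXtri _] := hX.
have [Kf Kf0 hKf] := dif_bound hf.
have [K [d [K0 d0 hd]]] := dif_lip hf.
have [KM KM0 hKM] : exists2 K : R, 0 <= K & forall w, NX (M w) <= K * NW w.
  case: hg => -[K' hK'] _; exists `|K'| => // w; rewrite (le_trans (hK' w))//.
  by rewrite ler_wpM2r// ler_norm.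
split.
  exists (KM * Kf) => w; rewrite (le_trans (hKM _))// -mulrA ler_wpM2l//.
have o2 := is_ooZ NV0 KM0 hf.2.
pose r w := NX (g (f (z + w)) - g (f z) - M (f (z + w) - f z)).
have o1 : is_oo NV r.
  move=> e e0; have K1 : 0 < K + 1 by lra.
  have [d' d'0 hd'] := hg.2 (e / (K + 1)) (divr_gt0 e0 K1).
  exists (Num.min d (d' / (K + 1))); first by rewrite lt_min d0 divr_gt0.
  move=> w; rewrite lt_min ltr_pdivlMr// => /andP[/hd h1 h2].
  have h3 : NW (f (z + w) - f z) < d' by have := NV0 w; nra.
  have := hd' _ h3; rewrite (addrC (f z)) subrK => h4.
  rewrite /r (le_trans h4)//.
  have q0 : 0 < e / (K + 1) by rewrite divr_gt0.
  rewrite (le_trans (ler_wpM2l (ltW q0) h1))// mulrA ler_wpM2r//.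
  by rewrite -mulrA ger_pMr// mulrC ler_pdivrMr// mul1r; lra.
apply: (is_oo_le d0 _ (is_ooD NV0 o1 o2)) => w _ /=.
rewrite (le_trans _ (lerD (lexx _) (hKM _)))// Mlin.
rewrite (le_trans _ (NXtri _ _))//.
by rewrite addrA subrK.
Qed.

End Codomain.

Local Notation difC := (dif NV (@cabs R)).

Lemma dif_cst (c : C) z : difC (fun=> c) z (fun=> 0).
Proof.
split; first by exists 0 => w; rewrite cabs0 mul0r.
by move=> e e0; exists 1 => // w _; rewrite subrr subr0 cabs0 mulr_ge0// ltW.
Qed.

Lemma difD (f g : V -> C) z L M : difC f z L -> difC g z M ->
  difC (fun w => f w + g w) z (fun w => L w + M w).
Proof.
move=> hf hg; have [K K0 hK] := dif_bound hf; have [K' K'0 hK'] := dif_bound hg.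
split; first by exists (K + K') => w; rewrite (le_trans (cabsD _ _))// mulrDl lerD.
apply: (is_oo_le ltr01 _ (is_ooD NV0 hf.2 hg.2)) => w _.
by rewrite (le_trans _ (cabsD _ _))//; rewrite le_eqVlt; apply/orP; left; apply/eqP; congr cabs; ring.
Qed.

Lemma difM (f g : V -> C) z L M : difC f z L -> difC g z M ->
  difC (fun w => f w * g w) z (fun w => f z * M w + g z * L w).
Proof.
move=> hf hg; have [K K0 hK] := dif_bound hf; have [K' K'0 hK'] := dif_bound hg.
have [Kf [d [Kf0 d0 hd]]] := dif_lip cabs_is_norm hf.
have [Kg [d' [Kg0 d'0 hd']]] := dif_lip cabs_is_norm hg.
split.
  exists (cabs (f z) * K' + cabs (g z) * K) => w.
  rewrite (le_trans (cabsD _ _))// mulrDl !cabsM -!mulrA.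
  by rewrite lerD// ler_wpM2l// cabs_ge0.
have o1 := is_ooZ NV0 (cabs_ge0 (f z)) hg.2.
have o2 := is_ooZ NV0 (cabs_ge0 (g z)) hf.2.
have o3 := is_ooD NV0 (is_ooD NV0 o1 o2) (is_oo_quad NV0 (Kf * Kg)).
have dd : 0 < Num.min d d' by rewrite lt_min d0.
apply: (is_oo_le dd _ o3) => w; rewrite lt_min => /andP[/hd h1 /hd' h2].
have -> : f (z + w) * g (z + w) - f z * g z - (f z * M w + g z * L w) =
  f z * (g (z + w) - g z - M w) + g z * (f (z + w) - f z - L w) +
  (f (z + w) - f z) * (g (z + w) - g z) by ring.
rewrite (le_trans (cabsD _ _))// lerD//.
  by rewrite (le_trans (cabsD _ _))// !cabsM.
rewrite cabsM (le_trans (ler_pM _ _ h1 h2)) ?cabs_ge0//.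
by rewrite le_eqVlt; apply/orP; left; apply/eqP; ring.
Qed.

(** The exact remainder has denominator [f z ^+ 2 * f (z + w)]; near z the last factor is at least
    |f z| / 2 in modulus, whence the constant 2 / |f z|^3. *)
Lemma difI (f : V -> C) z L : f z != 0 -> difC f z L ->
  difC (fun w => (f w)^-1) z (fun w => - (L w / f z ^+ 2)).
Proof.
move=> fz0 hf; have [K K0 hK] := dif_bound hf.
have [Kf [d [Kf0 d0 hd]]] := dif_lip cabs_is_norm hf.
have cf : 0 < cabs (f z) by rewrite cabs_gt0.
have [|d' d'0 hd'] := dif_continuous (e := cabs (f z) / 2) cabs_is_norm hf; first lra.
split.
  exists (K / cabs (f z) ^+ 2) => w; rewrite cabsN cabsM cabsV cabsX mulrAC.
  by rewrite ler_wpM2r// invr_ge0 exprn_ge0// ltW.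
have c0 : 0 <= 2 / cabs (f z) ^+ 3 by rewrite divr_ge0// exprn_ge0// ltW.
have o1 := is_ooZ NV0 (cabs_ge0 (f z)) hf.2.
have o2 := is_ooZ NV0 c0 (is_ooD NV0 o1 (is_oo_quad NV0 (K * Kf))).
have dd : 0 < Num.min d d' by rewrite lt_min d0.
apply: (is_oo_le dd _ o2) => w; rewrite lt_min => /andP[/hd h1 /hd' h2].
have hG : cabs (f z) / 2 <= cabs (f (z + w)).
  have := cabs_sub_le (f z) (f (z + w)); rewrite cabsBC; lra.
have G0 : f (z + w) != 0 by rewrite -cabs_gt0; lra.
have -> : (f (z + w))^-1 - (f z)^-1 - - (L w / f z ^+ 2) =
   (- (f z * (f (z + w) - f z - L w)) + L w * (f (z + w) - f z)) /
     (f z ^+ 2 * f (z + w)).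
  by field; rewrite fz0 G0.
rewrite cabsM cabsV mulrC; apply: ler_pM; rewrite ?invr_ge0 ?cabs_ge0//.
  rewrite cabsM cabsX -invf_div.
  have c3 : 0 < cabs (f z) ^+ 3 / 2 by rewrite divr_gt0// exprn_gt0.
  have le3 : cabs (f z) ^+ 3 / 2 <= cabs (f z) ^+ 2 * cabs (f (z + w)).
    by rewrite exprSr -mulrA ler_wpM2l// exprn_ge0// ltW.
  by rewrite lef_pV2 ?posrE// (lt_le_trans c3).
rewrite (le_trans (cabsD _ _))// cabsN lerD//; first by rewrite cabsM.
rewrite cabsM (le_trans (ler_pM _ _ (hK w) h1)) ?cabs_ge0//.
by rewrite le_eqVlt; apply/orP; left; apply/eqP; ring.
Qed.

Lemma difB (f g : V -> C) z L M : difC f z L -> difC g z M ->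
  difC (fun w => f w - g w) z (fun w => L w - M w).
Proof.
move=> hf hg; have h := difD hf (difM (dif_cst (-1) z) hg).
apply: (dif_eq (L := fun w => L w + (-1 * M w + g z * 0))) => [w|].
  by rewrite mulr0 addr0 mulN1r.
by move: h; under eq_fun do rewrite mulN1r.
Qed.

End Dif.

Lemma dif_id (V : zmodType) (N : V -> R) z : is_norm N -> dif N N id z id.
Proof.
move=> hN; have [N0 Nge _ _] := hN; split.
  by exists 1 => w; rewrite mul1r.
by move=> e e0; exists 1 => // w _; rewrite /= (addrC z w) addrK subrr N0 mulr_ge0// ltW.
Qed.

End Differentials.

(** * Goursat's lemma and Cauchy's estimate *)

Section Goursat.
Variable R : realType.
Local Notation C := (R[i]).
Local Notation difC := (dif (@cabs R) (@cabs R)).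

(** Stands for the vanishing of a contour integral, whose Riemann sums are the sequence [s]. *)
Definition vanishes (s : nat -> C) :=
  forall c : R, 0 < c -> exists n0, forall n, (n0 <= n)%N -> cabs (s n) <= c.

Lemma vanishesD s t : vanishes s -> vanishes t -> vanishes (fun n => s n + t n).
Proof.
move=> hs ht c c0; have c20 : 0 < c / 2 by lra.
have [n hn] := hs _ c20; have [m hm] := ht _ c20.
exists (maxn n m) => p; rewrite geq_max => /andP[/hn h1 /hm h2].
by rewrite (le_trans (cabsD _ _))//; lra.
Qed.

Section Contour.
Variable g : C -> C.
Implicit Types (x y l : R) (n : nat).

(** With 2^n equal steps, cutting a segment into halves lowers [n] by one, and the subdivision of a
    contour becomes an exact identity between sums. *)
Definition hsum x y l n : C := (l / 2 ^+ n)%:C%C *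
  \sum_(m < 2 ^ n) g ((x + m%:R * (l / 2 ^+ n)) +i* y)%C.

Definition vsum x y l n : C := (l / 2 ^+ n)%:C%C *
  \sum_(m < 2 ^ n) g (x +i* (y + m%:R * (l / 2 ^+ n)))%C.

(* Riemann sum for the contour integral of [g] over the boundary of the square
   with lower left corner (x, y) and side l. *)
Definition csum x y l n : C :=
  hsum x y l n - hsum x (y + l) l n + 'i%C * (vsum (x + l) y l n - vsum x y l n).

Let half_step l n : (l + l) / 2 ^+ n.+1 = l / 2 ^+ n.
Proof. by rewrite exprS; field; rewrite expf_neq0. Qed.

Let full_step l n : (2 ^ n)%:R * (l / 2 ^+ n) = l.
Proof. by rewrite natrX mulrC divfK// expf_neq0. Qed.

Let sum_split (F : nat -> C) n :
  \sum_(m < 2 ^ n.+1) F m = \sum_(m < 2 ^ n) F m + \sum_(m < 2 ^ n) F ((2 ^ n)%N + m)%N.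
Proof.
by rewrite expnS mul2n -addnn big_split_ord.
Qed.

Lemma hsum_split x y l n :
  hsum x y (l + l) n.+1 = hsum x y l n + hsum (x + l) y l n.
Proof.
rewrite /hsum half_step (sum_split (fun m => g ((x + m%:R * _) +i* y)%C)) mulrDr.
congr (_ + _ * _); apply: eq_bigr => m _; congr (g (_ +i* _)%C).
by rewrite natrD mulrDl full_step addrA.
Qed.

Lemma vsum_split x y l n :
  vsum x y (l + l) n.+1 = vsum x y l n + vsum x (y + l) l n.
Proof.
rewrite /vsum half_step (sum_split (fun m => g (x +i* (y + m%:R * _))%C)) mulrDr.
congr (_ + _ * _); apply: eq_bigr => m _; congr (g (_ +i* _)%C).
by rewrite natrD mulrDl full_step addrA.
Qed.

(** Sums over an edge common to two quarters use the same nodes with opposite signs and cancel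
    exactly. *)
Lemma csum_split x y l n : csum x y (l + l) n.+1 =
  csum x y l n + csum (x + l) y l n + csum x (y + l) l n +
  csum (x + l) (y + l) l n.
Proof. by rewrite /csum !hsum_split !vsum_split !addrA; ring. Qed.

Lemma hsum_bound x y l n M : 0 <= l ->
  (forall u, x <= u <= x + l -> cabs (g (u +i* y)%C) <= M) ->
  cabs (hsum x y l n) <= l * M.
Proof.
move=> l0 hM; have d0 : 0 <= l / 2 ^+ n by rewrite divr_ge0// exprn_ge0.
rewrite /hsum cabsM cabs_real ger0_norm// -[in leRHS](full_step l n).
rewrite [leRHS]mulrAC [leRHS]mulrC ler_wpM2l//.
rewrite (le_trans (cabs_sum _ _ _))//.
rewrite (@le_trans _ _ (\sum_(m < 2 ^ n) M))//; last first.
  by rewrite sumr_const card_ord mulr_natl.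
apply: ler_sum => m _; apply: hM; rewrite lerDl mulr_ge0//= lerD2l.
by rewrite -[leRHS](full_step l n) ler_wpM2r// ler_nat ltnW.
Qed.

Lemma vsum_bound x y l n M : 0 <= l ->
  (forall v, y <= v <= y + l -> cabs (g (x +i* v)%C) <= M) ->
  cabs (vsum x y l n) <= l * M.
Proof.
move=> l0 hM; have d0 : 0 <= l / 2 ^+ n by rewrite divr_ge0// exprn_ge0.
rewrite /vsum cabsM cabs_real ger0_norm// -[in leRHS](full_step l n).
rewrite [leRHS]mulrAC [leRHS]mulrC ler_wpM2l//.
rewrite (le_trans (cabs_sum _ _ _))//.
rewrite (@le_trans _ _ (\sum_(m < 2 ^ n) M))//; last first.
  by rewrite sumr_const card_ord mulr_natl.
apply: ler_sum => m _; apply: hM; rewrite lerDl mulr_ge0//= lerD2l.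
by rewrite -[leRHS](full_step l n) ler_wpM2r// ler_nat ltnW.
Qed.

Lemma csum_bound x y l n M : 0 <= l ->
  (forall u v, x <= u <= x + l -> y <= v <= y + l ->
     [|| u == x, u == x + l, v == y | v == y + l] -> cabs (g (u +i* v)%C) <= M) ->
  cabs (csum x y l n) <= 4 * l * M.
Proof.
move=> l0 hM.
have hx : x <= x <= x + l by rewrite lexx lerDl.
have hx' : x <= x + l <= x + l by rewrite lexx lerDl l0.
have hy : y <= y <= y + l by rewrite lexx lerDl.
have hy' : y <= y + l <= y + l by rewrite lexx lerDl l0.
have h1 := @hsum_bound x y l n M l0 (fun u hu => hM u y hu hy (introT or4P (Or43 _ _ _ (eqxx _)))).
have h2 := @hsum_bound x (y + l) l n M l0 (fun u hu => hM u (y + l) hu hy' (introT or4P (Or44 _ _ _ (eqxx _)))).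
have h3 := @vsum_bound x y l n M l0 (fun v hv => hM x v hx hv (introT or4P (Or41 _ _ _ (eqxx _)))).
have h4 := @vsum_bound (x + l) y l n M l0 (fun v hv => hM (x + l) v hx' hv (introT or4P (Or42 _ _ _ (eqxx _)))).
rewrite /csum (le_trans (cabsD _ _))// cabsM cabs_i mul1r.
have := cabsB (hsum x y l n) (hsum x (y + l) l n).
have := cabsB (vsum (x + l) y l n) (vsum x y l n).
lra.
Qed.

End Contour.

Lemma csumE g x y l n : csum g x y l n = (l / 2 ^+ n)%:C%C *
  \sum_(m < 2 ^ n) let d := m%:R * (l / 2 ^+ n) in
    (g ((x + d) +i* y)%C - g ((x + d) +i* (y + l))%C +
     'i%C * (g ((x + l) +i* (y + d))%C - g (x +i* (y + d))%C)).
Proof.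
rewrite /csum /hsum /vsum big_split/= sumrB -mulr_sumr sumrB !mulrBr mulrDr !mulrBr.
by ring.
Qed.

Lemma csum_combine g1 g2 g (c : C) x y l n :
  (forall z, g z = g1 z + c * g2 z) ->
  csum g x y l n = csum g1 x y l n + c * csum g2 x y l n.
Proof.
move=> gE; rewrite !csumE mulrCA -mulrDr; congr (_ * _).
by rewrite mulr_sumr -big_split/=; apply: eq_bigr => m _; rewrite !gE; ring.
Qed.

(** Opposite sides carry matching nodes, so each difference of an affine map is a constant; the
    horizontal one, -i q l, cancels the vertical one term by term. No limit is involved. *)
Lemma csum_affine (p q : C) x y l n : csum (fun z => p + q * z) x y l n = 0.
Proof.
rewrite csumE big1 ?mulr0// => m _ /=.
set d := m%:R * _; move: d => d.
have E (u v : R) : (u +i* v)%C = u%:C%C + 'i%C * v%:C%C by rewrite [LHS]complexRI.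
have i2 : 'i%C * 'i%C = -1 :> C by rewrite -expr2 sqr_i.
rewrite (E (x + d) y) (E (x + d) (y + l)) (E (x + l) (y + d)) (E x (y + d)) !rmorphD /=.
transitivity ((- q * l%:C%C * 'i%C) + q * l%:C%C * 'i%C); first by ring.
by rewrite mulNr mulNr addNr.
Qed.

(** The property of being eventually at most [cc] times the area passes from the four quarters to a
    square, and holds on small squares around a point by differentiability. Bisection extends it to
    the whole square, where [cc * (l * l)] is [c]. *)
Lemma goursat g x y l : 0 < l ->
  (forall u v, x <= u <= x + l -> y <= v <= y + l ->
    exists q, difC g (u +i* v)%C (fun w => q * w)) ->
  vanishes (csum g x y l).
Proof.
move=> l0 hg c c0.
pose P (a : bool -> R) (l : R) := exists n0, forall n, (n0 <= n)%N ->
  cabs (csum g (a false) (a true) l n) <= (c / (l * l)) * (l * l).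
pose cc := c / (l * l); have cc0 : 0 < cc by rewrite divr_gt0// mulr_gt0.
pose Q (a : bool -> R) (l : R) := exists n0, forall n, (n0 <= n)%N ->
  cabs (csum g (a false) (a true) l n) <= cc * (l * l).
suff [n0 hn0] : Q (fun b => if b then y else x) l.
  exists n0 => n /hn0; rewrite /cc divfK// mulf_neq0// gt_eqF//.
apply: cube_bisection => //.
- move=> a l' l'0 hb.
  pose bb (b1 b2 : bool) : {ffun bool -> bool} := [ffun b => if b then b2 else b1].
  have [n1 h1] := hb (bb false false); have [n2 h2] := hb (bb true false).
  have [n3 h3] := hb (bb false true); have [n4 h4] := hb (bb true true).
  exists (maxn (maxn n1 n2) (maxn n3 n4)).+1 => -[//|n].
  rewrite ltnS !geq_max => /andP[/andP[/h1 + /h2 +] /andP[/h3 + /h4 +]].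
  rewrite /subcube_corner !ffunE/= !mul0r !mul1r !addr0 => k1 k2 k3 k4.
  have -> : l' = l' / 2 + l' / 2 by field.
  rewrite csum_split.
  have := cabsD (csum g (a false) (a true) (l' / 2) n + csum g (a false + l' / 2) (a true) (l' / 2) n +
      csum g (a false) (a true + l' / 2) (l' / 2) n) (csum g (a false + l' / 2) (a true + l' / 2) (l' / 2) n).
  have := cabsD (csum g (a false) (a true) (l' / 2) n + csum g (a false + l' / 2) (a true) (l' / 2) n)
      (csum g (a false) (a true + l' / 2) (l' / 2) n).
  have := cabsD (csum g (a false) (a true) (l' / 2) n) (csum g (a false + l' / 2) (a true) (l' / 2) n).
  have -> : cc * ((l' / 2 + l' / 2) * (l' / 2 + l' / 2)) = 4 * (cc * (l' / 2 * (l' / 2))) by ring.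
  lra.
- move=> p hp.
  have [q hq] := hg (p false) (p true) (hp false) (hp true).
  set z := (p false +i* p true)%C in hq.
  (* Points of a square of side l' are at distance at most 2 l' from z, and the perimeter is 4 l':
     the bound is cc / 8 * 2 l' * 4 l' = cc * l'^2. *)
  have c80 : 0 < cc / 8 by lra.
  have [d d0 hd] := hq.2 _ c80.
  exists (d / 2); first lra.
  move=> a l' l'0 l'd ha; exists 0%N => n _.
  pose e w := g w - g z - q * (w - z).
  have -> : csum g (a false) (a true) l' n = csum e (a false) (a true) l' n.
    rewrite (@csum_combine e (fun w => (g z - q * z) + q * w) g 1) ?csum_affine ?mulr0 ?addr0//.
    by move=> w; rewrite /e; ring.
  rewrite (le_trans (csum_bound (M := cc / 8 * (2 * l')) n (ltW l'0) _))//; last first.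
    by rewrite le_eqVlt; apply/orP; left; apply/eqP; field.
  move=> u v hu hv _.
  set w := (u +i* v)%C.
  have wz : cabs (w - z) <= 2 * l'.
    rewrite (le_trans (cabs_le _))//=.
    have := ha false; have := ha true; move: hu hv => /andP[? ?] /andP[? ?] /andP[? ?] /andP[? ?].
    have : `|u - p false| <= l' by rewrite ler_norml; apply/andP; split; lra.
    have : `|v - p true| <= l' by rewrite ler_norml; apply/andP; split; lra.
    lra.
  have := hd (w - z); rewrite (addrC z) subrK => hd'.
  rewrite /e (le_trans (hd' _))//; first lra.
  by rewrite ler_wpM2l// ltW.
Qed.

(* The centered square of side [4 k] minus the one of side [2 k] is tiled by
   twelve squares avoiding 0, so the singularity is pushed to arbitrarily small
   squares, where [g z = o(1 / |z|)] beats the perimeter. *)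
Lemma goursat_punctured g r : 0 < r ->
  (forall u v, `|u| <= r -> `|v| <= r -> (u != 0) || (v != 0) ->
    exists q, difC g (u +i* v)%C (fun w => q * w)) ->
  (forall e, 0 < e -> exists2 d : R, 0 < d &
    forall z, cabs z < d -> cabs (g z) * cabs z <= e) ->
  vanishes (csum g (- r) (- r) (r + r)).
Proof.
move=> r0 hg hsing.
pose U (s b : R) := forall c, 0 < c -> exists n0, forall n, (n0 <= n)%N ->
  cabs (csum g (- s) (- s) (s + s) n) <= b + c.
(* The levels [n.+2] and [n.+1] are those at which both sums split into squares of side k at the
   same level n: sixteen squares against the four inner ones. *)
have ring_step k : 0 < k -> k + k <= r ->
    vanishes (fun n => csum g (- (k + k)) (- (k + k)) ((k + k) + (k + k)) n.+2 -
                       csum g (- k) (- k) (k + k) n.+1).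
  move=> k0 kr.
  have sq x y : (x == - (k + k)) || (x == k) || (y == - (k + k)) || (y == k) ->
      - (k + k) <= x <= k -> - (k + k) <= y <= k -> vanishes (csum g x y k).
    move=> xy /andP[? ?] /andP[? ?]; apply: goursat => // u v /andP[? ?] /andP[? ?].
    apply: hg; rewrite ?ler_norml; try by apply/andP; split; lra.
    by move: xy => /orP[/orP[/orP[]|]|] /eqP xE;
      first [apply/orP; left; apply/eqP => u0; lra | apply/orP; right; apply/eqP => v0; lra].
  have i1 : - (k + k) <= - (k + k) <= k by apply/andP; split; lra.
  have i2 : - (k + k) <= - k <= k by apply/andP; split; lra.
  have i3 : - (k + k) <= 0 <= k by apply/andP; split; lra.
  have i4 : - (k + k) <= k <= k by apply/andP; split; lra.
  suff : vanishes (fun n =>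
    (csum g (- (k + k)) (- (k + k)) k n + csum g (- k) (- (k + k)) k n + csum g (- (k + k)) (- k) k n)
    + ((csum g 0 (- (k + k)) k n + csum g k (- (k + k)) k n + csum g k (- k) k n)
    + ((csum g (- (k + k)) 0 k n + csum g (- (k + k)) k k n + csum g (- k) k k n)
    + (csum g k 0 k n + csum g 0 k k n + csum g k k k n)))).
    move=> h c c0; have [n0 hn0] := h c c0; exists n0 => n /hn0; apply: le_trans.
    rewrite le_eqVlt; apply/orP; left; apply/eqP; congr cabs.
    rewrite !csum_split.
    have -> : - (k + k) + k = - k by ring.
    have -> : - (k + k) + (k + k) = 0 by ring.
    have -> : - k + k = 0 by ring.
    by rewrite !add0r; ring.
  by apply: (vanishesD (vanishesD (vanishesD _ _) _) (vanishesD (vanishesD (vanishesD _ _) _) (vanishesD (vanishesD (vanishesD _ _) _) (vanishesD (vanishesD _ _) _))));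
    apply: sq; rewrite ?eqxx ?orbT ?i1 ?i2 ?i3 ?i4.
have Uhalf k b : 0 < k -> k + k <= r -> U k b -> U (k + k) b.
  move=> k0 kr hU c c0; have c20 : 0 < c / 2 by lra.
  have [n hn] := ring_step k k0 kr _ c20; have [m hm] := hU _ c20.
  exists (maxn n m).+2 => -[//|[//|p]]; rewrite !ltnS geq_max => /andP[/hn h1 mp].
  have /hm h2 : (m <= p.+1)%N by rewrite ltnW.
  have := cabs_sub_le (csum g (- (k + k)) (- (k + k)) (k + k + (k + k)) p.+2) (csum g (- k) (- k) (k + k) p.+1).
  lra.
have Uiter j b : U (r / 2 ^+ j) b -> U r b.
  elim: j => [|j IH]; first by rewrite expr0 divr1.
  move=> h; apply: IH; have p0 : (0 : R) < 2 ^+ j by rewrite exprn_gt0.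
  have -> : r / 2 ^+ j = r / 2 ^+ j.+1 + r / 2 ^+ j.+1 by rewrite exprS; field; rewrite gt_eqF.
  apply: Uhalf => //; first by rewrite divr_gt0// exprn_gt0.
  have -> : r / 2 ^+ j.+1 + r / 2 ^+ j.+1 = r / 2 ^+ j by rewrite exprS; field; rewrite gt_eqF.
  have p1 : (1 : R) <= 2 ^+ j by rewrite exprn_ege1// ler1n.
  rewrite ler_pdivrMr//; nra.
(* On the boundary of the square of half side s, |z| >= s gives |g z| <= c / (16 s); the perimeter 8
   s leaves c / 2, and the other half of c absorbs the limit. *)
move=> c c0; have c160 : 0 < c / 16 by lra.
have [d d0 hd] := hsing _ c160.
have [j hj] : exists j, r / 2 ^+ j < d / 2.
  have d20 : 0 < d / 2 by lra.
  have := archi_boundP (ltW (divr_gt0 r0 d20)); set m := Num.bound _ => hm.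
  exists m; rewrite ltr_pdivrMr ?exprn_gt0// mulrC -ltr_pdivrMr//.
  by rewrite (lt_le_trans hm)// -natrX ler_nat ltnW// ltn_expl.
set s := r / 2 ^+ j in hj.
have s0 : 0 < s by rewrite divr_gt0// exprn_gt0.
have hU : U s (c / 2).
  move=> c' c'0; exists 0%N => n _; rewrite (le_trans (y := c / 2))//; last lra.
  rewrite (le_trans (csum_bound (M := c / 16 / s) n _ _))//; first lra.
  - move=> u v hu hv bd.
    have su : (`|u| == s) || (`|v| == s).
      have e1 : - s + (s + s) = s by ring.
      rewrite e1 in bd; case/or4P: bd => /eqP ->; rewrite ?normrN ?(gtr0_norm s0) ?eqxx ?orbT//.
    have zs : s <= cabs (u +i* v)%C.
      by case/orP: su => /eqP <-; [exact: (Re_le_cabs (u +i* v)%C)|exact: (Im_le_cabs (u +i* v)%C)].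
    have zd : cabs (u +i* v)%C < d.
      have := cabs_le (u +i* v)%C; rewrite /=.
      have : `|u| <= s by rewrite ler_norml; move: hu => /andP[? ?]; apply/andP; split; lra.
      have : `|v| <= s by rewrite ler_norml; move: hv => /andP[? ?]; apply/andP; split; lra.
      lra.
    by rewrite ler_pdivlMr// (le_trans _ (hd _ zd))// ler_wpM2l// cabs_ge0.
  - by rewrite le_eqVlt; apply/orP; left; apply/eqP; field; rewrite gt_eqF.
have c20 : 0 < c / 2 by lra.
have [n0 hn0] := Uiter j _ hU _ c20; exists n0 => n /hn0; lra.
Qed.

End Goursat.

Section CauchyEstimate.
Variable R : realType.
Local Notation C := (R[i]).
Local Notation difC := (dif (@cabs R) (@cabs R)).

(** A lower bound replaces the value 2 pi i. By symmetry the four terms of a step add up to i times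
    4 r / (x^2 + r^2), a positive number that is at least 2 / r since x^2 <= r^2; the steps have
    total length 2 r. *)
Lemma csum_inv_ge r n : 0 < r -> 4 <= cabs (csum (fun z : C => z^-1) (- r) (- r) (r + r) n).
Proof.
move=> r0; rewrite csumE; set dl := (r + r) / 2 ^+ n.
have dl0 : 0 < dl by rewrite divr_gt0 ?exprn_gt0//; lra.
have E (u v : R) : (u +i* v)%C = u%:C%C + 'i%C * v%:C%C by rewrite [LHS]complexRI.
have termE (x : R) : ((x +i* - r)%C^-1 - (x +i* r)%C^-1 +
    'i%C * ((r +i* x)%C^-1 - (- r +i* x)%C^-1)) = 'i%C * (4 * r / (x ^+ 2 + r ^+ 2))%:C%C :> C.
  have i2 : ('i%C : C) ^+ 2 = -1 by rewrite sqr_i.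
  have xr : 0 < x ^+ 2 + r ^+ 2 by have := sqr_ge0 x; nra.
  have nz (u v : R) : u ^+ 2 + v ^+ 2 = x ^+ 2 + r ^+ 2 -> (u +i* v)%C != 0.
    by move=> uv; rewrite -cabs_eq0 -sqrf_eq0 cabs_sqr/= uv gt_eqF.
  have n1 := nz x (- r); have n2 := nz x r; have n3 := nz r x; have n4 := nz (- r) x.
  have inv (u v : R) : u ^+ 2 + v ^+ 2 = x ^+ 2 + r ^+ 2 ->
      (u +i* v)%C^-1 = (u +i* - v)%C * ((x ^+ 2 + r ^+ 2)^-1)%:C%C.
    move=> uv; apply: (mulfI (nz _ _ uv)); rewrite mulfV ?nz//.
    rewrite mulrA; have -> : (u +i* v)%C * (u +i* - v)%C = (u ^+ 2 + v ^+ 2)%:C%C :> C.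
      by apply/eqP; rewrite eq_complex/=; apply/andP; split; apply/eqP; ring.
    by rewrite uv -rmorphM/= mulfV ?rmorph1// gt_eqF.
  rewrite !inv ?sqrrN//; try by rewrite addrC.
  rewrite (E x (- - r)) (E x (- r)) (E r (- x)) (E (- r) (- x)) !rmorphM/= !rmorphN/= !rmorph_nat.
  set iv := ((_)^-1)%:C%C; set ci := 'i%C; rewrite -/ci in i2.
  transitivity (iv * (2 * ci * r%:C%C + ci * (2 * r%:C%C))); last by ring.
  by ring.
rewrite cabsM cabs_real gtr0_norm//.
pose S : R := \sum_(m < 2 ^ n) 4 * r / ((- r + m%:R * dl) ^+ 2 + r ^+ 2).
have -> : \sum_(m < 2 ^ n) (let d := m%:R * dl in
    (((- r + d) +i* - r)%C^-1 - ((- r + d) +i* (- r + (r + r)))%C^-1 +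
     'i%C * (((- r + (r + r)) +i* (- r + d))%C^-1 - (- r +i* (- r + d))%C^-1))) = 'i%C * S%:C%C :> C.
  rewrite /S rmorph_sum mulr_sumr; apply: eq_bigr => m _ /=.
  have -> : - r + (r + r) = r by ring.
  exact: termE.
have S_ge : (2 ^+ n) * (2 / r) <= S.
  have -> : 2 ^+ n * (2 / r) = \sum_(m < 2 ^ n) (2 / r).
    by rewrite sumr_const card_ord -[RHS]mulr_natl natrX.
  apply: ler_sum => m _; set x := - r + m%:R * dl.
  have xr : x ^+ 2 <= r ^+ 2.
    rewrite -real_normK ?num_real// ler_sqr ?nnegrE ?normr_ge0 ?(ltW r0)//.
    have m1 : m%:R * dl <= r + r.
      have -> : r + r = (2 ^+ n) * dl by rewrite mulrC divfK// expf_neq0.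
      by rewrite ler_wpM2r ?(ltW dl0)// -natrX ler_nat ltnW.
    have m0 : 0 <= m%:R * dl by rewrite mulr_ge0// ltW.
    by rewrite ler_norml /x; apply/andP; split; lra.
  have x0 := sqr_ge0 x.
  rewrite ler_pdivlMr; last nra.
  rewrite mulrAC ler_pdivrMr//; nra.
rewrite cabsM cabs_i mul1r cabs_real.
rewrite (le_trans _ (ler_wpM2l (ltW dl0) (ler_norm _)))//.
rewrite (le_trans _ (ler_wpM2l (ltW dl0) S_ge))//.
by rewrite le_eqVlt; apply/orP; left; apply/eqP; rewrite /dl; field; rewrite expf_neq0// gt_eqF.
Qed.

(* Goursat applied to [(h z - h 0 - l z) / z ^ 2], which is [o(1 / |z|)] at 0. *)
Lemma cauchy_estimate h (l : C) r M : 0 < r ->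
  (forall u v, `|u| <= r -> `|v| <= r ->
     (exists q, difC h (u +i* v)%C (fun w => q * w)) /\ cabs (h (u +i* v)%C) <= M) ->
  difC h 0 (fun w => l * w) ->
  cabs l <= 4 * M / r.
Proof.
move=> r0 hh hl.
pose g z := (h z - h 0 - l * z) * (z^-1 * z^-1).
have vg : vanishes (csum g (- r) (- r) (r + r)).
  apply: goursat_punctured => //.
    move=> u v ur vr uv; have [[q hq] _] := hh u v ur vr.
    have z0 : (u +i* v)%C != 0 by rewrite eq_complex/= negb_and.
    have hid := dif_id (u +i* v)%C (cabs_is_norm R).
    have hi := difI (cabs_is_norm R) z0 hid.
    have h1 := difB (cabs_is_norm R) hq (dif_cst (cabs_is_norm R) (h 0) (u +i* v)%C).
    have h2 := difM (cabs_is_norm R) (dif_cst (cabs_is_norm R) l (u +i* v)%C) hid.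
    have h3 := difM (cabs_is_norm R) (difB (cabs_is_norm R) h1 h2) (difM (cabs_is_norm R) hi hi).
    set z := (u +i* v)%C in z0 h1 h2 h3 *.
    exists ((h z - h 0 - l * z) * (- 2 * (z^-1) ^+ 3) + z^-1 * z^-1 * (q - l)).
    by apply: dif_eq h3 => w /=; field.
  move=> e e0; have [d d0 hd] := hl.2 _ e0; exists d => // z /hd; rewrite add0r => hz.
  have [->|z0] := eqVneq z 0; first by rewrite cabs0 mulr0 ltW.
  have cz : 0 < cabs z by rewrite cabs_gt0.
  rewrite /g !cabsM cabsV -mulrA -mulrA mulVf ?gt_eqF// mulr1 ler_pdivrMr//.
(* The function (h z - h 0) / z^2 is g z + l / z. On the boundary it is at most 2 M / r^2, over a
   perimeter 8 r, whereas l / z contributes at least 4 |l|. *)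
have key c : 0 < c -> 4 * cabs l <= 16 * M / r + c.
  move=> c0; have [n hn] := vg _ c0; have {}hn := hn n (leqnn n).
  pose k z := (h z - h 0) * (z^-1 * z^-1).
  have E : csum k (- r) (- r) (r + r) n = csum g (- r) (- r) (r + r) n +
       l * csum (fun z : C => z^-1) (- r) (- r) (r + r) n.
    apply: csum_combine => z; rewrite /k /g.
    (* The identity persists at 0 by the convention that the inverse of 0 is 0. *)
    have [->|z0] := eqVneq z 0; first by rewrite !invr0 !mulr0 addr0.
    by field.
  have kb : cabs (csum k (- r) (- r) (r + r) n) <= 4 * (r + r) * (2 * M / (r * r)).
    apply: csum_bound; first lra.
    move=> u v hu hv bd.
    have su : (`|u| == r) || (`|v| == r).
      have e1 : - r + (r + r) = r by ring.
      by rewrite e1 in bd; case/or4P: bd => /eqP ->; rewrite ?normrN ?(gtr0_norm r0) ?eqxx ?orbT.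
    have zs : r <= cabs (u +i* v)%C.
      by case/orP: su => /eqP <-; [exact: (Re_le_cabs (u +i* v)%C)|exact: (Im_le_cabs (u +i* v)%C)].
    have h1 : cabs (h (u +i* v)%C) <= M.
      by apply: (hh _ _ _ _).2; rewrite ler_norml; [move: hu|move: hv] => /andP[? ?]; apply/andP; split; lra.
    have h0 : cabs (h 0) <= M.
      by apply: (hh 0 0 _ _).2; rewrite normr0 ltW.
    have M0 : 0 <= M by rewrite (le_trans (cabs_ge0 _) h0).
    rewrite /k !cabsM !cabsV; have h2 := cabsB (h (u +i* v)%C) (h 0).
    apply: ler_pM; rewrite ?mulr_ge0 ?invr_ge0 ?cabs_ge0//; first lra.
    by rewrite -invfM lef_pV2 ?posrE ?mulr_gt0//; nra.
  have i4 := csum_inv_ge n r0.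
  have : cabs (l * csum (fun z : C => z^-1) (- r) (- r) (r + r) n) <=
     cabs (csum k (- r) (- r) (r + r) n) + cabs (csum g (- r) (- r) (r + r) n).
    by rewrite (le_trans _ (cabsB _ _))// E addrAC subrr add0r.
  rewrite cabsM => h5.
  have -> : 16 * M / r = 4 * (r + r) * (2 * M / (r * r)) by field; rewrite gt_eqF.
  have := cabs_ge0 l; nra.
have : 4 * cabs l <= 16 * M / r by apply/ler_addgt0Pr => c c0; exact: key.
have -> : 16 * M / r = 4 * (4 * M / r) by ring.
lra.
Qed.

End CauchyEstimate.

(** * Cauchy estimates in several variables *)

Section SeveralVariables.
Variable R : realType.
Local Notation C := (R[i]).
Local Notation difC := (dif (@cabs R) (@cabs R)).

(** Bounds on increments add up under bisection, and a short interval around a point is split at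
    that point, where the local hypothesis applies on both sides. *)
Lemma lip_segment (u : R -> C) K :
  (forall x, 0 <= x <= 1 -> forall e, 0 < e -> exists2 d : R, 0 < d &
     forall y, `|y| < d -> cabs (u (x + y) - u x) <= (K + e) * `|y|) ->
  cabs (u 1 - u 0) <= K.
Proof.
move=> hu; apply/ler_addgt0Pr => e e0.
pose P (a : unit -> R) l := cabs (u (a tt + l) - u (a tt)) <= (K + e) * l.
suff : P (fun=> 0) 1 by rewrite /P add0r mulr1.
apply: (cube_bisection (P := P)) => //.
- move=> a l l0 hb.
  have /= := hb [ffun=> false]; have /= := hb [ffun=> true].
  rewrite /P /subcube_corner !ffunE mul0r mul1r addr0 => h2 h1.
  have e1 : a tt + l / 2 + l / 2 = a tt + l by field.
  rewrite e1 in h2.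
  have := cabsD (u (a tt + l) - u (a tt + l / 2)) (u (a tt + l / 2) - u (a tt)).
  rewrite addrA subrK; lra.
- move=> p hp; have hp' : 0 <= p tt <= 1 by have := hp tt; rewrite add0r.
  have [d d0 hd] := hu _ hp' _ e0; exists d => // a l l0 ld ha.
  rewrite /P; have /andP[ha1 ha2] := ha tt.
  have := hd (a tt + l - p tt); have := hd (a tt - p tt).
  have e1 : p tt + (a tt - p tt) = a tt by ring.
  have e2 : p tt + (a tt + l - p tt) = a tt + l by ring.
  rewrite e1 e2.
  have -> : `|a tt - p tt| = p tt - a tt by rewrite distrC ger0_norm; lra.
  have -> : `|a tt + l - p tt| = a tt + l - p tt by rewrite ger0_norm; lra.
  move=> h1 h2; have {}h1 : cabs (u (a tt) - u (p tt)) <= (K + e) * (p tt - a tt) by apply: h1; lra.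
  have {}h2 : cabs (u (a tt + l) - u (p tt)) <= (K + e) * (a tt + l - p tt) by apply: h2; lra.
  have := cabsB (u (a tt + l) - u (p tt)) (u (a tt) - u (p tt)).
  have -> : u (a tt + l) - u (p tt) - (u (a tt) - u (p tt)) = u (a tt + l) - u (a tt) by ring.
  lra.
Qed.

Lemma lip_dif (u : C -> C) K :
  (forall x : R, 0 <= x <= 1 -> exists2 l, difC u x%:C%C (fun w => l * w) & cabs l <= K) ->
  cabs (u 1 - u 0) <= K.
Proof.
move=> hu; have := @lip_segment (fun x => u x%:C%C) K; rewrite rmorph1 rmorph0; apply.
move=> x /hu[l hl lK] e e0; have [d d0 hd] := hl.2 _ e0; exists d => // y yd.
have := hd y%:C%C; rewrite cabs_real rmorphD => /(_ yd) h.
have := cabsD (u (x%:C%C + y%:C%C) - u x%:C%C - l * y%:C%C) (l * y%:C%C).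
rewrite subrK cabsM cabs_real => h2.
by have := normr_ge0 y; nra.
Qed.

Variable n : nat.
Implicit Types (h : 'rV[C]_n -> C) (z w v : 'rV[C]_n) (g : 'I_n -> C).

(** Bilinear, without conjugation: the differential with partial derivatives [g], applied to [v]. *)
Definition pairing v g : C := \sum_(j < n) v 0 j * g j.

Lemma pairing_le v g K : (forall j, cabs (g j) <= K) ->
  cabs (pairing v g) <= normv v * K.
Proof.
move=> gK; rewrite (le_trans (cabs_sum _ _ _))// mulr_suml; apply: ler_sum => j _.
by rewrite cabsM ler_wpM2l ?cabs_ge0.
Qed.

Lemma pairing_bound g : exists2 K : R, 0 <= K & forall v, cabs (pairing v g) <= K * normv v.
Proof.
exists (\sum_j cabs (g j)); first by apply: sumr_ge0 => j _; exact: cabs_ge0.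
move=> v; rewrite mulrC; apply: pairing_le => j.
by rewrite (bigD1 j)//= lerDl sumr_ge0// => i _; exact: cabs_ge0.
Qed.

Lemma pairingB v w g : pairing (v - w) g = pairing v g - pairing w g.
Proof. by rewrite /pairing -sumrB; apply: eq_bigr => j _; rewrite !mxE mulrBl. Qed.

Lemma pairingBr v g g' : pairing v (fun j => g j - g' j) = pairing v g - pairing v g'.
Proof. by rewrite /pairing -sumrB; apply: eq_bigr => j _; rewrite mulrBr. Qed.

Lemma pairingZ (c : C) v g : pairing (c *: v) g = c * pairing v g.
Proof. by rewrite /pairing mulr_sumr; apply: eq_bigr => j _; rewrite mxE mulrA. Qed.

Lemma pairing_delta j g : pairing (delta_mx 0 j) g = g j.
Proof.
rewrite /pairing (bigD1 j)//= big1 ?addr0.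
  by rewrite mxE !eqxx mul1r.
by move=> i ij; rewrite mxE (negbTE ij) andbF mul0r.
Qed.

Definition hgrad h z g := dif (@normv R n) (@cabs R) h z (pairing^~ g).

Lemma dif_slice h z v (t : C) g : hgrad h (z + t *: v) g ->
  difC (fun s => h (z + s *: v)) t (fun s => pairing v g * s).
Proof.
move=> hg.
have h1 : dif (@cabs R) (@normv R n) (fun s => z + s *: v) t (fun s => s *: v).
  split; first by exists (normv v) => w; rewrite normvZ mulrC.
  move=> e e0; exists 1 => // w _.
  rewrite scalerDl addrA (addrC (z + t *: v)) addrK subrr normv0.
  by rewrite mulr_ge0 ?cabs_ge0 ?(ltW e0).
have := dif_comp (cabs_is_norm R) (normv_is_norm R n) (cabs_is_norm R) (fun a b => pairingB a b g) h1 hg.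
by apply: dif_eq => s /=; rewrite pairingZ mulrC.
Qed.

Lemma hgrad_shift h z v g : hgrad h (z + v) g -> hgrad (fun x => h (x + v)) z g.
Proof.
move=> [hb ho]; split=> [|e e0]; first exact: hb.
have [d d0 hd] := ho _ e0.
by exists d => // w /hd; rewrite (addrAC z v w).
Qed.

Lemma hgradB h h' z g g' : hgrad h z g -> hgrad h' z g' ->
  hgrad (fun x => h x - h' x) z (fun j => g j - g' j).
Proof.
move=> h1 h2; apply: dif_eq (difB (normv_is_norm R n) h1 h2) => w.
by rewrite pairingBr.
Qed.

Lemma hgrad_pairing z0 z g : hgrad (fun x => pairing (x - z0) g) z g.
Proof.
have [K K0 hK] := pairing_bound g; split; first by exists K.
move=> e e0; exists 1 => // w _.
rewrite -pairingB -pairingB.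
have -> : z + w - z0 - (z - z0) - w = 0 by apply/rowP => j; rewrite !mxE; ring.
by rewrite -(subrr 0) pairingB subrr cabs0 mulr_ge0 ?normv_ge0// ltW.
Qed.

(** This is the one-variable estimate on the complex line through z in the j-th direction. The
    square of half side s / 4 lies in the disc of radius s, and 4 M / (s / 4) = 16 M / s. *)
Lemma grad_bound h z s M g j : 0 < s ->
  (forall w, normv (w - z) < s -> (exists g', hgrad h w g') /\ cabs (h w) <= M) ->
  hgrad h z g -> cabs (g j) <= 16 * M / s.
Proof.
move=> s0 hh hg; pose v : 'rV[C]_n := delta_mx 0 j.
have -> : 16 * M / s = 4 * M / (s / 4) by field; rewrite gt_eqF.
apply: (@cauchy_estimate _ (fun t => h (z + t *: v))); first by rewrite divr_gt0.
- move=> u w us ws; set t := (u +i* w)%C.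
  have [|[g' hg'] hM] := hh (z + t *: v).
    rewrite (addrC z) addrK normvZ normv_delta mulr1 (le_lt_trans (cabs_le _))//=.
    lra.
  by split=> //; exists (pairing v g'); exact: dif_slice.
- by rewrite -[g j]pairing_delta; apply: dif_slice; rewrite scale0r addr0.
Qed.

Lemma hgrad_lip h z v K :
  (forall t : R, 0 <= t <= 1 -> exists2 g, hgrad h (z + t%:C%C *: v) g & cabs (pairing v g) <= K) ->
  cabs (h (z + v) - h z) <= K.
Proof.
move=> hh; have := @lip_dif (fun t => h (z + t *: v)) K.
rewrite scale1r scale0r addr0; apply => t /hh[g hg gK].
by exists (pairing v g) => //; exact: dif_slice.
Qed.

Lemma segment_ball z0 z v r (t : R) : 0 <= t <= 1 -> normv (z - z0) < r ->
  normv (z + v - z0) < r -> normv (z + t%:C%C *: v - z0) < r.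
Proof.
move=> /andP[t0 t1] h1 h2.
have -> : z + t%:C%C *: v - z0 = (1 - t)%:C%C *: (z - z0) + t%:C%C *: (z + v - z0).
  by apply/rowP => j; rewrite !mxE rmorphB rmorph1; ring.
rewrite (le_lt_trans (normvD _ _))// !normvZ !cabs_real !ger0_norm ?subr_ge0//.
have [->|tn] := eqVneq t 0; first by rewrite mul0r subr0 mul1r addr0.
have tp : 0 < t by rewrite lt_neqAle eq_sym tn.
nra.
Qed.

Section Ball.
Variables (h : 'rV[C]_n -> C) (G : 'rV[C]_n -> 'I_n -> C) (z0 : 'rV[C]_n) (r M : R).
Hypothesis r0 : 0 < r.
Hypothesis hG : forall z, normv (z - z0) < r -> hgrad h z (G z).
Hypothesis hM : forall z, normv (z - z0) < r -> cabs (h z) <= M.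

Let M0 : 0 <= M.
Proof. by rewrite (le_trans (cabs_ge0 (h z0)))// hM// subrr normv0. Qed.

Lemma ball_grad_bound z j : normv (z - z0) < r / 2 -> cabs (G z j) <= 32 * M / r.
Proof.
have rp := r0.
move=> hz; have -> : 32 * M / r = 16 * M / (r / 2) by field; rewrite gt_eqF.
apply: (grad_bound (h := h) (z := z) (g := G z)); first (by rewrite divr_gt0); last by apply: hG; lra.
move=> w hw; have hw' : normv (w - z0) < r.
  by have := normvD (w - z) (z - z0); rewrite addrA subrK; lra.
by split; [exists (G w); exact: hG|exact: hM].
Qed.

Lemma ball_lip z v : normv (z - z0) < r / 2 -> normv (z + v - z0) < r / 2 ->
  cabs (h (z + v) - h z) <= normv v * (32 * M / r).
Proof.
have rp := r0.
move=> h1 h2; apply: hgrad_lip => t t01; have h3 := segment_ball t01 h1 h2.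
exists (G (z + t%:C%C *: v)); first by apply: hG; lra.
by apply: pairing_le => j; exact: ball_grad_bound.
Qed.

(* [G (z + v) - G z] is the gradient of [h (x + v) - h x], which is small by [ball_lip]. *)
Lemma ball_grad_lip z v j : normv (z - z0) < r / 4 -> normv (z + v - z0) < r / 4 ->
  cabs (G (z + v) j - G z j) <= 2048 * M / r ^+ 2 * normv v.
Proof.
have rp := r0.
move=> h1 h2.
have -> : 2048 * M / r ^+ 2 * normv v = 16 * (normv v * (32 * M / r)) / (r / 4).
  by field; rewrite gt_eqF.
have near w y : normv (y - z0) < r / 4 -> normv (w - y) < r / 4 -> normv (w - z0) < r / 2.
  by move=> ? ?; have := normvD (w - y) (y - z0); rewrite addrA subrK; lra.
have h4 w : normv (w - z) < r / 4 -> normv (w + v - z0) < r / 2.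
  move=> hw; apply: (near _ (z + v)) => //.
  by have -> : w + v - (z + v) = w - z by apply/rowP => i; rewrite !mxE; ring.
apply: (@grad_bound (fun x => h (x + v) - h x) z _ _ (fun j => G (z + v) j - G z j)).
- by rewrite divr_gt0.
- move=> w hw; have h3 := near _ _ h1 hw; have h5 := h4 _ hw; split.
    exists (fun j => G (w + v) j - G w j).
    by apply: hgradB; [apply: hgrad_shift|]; apply: hG; lra.
  exact: ball_lip.
- by apply: hgradB; [apply: hgrad_shift|]; apply: hG; lra.
Qed.

(** Subtracting the linear part leaves a function with gradient G x - G z, which [ball_grad_lip]
    bounds along the segment; the mean value inequality yields a second factor |v|. *)
Lemma ball_taylor z v : normv (z - z0) < r / 4 -> normv (z + v - z0) < r / 4 ->
  cabs (h (z + v) - h z - pairing v (G z)) <= 2048 * M / r ^+ 2 * normv v ^+ 2.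
Proof.
have rp := r0.
move=> h1 h2.
have := @hgrad_lip (fun x => h x - pairing (x - z) (G z)) z v (2048 * M / r ^+ 2 * normv v ^+ 2).
have -> : z + v - z = v by rewrite (addrC z) addrK.
have -> : pairing (z - z) (G z) = 0 by rewrite pairingB subrr.
rewrite subr0 addrAC; apply => t t01; have h3 := segment_ball t01 h1 h2.
exists (fun j => G (z + t%:C%C *: v) j - G z j).
  by apply: hgradB; [apply: hG; lra|exact: hgrad_pairing].
rewrite expr2 mulrA mulrC; apply: pairing_le => j.
rewrite (le_trans (ball_grad_lip _ h1 h3))//.
have K0 : 0 <= 2048 * M / r ^+ 2.
  by apply: divr_ge0; [apply: mulr_ge0; [exact: ler0n|exact: M0]|exact: exprn_ge0 (ltW rp)].
case/andP: t01 => t0 t1; rewrite ler_wpM2l// normvZ cabs_real ger0_norm//.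
by rewrite ler_piMl// normv_ge0.
Qed.

End Ball.

End SeveralVariables.

(** * The mean value inequality on a grid *)

Section DiscreteMeanValue.
Variable R : realType.
Local Notation C := (R[i]).
Local Notation difC := (dif (@cabs R) (@cabs R)).

Section Square.
Variable N : nat.
Hypothesis N0 : (0 < N)%N.

Let Np : 0 < N%:R :> R. Proof. by rewrite ltr0n. Qed.

Definition side_ordinate (m : nat) : R := 2 * m%:R / N%:R - 1.

Definition side_pt (m : nat) : C := (1 +i* side_ordinate m)%C.

(** The quotient (z_(m+1) - z_m) / z_m for z_m = [side_pt m], that is (2 i / N) / (1 + i y), in real
    and imaginary parts: a Riemann sum term of dz / z. *)
Definition side_weight (m : nat) : C :=
  let y := side_ordinate m in
  ((2 / N%:R * y / (1 + y ^+ 2)) +i* (2 / N%:R / (1 + y ^+ 2)))%C.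

Lemma side_ordinate_bounds m : (m <= N)%N -> -1 <= side_ordinate m <= 1.
Proof.
move=> mN; have m1 : m%:R <= N%:R :> R by rewrite ler_nat.
have m0 : 0 <= m%:R :> R by rewrite ler0n.
rewrite /side_ordinate.
have q0 : 0 <= 2 * m%:R / N%:R :> R by rewrite !mulr_ge0 ?invr_ge0 ?ler0n.
have q2 : 2 * m%:R / N%:R <= 2 :> R by rewrite ler_pdivrMr//; lra.
by apply/andP; split; lra.
Qed.

Lemma side_pt_bounds m : (m <= N)%N -> 1 <= cabs (side_pt m) <= 2.
Proof.
move=> /side_ordinate_bounds/andP[y1 y2]; apply/andP; split.
  by have := Re_le_cabs (side_pt m); rewrite /= normr1.
rewrite (le_trans (cabs_le _))//= normr1.
have : `|side_ordinate m| <= 1 by rewrite ler_norml y1.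
lra.
Qed.

Lemma side_weightE m : side_weight m * side_pt m = 'i%C * (2 / N%:R)%:C%C.
Proof.
have d0 : 1 + side_ordinate m ^+ 2 != 0.
  by rewrite gt_eqF// ltr_pwDl// sqr_ge0.
have N0' : N%:R != 0 :> R by rewrite gt_eqF.
apply/eqP; rewrite eq_complex /side_weight /side_pt/=.
set y := side_ordinate m in d0 *; move: y d0 => y d0.
by apply/andP; split; apply/eqP; field; rewrite d0 N0'.
Qed.

Lemma side_weight_le m : (m <= N)%N -> cabs (side_weight m) <= 2 / N%:R.
Proof.
move=> /side_pt_bounds/andP[p1 _].
have := congr1 (@cabs R) (side_weightE m); rewrite !cabsM cabs_i mul1r cabs_real ger0_norm.
  by move=> <-; rewrite ler_peMr// cabs_ge0.
by rewrite divr_ge0// ltW.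
Qed.

Lemma Im_sum I (r : seq I) (P : pred I) (F : I -> C) :
  Im (\sum_(i <- r | P i) F i) = \sum_(i <- r | P i) Im (F i).
Proof. by apply: (big_morph (@complex.Im R)) => // -[a b] [c d]. Qed.

(** The sum approximates the integral of dz / z over one side, i pi / 2. Bounding y^2 by 1 in each
    imaginary part is enough to get 1. *)
Lemma side_weight_sum : 1 <= cabs (\sum_(m < N) side_weight m).
Proof.
rewrite (le_trans _ (Im_le_cabs _))// (le_trans _ (ler_norm _))// Im_sum.
have -> : 1 = \sum_(m < N) (N%:R^-1) :> R.
  by rewrite sumr_const card_ord -[RHS]mulr_natl mulfV// gt_eqF.
apply: ler_sum => m _ /=.
have /andP[y1 y2] := side_ordinate_bounds (ltnW (ltn_ord m)).
set y := side_ordinate m in y1 y2 *.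
have y3 : y ^+ 2 <= 1 by nra.
rewrite ler_pdivlMr; last by have := sqr_ge0 y; lra.
by rewrite mulrC ler_pM2r ?invr_gt0//; lra.
Qed.

Lemma cabs_iX a : cabs ('i%C ^+ a : C) = 1.
Proof. by rewrite cabsX cabs_i expr1n. Qed.

Lemma sum_iX (c : C) : \sum_(a < 4) 'i%C ^+ a * c = 0.
Proof.
have i2 : ('i%C : C) ^+ 2 = -1 by rewrite sqr_i.
have i3 : ('i%C : C) ^+ 3 = - 'i%C by rewrite exprS i2 mulrN1.
rewrite !big_ord_recr big_ord0/= expr0 expr1 i2 i3.
by ring.
Qed.

(** Since i * [side_pt 0] = [side_pt N], each side ends where the next one begins, and the fourth
    closes the contour. *)
Lemma square_telescope (u : C -> C) (x : R) :
  \sum_(a < 4) \sum_(m < N)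
    (u (x%:C%C * ('i%C ^+ a * side_pt m.+1)) - u (x%:C%C * ('i%C ^+ a * side_pt m))) = 0.
Proof.
have tel (F : nat -> C) : \sum_(m < N) (F m.+1 - F m) = F N - F 0%N.
  by rewrite -(big_mkord xpredT (fun m => F m.+1 - F m)) telescope_sumr.
under eq_bigr do rewrite (tel (fun m => u (_ * (_ * side_pt m)))).
have e1 : side_pt N = (1 +i* 1)%C.
  by congr (_ +i* _)%C; rewrite /side_ordinate mulfK ?gt_eqF//; ring.
have e0 : side_pt 0 = (1 +i* -1)%C.
  by congr (_ +i* _)%C; rewrite /side_ordinate mulr0 mul0r; ring.
have e2 : 'i%C * side_pt 0 = side_pt N.
  by rewrite e0 e1; apply/eqP; rewrite eq_complex/=; apply/andP; split; apply/eqP; ring.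
have i4 : ('i%C : C) ^+ 4 = 1.
  by rewrite -[4%N]/(2 * 2)%N exprM sqr_i expr2 mulrNN mulr1.
pose G a := u (x%:C%C * ('i%C ^+ a * side_pt 0)).
transitivity (\sum_(a < 4) (G a.+1 - G a)).
  by apply: eq_bigr => a _; rewrite -e2 /G exprSr !mulrA.
rewrite -(big_mkord xpredT (fun m => G m.+1 - G m)) telescope_sumr//.
by rewrite /G i4 expr0 subrr.
Qed.

Section MeanValue.
Variables (u du : C -> C) (rho K : R).
Hypotheses (rho0 : 0 <= rho) (K0 : 0 <= K).
Hypothesis hdu : forall z, cabs z <= 2 * rho -> difC u z (fun w => du z * w).
Hypothesis hTay : forall z w, cabs z <= 2 * rho -> cabs (z + w) <= 2 * rho ->
  cabs (u (z + w) - u z - du z * w) <= K * cabs w ^+ 2.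

Local Notation pt a m := (rho%:C%C * ('i%C ^+ a * side_pt m)).

Let A (s : C) := \sum_(a < 4) \sum_(m < N) side_weight m * u (s * pt a m).

Lemma pt_bound (x : R) a m : 0 <= x <= 1 -> (m <= N)%N ->
  cabs (x%:C%C * pt a m) <= 2 * rho.
Proof.
move=> /andP[x0 x1] /side_pt_bounds/andP[_ p2].
rewrite !cabsM cabs_iX mul1r !cabs_real !ger0_norm//.
have := cabs_ge0 (side_pt m); move: (cabs _) p2 => p p2 p0.
have h1 : rho * p <= 2 * rho by rewrite (mulrC 2) ler_wpM2l.
by rewrite (le_trans _ h1)// ler_piMl// mulr_ge0.
Qed.

Lemma dif_sum I (r : seq I) (F L : I -> C -> C) z :
  (forall i, difC (F i) z (L i)) ->
  difC (fun s => \sum_(i <- r) F i s) z (fun w => \sum_(i <- r) L i w).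
Proof.
move=> hF; elim: r => [|i r IH].
  by under eq_fun do rewrite big_nil; under [X in dif _ _ _ _ X]eq_fun do rewrite big_nil;
    exact: dif_cst (cabs_is_norm R) 0 z.
under eq_fun do rewrite big_cons; under [X in dif _ _ _ _ X]eq_fun do rewrite big_cons.
exact: (difD (cabs_is_norm R)).
Qed.

Let dA (x : R) : C := \sum_(a < 4) \sum_(m < N)
  'i%C ^+ a * ((2 * rho / N%:R)%:C%C * 'i%C * du (x%:C%C * pt a m)).

Let A_dif (x : R) : 0 <= x <= 1 -> difC A x%:C%C (fun w => dA x * w).
Proof.
move=> x01; rewrite /A.
have h (a : 'I_4) (m : 'I_N) : difC (fun s => side_weight m * u (s * pt a m)) x%:C%C
    (fun w => 'i%C ^+ a * ((2 * rho / N%:R)%:C%C * 'i%C * du (x%:C%C * pt a m)) * w).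
  have hid := dif_id (x%:C%C : C) (cabs_is_norm R).
  have h1 := difM (cabs_is_norm R) hid (dif_cst (cabs_is_norm R) (pt a m) x%:C%C).
  have h2 := hdu (pt_bound a x01 (ltnW (ltn_ord m))).
  have h3 := dif_comp (cabs_is_norm R) (cabs_is_norm R) (cabs_is_norm R) (fun a b => mulrBr _ a b) h1 h2.
  have h4 := difM (cabs_is_norm R) (dif_cst (cabs_is_norm R) (side_weight m) x%:C%C) h3.
  apply: dif_eq h4 => w /=; rewrite !mulr0 addr0 add0r.
  have -> : side_weight m * (du (x%:C%C * pt a m) * (pt a m * w)) =
    du (x%:C%C * pt a m) * rho%:C%C * 'i%C ^+ a * (side_weight m * side_pt m) * w by ring.
  by rewrite side_weightE !rmorphM/=; ring.
have h5 := dif_sum (index_enum 'I_4) (fun a => dif_sum (index_enum 'I_N) (h a)).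
apply: dif_eq h5 => w; rewrite /dA mulr_suml; apply: eq_bigr => a _.
by rewrite mulr_suml.
Qed.

(** Up to sign, x * dA x is the Riemann sum of [du] over the contour minus the increments of [u],
    which telescope to 0. It consists of 4 N Taylor remainders, each at most K (2 x rho / N)^2. *)
Let dA_bound (x : R) : 0 <= x <= 1 -> cabs (dA x) <= 16 * K * rho ^+ 2 / N%:R.
Proof.
move=> x01; have /andP[x0 x1] := x01.
have B0 : 0 <= 16 * K * rho ^+ 2 / N%:R by rewrite !mulr_ge0 ?exprn_ge0 ?invr_ge0 ?ler0n.
(* At x = 0 all contour points coincide and the powers of i sum to 0; elsewhere the bound is proved
   after multiplication by x. *)
have [->|xn] := eqVneq x 0.
  rewrite /dA exchange_big/= big1 ?cabs0// => m _.
  by rewrite -[RHS](sum_iX ((2 * rho / N%:R)%:C%C * 'i%C * du 0)); apply: eq_bigr => a _; rewrite mul0r.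
have xp : 0 < x by rewrite lt_neqAle eq_sym xn.
rewrite -(ler_pM2l xp) (le_trans (y := cabs (x%:C%C * dA x)))//.
  by rewrite cabsM cabs_real ger0_norm.
have -> : x%:C%C * dA x = - \sum_(a < 4) \sum_(m < N)
    (u (x%:C%C * pt a m.+1) - u (x%:C%C * pt a m) -
     du (x%:C%C * pt a m) * (x%:C%C * pt a m.+1 - x%:C%C * pt a m)).
  have tele := square_telescope u (x * rho).
  set S := \sum_(a < 4) _; suff E : x%:C%C * dA x + S = 0 by apply/eqP; rewrite -subr_eq0 opprK E.
  rewrite -[RHS]tele /S /dA mulr_sumr -big_split/=; apply: eq_bigr => a _.
  rewrite mulr_sumr -big_split/=; apply: eq_bigr => m _.
  have -> : x%:C%C * pt a m.+1 - x%:C%C * pt a m =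
      x%:C%C * ('i%C ^+ a * ((2 * rho / N%:R)%:C%C * 'i%C)).
    have -> : side_pt m.+1 = side_pt m + (2 / N%:R)%:C%C * 'i%C.
      apply/eqP; rewrite eq_complex/=; apply/andP; split; apply/eqP; first by ring.
      by rewrite /side_ordinate -natr1; field; rewrite gt_eqF.
    by rewrite !rmorphM/=; ring.
  have e b : (x * rho)%:C%C * b = x%:C%C * (rho%:C%C * b) by rewrite rmorphM mulrA.
  by rewrite !e; ring.
rewrite cabsN (le_trans (cabs_sum _ _ _))//.
rewrite (@le_trans _ _ (\sum_(a < 4) \sum_(m < N) (K * (x * (2 * rho / N%:R)) ^+ 2)))//; last first.
  rewrite !sumr_const !card_ord -(mulr_natl (_ *+ N)) -(mulr_natl _ N).
  have -> : 4%:R * (N%:R * (K * (x * (2 * rho / N%:R)) ^+ 2)) = x * (x * (16 * K * rho ^+ 2 / N%:R)).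
    by field; rewrite gt_eqF.
  by rewrite ler_wpM2l// ler_piMl.
apply: ler_sum => a _; rewrite (le_trans (cabs_sum _ _ _))//.
apply: ler_sum => m _.
have e : x%:C%C * pt a m.+1 = x%:C%C * pt a m + (x%:C%C * pt a m.+1 - x%:C%C * pt a m).
  by rewrite (addrC (x%:C%C * pt a m)) subrK.
rewrite {1}e (le_trans (hTay _ _))//.
- exact: pt_bound (ltnW (ltn_ord m)).
- by rewrite -e; apply: pt_bound.
rewrite ler_wpM2l// ler_pXn2r ?nnegrE ?cabs_ge0 ?mulr_ge0 ?invr_ge0 ?ler0n//.
have -> : x%:C%C * pt a m.+1 - x%:C%C * pt a m =
      x%:C%C * ('i%C ^+ a * ((2 * rho / N%:R)%:C%C * 'i%C)).
  have -> : side_pt m.+1 = side_pt m + (2 / N%:R)%:C%C * 'i%C.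
    apply/eqP; rewrite eq_complex/=; apply/andP; split; apply/eqP; first by ring.
    by rewrite /side_ordinate -natr1; field; rewrite gt_eqF.
  by rewrite !rmorphM/=; ring.
rewrite !cabsM cabs_iX cabs_i mul1r mulr1 !cabs_real !ger0_norm//.
by rewrite !mulr_ge0 ?invr_ge0 ?ler0n.
Qed.

(* The weighted sum of [u (s * z_m)] with weights [(z_(m+1) - z_m) / z_m] has as
   derivative in [s] a Riemann sum of a closed contour integral of [du], which is
   nearly 0; it thus changes little between [s = 1] and [s = 0]. *)
Lemma square_mean_value :
  cabs (u 0) <= (2 * N%:R)^-1 * (\sum_(a < 4) \sum_(m < N) cabs (u (pt a m)))
                + 4 * K * rho ^+ 2 / N%:R.
Proof.
have hA : cabs (A 1 - A 0) <= 16 * K * rho ^+ 2 / N%:R.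
  apply: lip_dif => x x01; exists (dA x); [exact: A_dif|exact: dA_bound].
have A0E : A 0 = 4%:R * ((\sum_(m < N) side_weight m) * u 0).
  rewrite /A; under eq_bigr do under eq_bigr do rewrite mul0r.
  by rewrite sumr_const card_ord -mulr_suml mulr_natl.
have A1 : cabs (A 1) <= 2 / N%:R * (\sum_(a < 4) \sum_(m < N) cabs (u (pt a m))).
  rewrite /A (le_trans (cabs_sum _ _ _))// mulr_sumr; apply: ler_sum => a _.
  rewrite (le_trans (cabs_sum _ _ _))// mulr_sumr; apply: ler_sum => m _.
  by rewrite mul1r cabsM ler_wpM2r ?cabs_ge0// side_weight_le// ltnW.
have A0 : 4 * cabs (u 0) <= cabs (A 0).
  have -> : cabs (A 0) = 4 * (cabs (\sum_(m < N) side_weight m) * cabs (u 0)).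
    rewrite A0E !cabsM; congr (_ * _).
    have -> : 4%:R = (4 : R)%:C%C :> C by rewrite rmorph_nat.
    by rewrite cabs_real normr_nat.
  by rewrite ler_pM2l// ler_peMl ?cabs_ge0// side_weight_sum.
have := cabs_sub_le (A 0) (A 1); rewrite cabsBC => h.
have e1 : 4 * ((2 * N%:R)^-1 * (\sum_(a < 4) \sum_(m < N) cabs (u (pt a m)))) =
  2 / N%:R * (\sum_(a < 4) \sum_(m < N) cabs (u (pt a m))).
  by rewrite mulrA; congr (_ * _); field; rewrite gt_eqF.
have e2 : 4 * (4 * K * rho ^+ 2 / N%:R) = 16 * K * rho ^+ 2 / N%:R by ring.
by rewrite -(@ler_pM2l _ 4)// mulrDr e1 e2; lra.
Qed.

End MeanValue.

End Square.

End DiscreteMeanValue.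

(** * The grid on concentric squares and its separation *)

Section Grid.
Variable R : realType.
Local Notation C := (R[i]).
Local Notation difC := (dif (@cabs R) (@cabs R)).

Definition grid_index N : Type := ('I_4 * 'I_N * 'I_N)%type.
HB.instance Definition _ N := Finite.on (grid_index N).

Definition grid_level N (b : nat) : R := 1 / 2 + b%:R / (2 * N%:R).

(** There are 4 N points on each of N concentric squares. Their half sides are at least rho / 2, so
    that points on one square are as far apart as neighbouring squares are, namely rho / (2 N). *)
Definition grid_pt N (rho : R) (x : grid_index N) : C :=
  (rho * grid_level N x.2)%:C%C * ('i%C ^+ x.1.1 * side_pt R N x.1.2).

Lemma card_grid_index N : #|{: grid_index N}| = (4 * N * N)%N.
Proof. by rewrite !card_prod !card_ord. Qed.

Lemma grid_level_bounds N b : (b < N)%N -> 1 / 2 <= grid_level N b <= 1.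
Proof.
move=> bN; have N0 : 0 < N%:R :> R by rewrite ltr0n (leq_ltn_trans _ bN).
have b0 : 0 <= b%:R / (2 * N%:R) :> R by rewrite !mulr_ge0 ?invr_ge0 ?mulr_ge0 ?ler0n.
have b1 : b%:R / (2 * N%:R) <= 1 / 2 :> R.
  have bN' : b%:R <= N%:R :> R by rewrite ler_nat ltnW.
  by rewrite ler_pdivrMr; lra.
by rewrite /grid_level; apply/andP; split; lra.
Qed.

Lemma grid_pt_bound N (rho : R) (x : grid_index N) : 0 <= rho ->
  cabs (grid_pt rho x) <= 2 * rho.
Proof.
move=> r0; have N0 : (0 < N)%N by rewrite (leq_ltn_trans _ (ltn_ord x.2)).
have /andP[_ p2] := side_pt_bounds R N0 (ltnW (ltn_ord x.1.2)).
have /andP[t1 t2] := grid_level_bounds (ltn_ord x.2).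
have t0 : 0 <= grid_level N x.2 by lra.
rewrite /grid_pt !cabsM cabs_iX mul1r cabs_real ger0_norm ?mulr_ge0// mulrC.
apply: ler_pM; rewrite ?cabs_ge0 ?mulr_ge0//.
by rewrite ler_piMr.
Qed.

Section OneVariable.
Variables (u du : C -> C) (rho K : R) (N : nat).
Hypotheses (N0 : (0 < N)%N) (rho0 : 0 <= rho) (K0 : 0 <= K).
Hypothesis hdu : forall z, cabs z <= 2 * rho -> difC u z (fun w => du z * w).
Hypothesis hTay : forall z w, cabs z <= 2 * rho -> cabs (z + w) <= 2 * rho ->
  cabs (u (z + w) - u z - du z * w) <= K * cabs w ^+ 2.

(** Average of [square_mean_value] over the N levels; the factor 2 is the loss from bounding the
    weights in modulus. *)
Lemma grid_mean_value : cabs (u 0) <=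
  2 * ((4 * N * N)%N%:R^-1 * (\sum_(x : grid_index N) cabs (u (grid_pt rho x))))
  + 4 * K * rho ^+ 2 / N%:R.
Proof.
have Np : 0 < N%:R :> R by rewrite ltr0n.
have h (b : 'I_N) : cabs (u 0) <= (2 * N%:R)^-1 * (\sum_(a < 4) \sum_(m < N)
     cabs (u ((rho * grid_level N b)%:C%C * ('i%C ^+ a * side_pt R N m)))) + 4 * K * rho ^+ 2 / N%:R.
  have /andP[t1 t2] := grid_level_bounds (ltn_ord b).
  have t0 : 0 <= grid_level N b by lra.
  have rt : rho * grid_level N b <= rho by rewrite ler_piMr.
  have rt0 : 0 <= rho * grid_level N b by rewrite mulr_ge0.
  have h1 := @square_mean_value R N N0 u du (rho * grid_level N b) K rt0 K0.
  apply: (le_trans (h1 _ _)).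
  - by move=> z hz; apply: hdu; rewrite (le_trans hz)// ler_wpM2l.
  - move=> z w h2 h3; apply: hTay.
      by rewrite (le_trans h2)// ler_wpM2l.
    by rewrite (le_trans h3)// ler_wpM2l.
  rewrite lerD2l ler_wpM2r ?invr_ge0 ?ler0n// ler_wpM2l ?mulr_ge0 ?ler0n//.
  by rewrite ler_pXn2r.
have := ler_sum (index_enum 'I_N) (P := xpredT) (fun b _ => h b).
rewrite big_split/= !sumr_const card_ord -[leLHS]mulr_natl -[X in _ <= _ + X]mulr_natl -mulr_sumr.
set S := \sum_(b < N) _.
have -> : S = \sum_(x : grid_index N) cabs (u (grid_pt rho x)).
  rewrite /S exchange_big/= -(pair_bigA _ (fun p b => cabs (u (grid_pt rho (p, b)))))/=.
  rewrite -(pair_bigA _ (fun a m => \sum_(b < N) cabs (u (grid_pt rho ((a, m), b)))))/=.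
  by apply: eq_bigr => a _; rewrite exchange_big.
move: (\sum_(x : grid_index N) _) => T hT.
rewrite -(@ler_pM2l _ N%:R)//; apply: (le_trans hT).
rewrite le_eqVlt; apply/orP; left; apply/eqP; rewrite !natrM; field.
by rewrite gt_eqF.
Qed.

End OneVariable.

Lemma i_side_ptE (a m N : nat) : (a < 4)%N ->
  'i%C ^+ a * side_pt R N m = let y := side_ordinate R N m in
   nth 0 [:: (1 +i* y)%C; ((- y) +i* 1)%C; (-1 +i* (- y))%C; (y +i* -1)%C] a.
Proof.
rewrite /side_pt; set y := side_ordinate R N m.
by case: a => [|[|[|[|//]]]] _ /=; rewrite ?exprSr ?expr0 ?mul1r; apply/eqP; rewrite eq_complex/=;
  apply/andP; split; apply/eqP; ring.
Qed.

(** Each side omits its end point, which starts the next side. The ordinates thus stay in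
    [-1, 1 - 2 / N], and this separates points on adjacent sides. *)
Lemma side_pt_separated N a a' m m' : (a < 4)%N -> (a' < 4)%N -> (m < N)%N -> (m' < N)%N ->
  (a, m) != (a', m') ->
  N%:R^-1 <= cabs ('i%C ^+ a * side_pt R N m - 'i%C ^+ a' * side_pt R N m').
Proof.
move=> a4 a'4 mN m'N am; have N0 : (0 < N)%N by rewrite (leq_ltn_trans _ mN).
have Np : 0 < N%:R :> R by rewrite ltr0n.
have ub k : (k < N)%N -> -1 <= side_ordinate R N k <= 1 - 2 * N%:R^-1.
  move=> kN; have /andP[k1 k2] := side_ordinate_bounds R N0 (ltnW kN); rewrite k1/=.
  have : k.+1%:R <= N%:R :> R by rewrite ler_nat.
  rewrite -natr1 => k3; rewrite /side_ordinate.
  have iv : 0 <= N%:R^-1 :> R by rewrite invr_ge0 ltW.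
  have k4 := ler_wpM2r iv k3; have e : N%:R * N%:R^-1 = 1 :> R by rewrite mulfV// gt_eqF.
  lra.
have iv : 0 < N%:R^-1 :> R by rewrite invr_gt0.
have yy : m != m' -> N%:R^-1 <= `|side_ordinate R N m - side_ordinate R N m'|.
  move=> mm; have -> : side_ordinate R N m - side_ordinate R N m' = 2 * N%:R^-1 * (m%:R - m'%:R).
    by rewrite /side_ordinate; ring.
  have d1 : 1 <= `|m%:R - m'%:R| :> R.
    case: (ltngtP m m') mm => // h _.
      have : m.+1%:R <= m'%:R :> R by rewrite ler_nat.
      by rewrite -natr1 => h1; rewrite distrC ger0_norm; lra.
    have : m'.+1%:R <= m%:R :> R by rewrite ler_nat.
    by rewrite -natr1 => h1; rewrite ger0_norm; lra.
  have iv2 : 0 <= 2 * N%:R^-1 :> R by rewrite mulr_ge0 ?(ltW iv).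
  rewrite normrM (ger0_norm iv2); nra.
have /andP[y1 y2] := ub _ mN; have /andP[y3 y4] := ub _ m'N.
set z := _ - _; have hR := Re_le_cabs z; have hI := Im_le_cabs z.
have f1 := le_trans (ler_norm _) hR; have f2 := le_trans (ler_norm _) hI.
have f3 : - Re z <= cabs z by rewrite (le_trans _ hR)// -normrN ler_norm.
have f4 : - Im z <= cabs z by rewrite (le_trans _ hI)// -normrN ler_norm.
move: hR hI f1 f2 f3 f4; rewrite /z {z} !i_side_ptE//.
case: a a4 am => [|[|[|[|//]]]] _; case: a' a'4 => [|[|[|[|//]]]] _ am /= hR hI f1 f2 f3 f4;
  try lra.
- by have /yy/le_trans : m != m' by []; apply.
- have /yy/le_trans : m != m' by []; apply; rewrite (le_trans _ hR)//.
  by rewrite -opprD normrN.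
- have /yy/le_trans : m != m' by []; apply; rewrite (le_trans _ hI)//.
  by rewrite -opprD normrN.
- by have /yy/le_trans : m != m' by []; apply.
Qed.

(** The level sets of this norm are the squares of the grid, so it separates points of different
    levels. *)
Definition max_coord (z : C) : R := Num.max `|Re z| `|Im z|.

Lemma max_coord_sub z w : max_coord z - max_coord w <= cabs (z - w).
Proof.
rewrite /max_coord lerBlDr ge_max; apply/andP; split.
  have := Re_le_cabs (z - w); have := ler_normD (Re (z - w)) (Re w).
  have -> : Re (z - w) + Re w = Re z by case: z w => [? ?] [? ?] /=; ring.
  have : `|Re w| <= Num.max `|Re w| `|Im w| by rewrite le_max lexx.
  lra.
have := Im_le_cabs (z - w); have := ler_normD (Im (z - w)) (Im w).
have -> : Im (z - w) + Im w = Im z by case: z w => [? ?] [? ?] /=; ring.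
have : `|Im w| <= Num.max `|Re w| `|Im w| by rewrite le_max lexx orbT.
lra.
Qed.

Lemma max_coord_grid N (rho : R) (x : grid_index N) : 0 <= rho ->
  max_coord (grid_pt rho x) = rho * grid_level N x.2.
Proof.
move=> r0; have N0 : (0 < N)%N by rewrite (leq_ltn_trans _ (ltn_ord x.2)).
have /andP[t1 t2] := grid_level_bounds (ltn_ord x.2).
have t0 : 0 <= rho * grid_level N x.2 by rewrite mulr_ge0//; lra.
have /andP[y1 y2] := side_ordinate_bounds R N0 (ltnW (ltn_ord x.1.2)).
have ya : `|side_ordinate R N x.1.2| <= 1 by rewrite ler_norml y1.
rewrite /grid_pt; move: (rho * _) t0 => s s0.
have -> : max_coord (s%:C%C * ('i%C ^+ x.1.1 * side_pt R N x.1.2)) =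
   s * max_coord ('i%C ^+ x.1.1 * side_pt R N x.1.2).
  case: (_ * side_pt _ _ _) => u v; rewrite /max_coord /= !mul0r subr0 addr0 !normrM (ger0_norm s0).
  by rewrite maxr_pMr.
suff -> : max_coord ('i%C ^+ x.1.1 * side_pt R N x.1.2) = 1 by rewrite mulr1.
rewrite i_side_ptE//; case: (nat_of_ord x.1.1) (ltn_ord x.1.1) => [|[|[|[|//]]]] _;
  rewrite /max_coord /= ?normrN normr1; first [exact/max_idPl | exact/max_idPr].
Qed.

Lemma grid_separated N (rho : R) (x y : grid_index N) : 0 <= rho -> x != y ->
  rho / (2 * N%:R) <= cabs (grid_pt rho x - grid_pt rho y).
Proof.
move=> r0 xy; have N0 : (0 < N)%N by rewrite (leq_ltn_trans _ (ltn_ord x.2)).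
have Np : 0 < N%:R :> R by rewrite ltr0n.
have [bb|bb] := eqVneq x.2 y.2; last first.
  have h1 := max_coord_sub (grid_pt rho x) (grid_pt rho y).
  have h2 := max_coord_sub (grid_pt rho y) (grid_pt rho x).
  rewrite cabsBC !max_coord_grid// in h2; rewrite !max_coord_grid// in h1.
  have q0 : 0 <= rho / (2 * N%:R) by rewrite divr_ge0// mulr_ge0// ltW.
  have e (c c' : R) : rho * (1 / 2 + c / (2 * N%:R)) - rho * (1 / 2 + c' / (2 * N%:R)) =
      (c - c') * (rho / (2 * N%:R)) by ring.
  move: h1 h2; rewrite /grid_level !e => h1 h2.
  move: bb; rewrite -val_eqE/=; case: ltngtP => // h _.
    have : x.2.+1%:R <= y.2%:R :> R by rewrite ler_nat.
    by rewrite -natr1 => h3; rewrite (le_trans _ h2)// ler_peMl//; lra.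
  have : y.2.+1%:R <= x.2%:R :> R by rewrite ler_nat.
  by rewrite -natr1 => h3; rewrite (le_trans _ h1)// ler_peMl//; lra.
have /andP[t1 t2] := grid_level_bounds (ltn_ord x.2).
rewrite /grid_pt -bb -mulrBr cabsM cabs_real ger0_norm; last by rewrite mulr_ge0//; lra.
rewrite invfM -mulrA ler_wpM2l//.
have : N%:R^-1 <= cabs ('i%C ^+ x.1.1 * side_pt R N x.1.2 - 'i%C ^+ y.1.1 * side_pt R N y.1.2).
  apply: side_pt_separated; rewrite ?ltn_ord//.
  apply: contra xy => /eqP[e1 e2]; apply/eqP.
  have {}e1 := val_inj e1; have {}e2 := val_inj e2.
  by rewrite (surjective_pairing x) (surjective_pairing x.1) e1 e2 bb -!surjective_pairing.
have : 0 <= cabs ('i%C ^+ x.1.1 * side_pt R N x.1.2 - 'i%C ^+ y.1.1 * side_pt R N y.1.2) by exact: cabs_ge0.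
by nra.
Qed.

End Grid.

(** * The mean value inequality in several variables *)

Section GridSeveral.
Variable R : realType.
Local Notation C := (R[i]).
Variables (k N : nat).
Hypothesis N0 : (0 < N)%N.
Local Notation X := {ffun 'I_k -> grid_index N}.

Definition grid_vec (rho : R) (x : X) : 'rV[C]_k := \row_i grid_pt rho (x i).

Lemma card_grid_vec : #|{: X}| = ((4 * N * N) ^ k)%N.
Proof. by rewrite card_ffun card_grid_index card_ord. Qed.

Lemma grid_vec_bound (rho : R) (x : X) : 0 <= rho -> normv (grid_vec rho x) <= k%:R * (2 * rho).
Proof.
move=> r0; rewrite (@le_trans _ _ (\sum_(i < k) (2 * rho)))//.
  by apply: ler_sum => i _; rewrite mxE grid_pt_bound.
by rewrite sumr_const card_ord -[leLHS]mulr_natl.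
Qed.

Lemma grid_vec_separated (rho : R) (x y : X) : 0 <= rho -> x != y ->
  rho / (2 * N%:R) <= normv (grid_vec rho x - grid_vec rho y).
Proof.
move=> r0 xy; have [i xyi] : exists i, x i != y i.
  apply/existsP; apply: contraNT xy; rewrite negb_exists => /forallP h.
  by apply/eqP/ffunP => i; apply/eqP; have := h i; rewrite negbK.
rewrite (le_trans (grid_separated r0 xyi))//.
by have := normv_coord (grid_vec rho x - grid_vec rho y) i; rewrite !mxE.
Qed.

Let upd (x : X) j y : X := [ffun i => if i == j then y else x i].

(** Exchanging [y] with the j-th coordinate of [x] is an involution on the pairs (x, y). *)
Let sum_update (phi : X -> R) j :
  \sum_x \sum_y phi (upd x j y) = #|{: grid_index N}|%:R * \sum_x phi x.
Proof.
pose f (p : X * grid_index N) := (upd p.1 j p.2, p.1 j).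
have ff : cancel f f.
  move=> [x y]; rewrite /f /=; congr pair; last by rewrite ffunE eqxx.
  by apply/ffunP => i; rewrite !ffunE; case: eqVneq => // ->.
rewrite pair_bigA (reindex_inj (can_inj ff))/=.
transitivity (\sum_(p : X * grid_index N) phi p.1).
  apply: eq_bigr => -[x y] _ /=; congr phi.
  by apply/ffunP => i; rewrite !ffunE; case: eqVneq => // ->.
rewrite -(pair_bigA _ (fun x _ => phi x))/= mulr_sumr; apply: eq_bigr => x _.
by rewrite sumr_const mulr_natl.
Qed.

Variables (h : 'rV[C]_k -> C) (G : 'rV[C]_k -> 'I_k -> C) (r rho K : R).
Hypotheses (rho0 : 0 <= rho) (K0 : 0 <= K) (rhor : k%:R * (2 * rho) < r).
Hypothesis hG : forall z, normv z < r -> hgrad h z (G z).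
Hypothesis hTay : forall z v, normv z < r -> normv (z + v) < r ->
  cabs (h (z + v) - h z - pairing v (G z)) <= K * normv v ^+ 2.

Let e := 4 * K * rho ^+ 2 / N%:R.

Let e0 : 0 <= e.
Proof. by rewrite !mulr_ge0 ?exprn_ge0 ?invr_ge0 ?ler0n. Qed.

(** Interpolates between the origin (j = 0) and the grid point (j = k), one variable at a time. *)
Let trunc (j : nat) (x : X) : 'rV[C]_k :=
  \row_i (if (i < j)%N then grid_pt rho (x i) else 0).

Let trunc_step (j : 'I_k) (x : X) :
  cabs (h (trunc j x)) <= 2 * ((4 * N * N)%N%:R^-1 *
    (\sum_y cabs (h (trunc j.+1 (upd x j y))))) + e.
Proof.
pose d : 'rV[C]_k := delta_mx 0 j.
have bnd (t : C) : cabs t <= 2 * rho -> normv (trunc j x + t *: d) < r.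
  move=> ht; apply: le_lt_trans rhor.
  rewrite (@le_trans _ _ (\sum_(i < k) (2 * rho)))//; last first.
    by rewrite sumr_const card_ord -[leLHS]mulr_natl.
  apply: ler_sum => i _; rewrite !mxE; case: ltnP => ij.
    have -> : (i == j) = false by apply/eqP => ji; rewrite ji ltnn in ij.
    by rewrite andbF mulr0 addr0 grid_pt_bound.
  rewrite add0r; case: (i == j); first by rewrite mulr1.
  by rewrite mulr0 cabs0 mulr_ge0.
have := @grid_mean_value R (fun t => h (trunc j x + t *: d)) (fun t => G (trunc j x + t *: d) j)
  rho K N N0 rho0 K0.
rewrite scale0r addr0 => h1; apply: (le_trans (h1 _ _)).
- move=> t ht; rewrite -[G _ j]pairing_delta; apply: dif_slice.
  by apply: hG; exact: bnd.
- move=> t w ht htw; rewrite scalerDl addrA.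
  have := @hTay (trunc j x + t *: d) (w *: d) (bnd _ ht).
  rewrite -addrA -scalerDl => /(_ (bnd _ htw)).
  by rewrite pairingZ pairing_delta normvZ normv_delta mulr1 mulrC.
rewrite lerD2r le_eqVlt; apply/orP; left; apply/eqP; congr (_ * (_ * _)).
apply: eq_bigr => y _; congr (cabs (h _)); apply/rowP => i; rewrite !mxE !ffunE.
have [->|ij] := eqVneq i j; first by rewrite ltnn ltnS leqnn mulr1 add0r.
have ijn : (nat_of_ord i == nat_of_ord j) = false := negbTE ij.
by rewrite mulr0 addr0 ltnS [in RHS]leq_eqVlt ijn.
Qed.

Lemma grid_mean_value_several : cabs (h 0) <=
  2 ^+ k * (((4 * N * N) ^ k)%N%:R^-1 * (\sum_x cabs (h (grid_vec rho x))) + e).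
Proof.
have q0 : 0 < (4 * N * N)%N%:R :> R by rewrite ltr0n !muln_gt0 N0.
have n0 : 0 < ((4 * N * N) ^ k)%N%:R :> R by rewrite ltr0n expn_gt0 !muln_gt0 N0.
set n := ((4 * N * N) ^ k)%N%:R in n0 *.
(* With S_j the sum over [trunc j], averaging one variable gives S_j <= 2 S_(j+1) + n e; adding n e
   to both sides makes this a plain doubling. *)
have ind j : (j <= k)%N -> n * cabs (h 0) + n * e <= 2 ^+ j * (\sum_x cabs (h (trunc j x)) + n * e).
  elim: j => [_|j IH jk].
    rewrite expr0 mul1r lerD2r.
    under eq_bigr => x _.
      have -> : trunc 0 x = 0 by apply/rowP => i; rewrite !mxE.
      over.
    by rewrite sumr_const card_grid_vec mulr_natl.
  rewrite (le_trans (IH (ltnW jk)))// exprSr -mulrA ler_wpM2l ?exprn_ge0//.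
  have := ler_sum (index_enum X) (P := xpredT) (fun x _ => trunc_step (Ordinal jk) x).
  rewrite /= big_split/= sumr_const card_grid_vec -[X in _ <= _ + X]mulr_natl -/n -!mulr_sumr.
  rewrite (sum_update (fun x => cabs (h (trunc j.+1 x)))) card_grid_index mulKf ?gt_eqF//.
  have ne : 0 <= n * e by rewrite mulr_ge0 ?(ltW n0).
  lra.
have := ind k (leqnn k).
under eq_bigr => x _.
  have -> : trunc k x = grid_vec rho x by apply/rowP => i; rewrite !mxE ltn_ord.
  over.
move=> h1; rewrite -(ler_pM2l n0).
have -> : n * (2 ^+ k * (n^-1 * \sum_x cabs (h (grid_vec rho x)) + e)) =
   2 ^+ k * (\sum_x cabs (h (grid_vec rho x)) + n * e).
  by rewrite mulrCA mulrDr mulVKf ?gt_eqF.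
rewrite (le_trans _ h1)// lerDl mulr_ge0// ltW//.
Qed.

End GridSeveral.

(** * Lower bounds for iterated integrals *)

Section LowerIntegral.
Context d (T : measurableType d) (R : realType).
Variable mu : {measure set T -> \bar R}.
Local Open Scope ereal_scope.
Implicit Types f g : T -> \bar R.

Import HBNNSimple.

Lemma ge0_integral_mono f g : (forall x, 0 <= f x) -> (forall x, f x <= g x) ->
  \int[mu]_x f x <= \int[mu]_x g x.
Proof.
move=> f0 fg; have g0 x : 0 <= g x by exact: le_trans (fg x).
rewrite !ge0_integralTE//; apply: ge_ereal_sup => _ [h hf <-].
by apply: ereal_sup_ubound; exists h => // x; exact: le_trans (fg x).
Qed.

(** The sum of simple minorants of f and of g is a simple minorant of f + g. Taking the two suprema
    one after the other requires subtraction, hence the separate case where the right-hand side is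
    infinite. *)
Lemma ge0_integral_superadditive f g : (forall x, 0 <= f x) -> (forall x, 0 <= g x) ->
  \int[mu]_x f x + \int[mu]_x g x <= \int[mu]_x (f x + g x).
Proof.
move=> f0 g0; have fg0 x : 0 <= f x + g x by rewrite adde_ge0.
set c := \int[mu]_x (f x + g x).
have key (h1 h2 : {nnsfun T >-> R}) : (forall x, (h1 x)%:E <= f x) ->
    (forall x, (h2 x)%:E <= g x) -> sintegral mu h1 + sintegral mu h2 <= c.
  move=> hf hg; rewrite /c ge0_integralTE// -sintegralD//.
  apply: ereal_sup_ubound; exists (add_nnsfun h1 h2) => //= x.
  by rewrite EFinD leeD.
have c0 : 0 <= c by exact: integral_ge0.
have [cy|cfin] := eqVneq c +oo; first by rewrite cy leey.
have {}cfin : c \is a fin_num by rewrite ge0_fin_numE// lt_neqAle cfin leey.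
have z0 : sintegral mu (@nnsfun0 _ T R) = 0 by exact: sintegral0.
have fbound (h1 : {nnsfun T >-> R}) : (forall x, (h1 x)%:E <= f x) -> sintegral mu h1 <= c - \int[mu]_x g x.
  move=> hf.
  have s1 : sintegral mu h1 \is a fin_num.
    have s0 : 0 <= sintegral mu h1 by exact: sintegral_ge0.
    rewrite ge0_fin_numE//.
    apply: (@le_lt_trans _ _ c).
      rewrite -[leLHS]adde0 -[X in _ + X]z0; apply: key => // x.
    by rewrite -ge0_fin_numE.
  have gb : \int[mu]_x g x <= c - sintegral mu h1.
    rewrite [X in X <= _]ge0_integralTE//; apply: ge_ereal_sup => _ [h2 hg <-].
    by rewrite leeBrDr// addeC; exact: key.
  have gfin : \int[mu]_x g x \is a fin_num.
    rewrite ge0_fin_numE ?integral_ge0//; apply: (le_lt_trans gb).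
    by rewrite ltey_eq fin_numB cfin s1.
  by rewrite leeBrDr// addeC -leeBrDr.
have gfin : \int[mu]_x g x \is a fin_num.
  rewrite ge0_fin_numE ?integral_ge0//; apply: (@le_lt_trans _ _ c).
    rewrite [X in X <= _]ge0_integralTE//; apply: ge_ereal_sup => _ [h2 hg <-].
    by rewrite -[leLHS]add0e -[X in X + _]z0; exact: key.
  by rewrite -ge0_fin_numE.
rewrite -leeBrDr// [X in X <= _]ge0_integralTE//; apply: ge_ereal_sup => _ [h1 hf <-].
exact: fbound.
Qed.

End LowerIntegral.

Section IteratedIntegral.
Variable R : realType.
Local Open Scope ereal_scope.
Local Notation mu := (@lebesgue_measure R).

Lemma ge0_integral_interval (f : R -> \bar R) (c r M : R) : (0 <= r)%R -> (0 <= M)%R ->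
  (forall x, 0 <= f x) -> (forall x, (`|x - c| < r)%R -> M%:E <= f x) ->
  (2 * r * M)%:E <= \int[mu]_x f x.
Proof.
move=> r0 M0 f0 hf; set A : set R := `](c - r)%R, (c + r)%R[%classic.
have <- : \int[mu]_(x in A) cst M%:E x = (2 * r * M)%:E.
  rewrite integral_cst; last exact: measurable_itv.
  rewrite [X in _ * X]lebesgue_measure_itv /= lte_fin.
  have -> : (c + r)%:E - (c - r)%:E = (2 * r)%:E by rewrite -EFinB; congr (_%:E); ring.
  have [r1|r1] := ltP (c - r)%R (c + r)%R; first by rewrite -EFinM mulrC.
  have -> : r = 0%R by lra.
  by rewrite mule0 mulr0 mul0r.
rewrite integral_mkcond; apply: ge0_integral_mono => x; rewrite patchE; case: ifPn => // xA.
apply: hf; move: xA; rewrite inE /A /= in_itv/= => /andP[h1 h2].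
by rewrite ltr_norml; apply/andP; split; lra.
Qed.

Section Iterated.
Implicit Types F H : (nat -> R) -> \bar R.

Definition scons (x : R) (v : nat -> R) : nat -> R := fun j => if j is j'.+1 then v j' else x.

Lemma iint_ge0 n F : (forall x, 0 <= F x) -> 0 <= iint n F.
Proof.
elim: n F => [|n IH] F F0 //=; apply: integral_ge0 => x _.
by apply: IH.
Qed.

Lemma iint_mono n F H : (forall x, 0 <= F x) -> (forall x, F x <= H x) -> iint n F <= iint n H.
Proof.
elim: n F H => [|n IH] F H F0 FH //=; apply: ge0_integral_mono => x.
  exact: iint_ge0.
exact: IH.
Qed.

Lemma iint_superadditive n F H : (forall x, 0 <= F x) -> (forall x, 0 <= H x) ->
  iint n F + iint n H <= iint n (fun x => F x + H x).
Proof.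
elim: n F H => [|n IH] F H F0 H0 //=.
apply: le_trans; first by apply: ge0_integral_superadditive => x; exact: iint_ge0.
apply: ge0_integral_mono => x; last exact: IH.
by rewrite adde_ge0// iint_ge0.
Qed.

Lemma iint_sum n (I : Type) (s : seq I) (F : I -> (nat -> R) -> \bar R) :
  (forall i x, 0 <= F i x) ->
  \sum_(i <- s) iint n (F i) <= iint n (fun x => \sum_(i <- s) F i x).
Proof.
move=> F0; elim: s => [|i s IH].
  by rewrite big_nil; apply: iint_ge0 => x; rewrite big_nil.
rewrite big_cons.
have -> : (fun x => \sum_(j <- i :: s) F j x) = (fun x => F i x + \sum_(j <- s) F j x).
  by apply/funext => x; rewrite big_cons.
apply: le_trans (iint_superadditive _ _ _) => //.
  by rewrite leeD.
by move=> x; apply: sume_ge0.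
Qed.

(** Each interval may move with the earlier coordinates, as in a sheared box; its length is fixed,
    so every inner integral has the same lower bound and the lengths multiply. *)
Lemma iint_box n F (c : nat -> (nat -> R) -> R) (rho : nat -> R) (M : R) :
  (0 <= M)%R -> (forall j, (0 <= rho j)%R) ->
  (forall j x y, (forall l, (l < j)%N -> x l = y l) -> c j x = c j y) ->
  (forall x, 0 <= F x) ->
  (forall x, (forall j, (j < n)%N -> (`|x j - c j x| < rho j)%R) -> M%:E <= F x) ->
  (M * \prod_(j < n) (2 * rho j))%:E <= iint n F.
Proof.
elim: n F c rho M => [|n IH] F c rho M M0 rho0 cdep F0 hF.
  by rewrite big_ord0 mulr1/=; exact: hF.
rewrite big_ord_recl mulrCA/=.
apply: (@ge0_integral_interval _ (c 0%N (fun=> 0%R))) => //.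
- by rewrite mulr_ge0// prodr_ge0// => j _; rewrite mulr_ge0.
- by move=> x; exact: iint_ge0.
move=> x hx.
apply: (IH (fun v => F (scons x v)) (fun j v => c j.+1 (scons x v)) (fun j => rho j.+1) M) => //.
  move=> j v w vw; apply: cdep => -[|l]//=; exact: vw.
move=> v hv; apply: hF => -[_|j jn]; last exact: hv.
by rewrite /= (cdep _ _ (fun=> 0%R)).
Qed.

End Iterated.

End IteratedIntegral.

(** * Triangularization and the volume of affine images of balls *)

Section UnitaryFactor.
Variable R : realType.
Local Notation C := (R[i]).
Local Open Scope sesquilinear_scope.

Lemma row_unitary_norm n (Q : 'M[C]_n) i : Q \is unitarymx -> \sum_j cabs (Q i j) ^+ 2 = 1.
Proof.
move=> /unitarymxP/matrixP/(_ i i); rewrite !mxE eqxx mulr1n => h.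
apply: (@complexI R); rewrite rmorph_sum rmorph1 -h; apply: eq_bigr => j _.
by rewrite !mxE rmorphXn /= cabsE normCK.
Qed.

Lemma unitary_entry_le n (Q : 'M[C]_n) i j : Q \is unitarymx -> cabs (Q i j) <= 1.
Proof.
move=> /(row_unitary_norm i); rewrite (bigD1 j)//= => h.
rewrite -(@ler_pXn2r _ 2) ?nnegrE ?cabs_ge0// expr1n -h lerDl.
by apply: sumr_ge0 => l _; rewrite sqr_ge0.
Qed.

Lemma unitary_det n (Q : 'M[C]_n) : Q \is unitarymx -> cabs (\det Q) = 1.
Proof.
move=> /unitarymxP/(congr1 determinant); rewrite det_mulmx det1 det_map_mx det_tr => h.
apply/eqP; rewrite -(@eqrXn2 _ 2) ?cabs_ge0// expr1n; apply/eqP.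
by apply: (@complexI R); rewrite rmorphXn /= cabsE normCK h rmorph1.
Qed.

(* Gram-Schmidt from the last row up, which makes [T] upper triangular. *)
Lemma upper_unitary_factor n (B : 'M[C]_n) : exists T Q : 'M[C]_n,
  [/\ B = T *m Q, (forall i j : 'I_n, (j < i)%N -> T i j = 0),
      (forall i j, cabs (Q i j) <= 1) & cabs (\det Q) = 1].
Proof.
pose B' := rowsub (@rev_ord n) B; pose S := schmidt B'.
have Su : S \is unitarymx by exact: schmidt_unitarymx.
have low (i j : 'I_n) : (i < j)%N -> (B' *m S ^t*) i j = 0.
  move=> ij; have h : (row i B' <= kermx ((row j S) ^t*))%MS.
    apply: submx_trans (row_schmidt_sub B' i) _.
    apply/sumsmx_subP => l li; rewrite genmxE; apply/sub_kermxP.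
    apply/matrixP => a b; rewrite !ord1 mxE [RHS]mxE.
    have /unitarymxP/matrixP/(_ l j) := Su; rewrite !mxE.
    have -> : (l == j) = false by apply/eqP => e; rewrite e leqNgt ij in li.
    by rewrite mulr0n => h; rewrite -[RHS]h; apply: eq_bigr => p _; rewrite !mxE.
  move: h; rewrite sub_kermx => /eqP/(congr1 (fun M : 'M_1 => M 0 0)); rewrite !mxE => h0; rewrite -[RHS]h0.
  by apply: eq_bigr => p _; rewrite !mxE.
have BE : B' = (B' *m S ^t*) *m S.
  rewrite -mulmxA -invmx_unitary// mulVmx ?mulmx1//; exact: unitarymx_unit.
exists (\matrix_(i, j) (B' *m S ^t*) (rev_ord i) (rev_ord j)), (rowsub (@rev_ord n) S).
have Qu : rowsub (@rev_ord n) S \is unitarymx.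
  apply/unitarymxP/matrixP => i j; have /unitarymxP/matrixP/(_ (rev_ord i) (rev_ord j)) := Su.
  rewrite !mxE (inj_eq rev_ord_inj) => <-; apply: eq_bigr => p _; by rewrite !mxE.
split.
- apply/matrixP => i j; have -> : B i j = (B' *m S ^t* *m S) (rev_ord i) j by rewrite -BE mxE rev_ordK.
  rewrite mxE [RHS]mxE (reindex_inj rev_ord_inj)/=; apply: eq_bigr => p _.
  by rewrite !mxE.
- by move=> i j ji; rewrite mxE low//= ltn_sub2l// (leq_ltn_trans _ (ltn_ord i)).
- by move=> i j; exact: unitary_entry_le.
- exact: unitary_det.
Qed.

End UnitaryFactor.

Section Parallelepiped.
Variable R : realType.
Local Notation C := (R[i]).

Lemma prod_pairs (F : nat -> R) k :
  \prod_(m < 2 * k) F m = \prod_(j < k) (F (2 * j)%N * F (2 * j).+1).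
Proof.
elim: k => [|k IH]; first by rewrite muln0 !big_ord0.
by rewrite mulnS !addSn add0n !big_ord_recr/= IH -mulrA.
Qed.

(* With [invmx A = T Q], [T] upper triangular, the coordinates of
   [(w - w0) *m T] bound those of [u = (w - w0) *m invmx A], and the j-th one only
   involves the first j coordinates of [w]: no change in the order of
   integration is needed. *)
Lemma iint_parallelepiped k (A : 'M[C]_k) (w0 : 'rV[C]_k) (eta M : R) (g : (nat -> R) -> \bar R) :
  (0 < k)%N -> 0 < eta -> 0 <= M -> (forall x, (0 <= g x)%E) ->
  (forall x u, normv u < eta -> toC k x = w0 + u *m A -> (M%:E <= g x)%E) ->
  ((M * ((eta / (2 * k%:R ^+ 2)) ^+ (2 * k) * cabs (\det A) ^+ 2))%:E <= iint (2 * k) g)%E.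
Proof.
move=> k0 eta0 M0 g0 hg.
have [dA|dA] := eqVneq (\det A) 0.
  by rewrite dA cabs0 expr0n/= !mulr0; exact: iint_ge0.
have kp : 0 < k%:R :> R by rewrite ltr0n.
(* The entries of Q have modulus at most 1, so |v_j| <= eta' for all j gives |v Q| <= k^2 eta' = eta
   / 2 in the sum norm. *)
set eta' := eta / _; have eta'0 : 0 < eta' by rewrite divr_gt0// mulr_gt0// exprn_gt0.
have uA : A \in unitmx by rewrite unitmxE unitfE.
have [T [Q [BE Tup Qle Qdet]]] := upper_unitary_factor (invmx A).
have detT : cabs (\det A) * cabs (\det T) = 1.
  have : \det (A *m invmx A) = 1 by rewrite mulmxV// det1.
  by rewrite BE !det_mulmx => /(congr1 (@cabs R)); rewrite !cabsM Qdet cabs1 mulr1.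
have detTE : \det T = \prod_(j < k) T j j.
  rewrite -det_tr det_trig; first by apply: eq_bigr => j _; rewrite mxE.
  by apply/is_trig_mxP => i j ij; rewrite mxE Tup.
have Tjj j : 0 < cabs (T j j).
  rewrite cabs_gt0; apply/eqP => Tj0; have : cabs (\det T) = 0.
    by rewrite detTE (bigD1 j)//= Tj0 mul0r cabs0.
  by move=> d0; move: detT; rewrite d0 mulr0 => /eqP; rewrite eq_sym oner_eq0.
pose j0 : 'I_k := Ordinal k0.
(* Solves v_j = 0 for the j-th coordinate of w, so that v_j = T_jj (w_j - cen j w). A half width
   eta' / (2 |T_jj|) for both real coordinates then gives |v_j| <= eta'. *)
pose cen (j : 'I_k) (w : 'rV[C]_k) : C :=
  w0 0 j - (\sum_(i < k | (i < j)%N) (w 0 i - w0 0 i) * T i j) / T j j.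
pose idx (m : nat) : 'I_k := insubd j0 m./2.
pose c (m : nat) (x : nat -> R) : R :=
  if (m < 2 * k)%N then
    (if odd m then Im (cen (idx m) (toC k x)) else Re (cen (idx m) (toC k x)))
  else 0.
pose rho (m : nat) : R := eta' / (2 * cabs (T (idx m) (idx m))).
have idxe (j : 'I_k) : idx (2 * j)%N = j.
  by apply: val_inj; rewrite /idx val_insubd mul2n doubleK ltn_ord.
have idxo (j : 'I_k) : idx (2 * j).+1 = j.
  by apply: val_inj; rewrite /idx val_insubd mul2n /= uphalf_double ltn_ord.
(* The side lengths multiply to eta'^(2k) / |det T|^2, and |det T| is the inverse of |det A| because
   |det Q| = 1. *)
have -> : eta' ^+ (2 * k) * cabs (\det A) ^+ 2 = \prod_(m < 2 * k) (2 * rho m).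
  rewrite (prod_pairs (fun m => 2 * rho m)).
  have -> : \prod_(j < k) (2 * rho (2 * j)%N * (2 * rho (2 * j).+1)) =
            \prod_(j < k) (eta' ^+ 2 * ((cabs (T j j)) ^- 1) ^+ 2).
    apply: eq_bigr => j _; rewrite /rho idxe idxo; have := Tjj j => tj.
    by field; rewrite gt_eqF.
  rewrite big_split/= prodr_const card_ord -exprM; congr (_ * _).
  rewrite prodrXl; congr (_ ^+ 2).
  rewrite prodfV -cabs_prod -detTE.
  have dT : cabs (\det T) != 0.
    by apply/eqP => d0; move: detT; rewrite d0 mulr0 => /eqP; rewrite eq_sym oner_eq0.
  by apply: (mulIf dT); rewrite detT mulVf.
apply: (iint_box (c := c)) => //.
- by move=> j; rewrite /rho divr_ge0 ?mulr_ge0 ?cabs_ge0// ltW.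
- move=> m x y xy; rewrite /c; case: ifP => // mk.
  have mk2 : (m./2 < k)%N by rewrite ltn_half_double -mul2n.
  have -> : cen (idx m) (toC k x) = cen (idx m) (toC k y).
    rewrite /cen; congr (_ - _ / _); apply: eq_bigr => i ij; rewrite !mxE.
    have im : (i < m./2)%N by move: ij; rewrite /idx val_insubd mk2.
    have i1 : ((2 * i).+1 < m)%N.
      have h : (m./2.*2 <= m)%N by rewrite -{2}(odd_double_half m) leq_addl.
      by rewrite mul2n -doubleS (leq_trans _ h)// leq_double.
    by rewrite (xy _ i1) (xy _ (ltnW i1)).
  by [].
move=> x hx; set w := toC k x.
pose v := (w - w0) *m T.
have vE j : v 0 j = T j j * (w 0 j - cen j w).
  rewrite /v mxE (bigID (fun i : 'I_k => (i < j)%N))/=.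
  rewrite (bigD1 (P := fun i : 'I_k => ~~ (i < j)%N) j) ?ltnn//=.
  rewrite [X in _ + (_ + X)]big1 ?addr0; last first.
    move=> i /andP[ij inj]; rewrite Tup ?mulr0//.
    by rewrite ltn_neqAle eq_sym inj leqNgt.
  rewrite /cen !mxE.
  under eq_bigr do rewrite !mxE.
  have Tn : T j j != 0 by rewrite -cabs_gt0.
  have -> : \sum_(i < k | (i < j)%N) (w 0 i - w0 0 i) * T i j =
     \sum_(i < k | (i < j)%N) (((x (2 * i)%N +i* x (2 * i).+1)%C - w0 0 i) * T i j).
    by apply: eq_bigr => i _; rewrite !mxE.
  by field.
have vle j : cabs (v 0 j) <= eta'.
  rewrite vE cabsM.
  have jk : (2 * j < 2 * k)%N by rewrite ltn_pmul2l.
  have jk1 : ((2 * j).+1 < 2 * k)%N by rewrite -[(2 * j).+2]/(2 + 2 * j)%N -mulnS leq_pmul2l.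
  have h1 := hx _ jk; have h2 := hx _ jk1.
  rewrite /c jk idxe mul2n odd_double -mul2n /rho idxe in h1.
  rewrite /c jk1 idxo /= mul2n odd_double -mul2n /= /rho idxo -/w in h2.
  rewrite -/w in h1.
  have hR : Re (w 0 j - cen j w) = x (2 * j)%N - Re (cen j w).
    by rewrite /w mxE; case: (cen j _).
  have hI : Im (w 0 j - cen j w) = x (2 * j).+1 - Im (cen j w).
    by rewrite /w mxE; case: (cen j _).
  have := cabs_le (w 0 j - cen j w); rewrite hR hI => h3.
  have tj := Tjj j.
  have h4 : cabs (w 0 j - cen j w) <= eta' / cabs (T j j).
    rewrite (le_trans h3)//.
    have -> : eta' / cabs (T j j) = eta' / (2 * cabs (T j j)) + eta' / (2 * cabs (T j j)).
      by field; rewrite gt_eqF.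
    by rewrite lerD// ltW.
  by rewrite (le_trans (ler_wpM2l (cabs_ge0 _) h4))// mulrC divfK// gt_eqF.
apply: (hg x (v *m Q)).
  have vn : normv v <= k%:R * eta'.
    rewrite (@le_trans _ _ (\sum_(j < k) eta'))//; first exact: ler_sum.
    by rewrite sumr_const card_ord -[leLHS]mulr_natl.
  have vQ : normv (v *m Q) <= k%:R * normv v.
    rewrite (@le_trans _ _ (\sum_(l < k) normv v))//; last first.
      by rewrite sumr_const card_ord -[leLHS]mulr_natl.
    apply: ler_sum => l _; rewrite mxE (le_trans (cabs_sum _ _ _))//.
    by apply: ler_sum => j _; rewrite cabsM ler_piMr// cabs_ge0.
  apply: (le_lt_trans vQ); apply: (@le_lt_trans _ _ (k%:R * (k%:R * eta'))).
    by rewrite ler_wpM2l// ltW.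
  have -> : k%:R * (k%:R * eta') = eta / 2 by rewrite /eta'; field; rewrite gt_eqF.
  by lra.
by rewrite -mulmxA -mulmxA (mulmxA T) -BE mulVmx// mulmx1 addrC subrK.
Qed.

End Parallelepiped.

(** * Holomorphic maps and automorphisms of the ball *)

Section HolomorphicMaps.
Variable R : realType.
Local Notation C := (R[i]).

Definition hdiff n (h : 'rV[C]_n -> C) (z : 'rV[C]_n) := exists g, hgrad h z g.

Section Scalar.
Variable n : nat.
Implicit Types (h : 'rV[C]_n -> C) (z : 'rV[C]_n).

Lemma hdiff_cst (c : C) z : hdiff (fun=> c) z.
Proof.
exists (fun=> 0); apply: dif_eq (dif_cst (normv_is_norm R n) c z) => w.
by rewrite /pairing big1// => j _; rewrite mulr0.
Qed.

Lemma hdiff_coord j z : hdiff (fun w => w 0 j) z.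
Proof.
exists (fun i => (i == j)%:R).
have E (w : 'rV[C]_n) : pairing w (fun i => (i == j)%:R) = w 0 j.
  rewrite /pairing (bigD1 j)//= eqxx mulr1 big1 ?addr0// => i /negbTE ->.
  by rewrite mulr0.
have := hgrad_pairing 0 z (fun i => (i == j)%:R).
by under eq_fun do rewrite subr0 E.
Qed.

Lemma hdiffD h h' z : hdiff h z -> hdiff h' z -> hdiff (fun w => h w + h' w) z.
Proof.
move=> [g hg] [g' hg']; exists (fun j => g j + g' j).
apply: dif_eq (difD (normv_is_norm R n) hg hg') => w.
by rewrite /pairing -big_split; apply: eq_bigr => j _; rewrite mulrDr.
Qed.

Lemma hdiffM h h' z : hdiff h z -> hdiff h' z -> hdiff (fun w => h w * h' w) z.
Proof.
move=> [g hg] [g' hg']; exists (fun j => h z * g' j + h' z * g j).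
apply: dif_eq (difM (normv_is_norm R n) hg hg') => w.
rewrite /pairing !mulr_sumr -big_split; apply: eq_bigr => j _ /=; ring.
Qed.

Lemma hdiffV h z : h z != 0 -> hdiff h z -> hdiff (fun w => (h w)^-1) z.
Proof.
move=> hz [g hg]; exists (fun j => - (g j / h z ^+ 2)).
apply: dif_eq (difI (normv_is_norm R n) hz hg) => w.
rewrite /pairing mulr_suml -sumrN; apply: eq_bigr => j _.
by rewrite mulrN mulrA.
Qed.

Lemma hdiffB h h' z : hdiff h z -> hdiff h' z -> hdiff (fun w => h w - h' w) z.
Proof.
move=> h1 h2; have := hdiffD h1 (hdiffM (hdiff_cst (-1) z) h2).
by under eq_fun do rewrite mulN1r.
Qed.

Lemma hdiff_sum I (r : seq I) (P : pred I) (F : I -> 'rV[C]_n -> C) z :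
  (forall i, P i -> hdiff (F i) z) -> hdiff (fun w => \sum_(i <- r | P i) F i w) z.
Proof.
move=> hF; elim: r => [|i r IH].
  by under eq_fun do rewrite big_nil; exact: hdiff_cst.
under eq_fun do rewrite big_cons; case: (boolP (P i)) => Pi //.
by apply: hdiffD => //; exact: hF.
Qed.

Lemma hdiff_prod I (r : seq I) (P : pred I) (F : I -> 'rV[C]_n -> C) z :
  (forall i, P i -> hdiff (F i) z) -> hdiff (fun w => \prod_(i <- r | P i) F i w) z.
Proof.
move=> hF; elim: r => [|i r IH].
  by under eq_fun do rewrite big_nil; exact: hdiff_cst.
under eq_fun do rewrite big_cons; case: (boolP (P i)) => Pi //.
by apply: hdiffM => //; exact: hF.
Qed.

Lemma hdiff_shift h z v : hdiff h (z + v) -> hdiff (fun x => h (x + v)) z.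
Proof. by move=> [g hg]; exists g; exact: hgrad_shift. Qed.

Lemma hdiff_det m (F : 'rV[C]_n -> 'M[C]_m) z :
  (forall i j, hdiff (fun w => F w i j) z) -> hdiff (fun w => \det (F w)) z.
Proof.
move=> hF; apply: hdiff_sum => s _; apply: hdiffM; first exact: hdiff_cst.
by apply: hdiff_prod.
Qed.

End Scalar.

Section Maps.
Implicit Types n m p : nat.

Lemma cderiv_dif n m (f : 'rV[C]_n -> 'rV[C]_m) z L :
  cderiv f z L <-> dif (@normv R n) (@normv R m) f z (fun w => w *m L).
Proof.
split=> [h|[_ h]]; last exact: h.
split; last exact: h.
by exists (mx_mass L) => w; rewrite mulrC normv_mul.
Qed.

Lemma cderiv_coord n m (f : 'rV[C]_n -> 'rV[C]_m) z L j :
  cderiv f z L -> hgrad (fun w => f w 0 j) z (L^~ j).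
Proof.
move=> h; split.
  by have [K K0 hK] := pairing_bound (L^~ j); exists K.
move=> e e0; have [d d0 hd] := h _ e0; exists d => // w /hd.
apply: le_trans; have := normv_coord (f (z + w) - f z - w *m L) j.
by rewrite !mxE.
Qed.

Lemma coord_cderiv n m (f : 'rV[C]_n -> 'rV[C]_m) z :
  (forall j, hdiff (fun w => f w 0 j) z) -> exists L, cderiv f z L.
Proof.
move=> /choice[g hg]; exists (\matrix_(i, j) g j i).
have N0 := @normv_ge0 R n.
have sumoo (s : seq 'I_m) : is_oo (@normv R n) (fun w =>
    \sum_(j <- s) cabs (f (z + w) 0 j - f z 0 j - pairing w (g j))).
  elim: s => [|j s IH].
    by move=> e e0; exists 1 => // w _; rewrite big_nil mulr_ge0// ltW.
  under eq_fun do rewrite big_cons.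
  by apply: is_ooD => //; exact: (hg j).2.
move=> e e0; have [d d0 hd] := sumoo (index_enum 'I_m) _ e0; exists d => // w /hd.
apply: le_trans; rewrite le_eqVlt; apply/orP; left; apply/eqP.
apply: eq_bigr => j _; rewrite !mxE; congr (cabs (_ - _)).
by apply: eq_bigr => i _; rewrite mxE.
Qed.

Lemma cderiv_comp n m p (f : 'rV[C]_n -> 'rV[C]_m) (g : 'rV[C]_m -> 'rV[C]_p) z L M :
  cderiv f z L -> cderiv g (f z) M -> cderiv (g \o f) z (L *m M).
Proof.
move=> /cderiv_dif hf /cderiv_dif hg; apply/cderiv_dif.
apply: dif_eq (dif_comp (normv_is_norm R n) (normv_is_norm R m) (normv_is_norm R p)
   (fun a b => mulmxBl a b M) hf hg) => w /=.
by rewrite mulmxA.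
Qed.

Lemma hdiff_comp n m (f : 'rV[C]_n -> 'rV[C]_m) (h : 'rV[C]_m -> C) z L :
  cderiv f z L -> hdiff h (f z) -> hdiff (fun w => h (f w)) z.
Proof.
move=> /cderiv_dif hf [g hg]; exists (fun i => \sum_j L i j * g j).
have := dif_comp (normv_is_norm R n) (normv_is_norm R m) (cabs_is_norm R)
   (fun a b => pairingB a b g) hf hg.
apply: dif_eq => w /=; rewrite /pairing.
under eq_bigr do rewrite mxE mulr_suml.
rewrite exchange_big/=; apply: eq_bigr => i _; rewrite mulr_sumr.
by apply: eq_bigr => j _; rewrite mulrA.
Qed.

Lemma cderiv_unique n m (f : 'rV[C]_n -> 'rV[C]_m) z L M :
  cderiv f z L -> cderiv f z M -> L = M.
Proof.
move=> hL hM; apply/row_matrixP => i; rewrite !rowE; apply/eqP; rewrite -subr_eq0.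
apply/eqP; apply: normv_eq0; apply/eqP; rewrite eq_le normv_ge0 andbT.
apply/ler_addgt0Pr => e e0; rewrite add0r.
have e20 : 0 < e / 2 by lra.
have [d d0 hd] := hL _ e20; have [d' d'0 hd'] := hM _ e20.
pose t := Num.min d d' / 2; have t0 : 0 < t by rewrite divr_gt0// lt_min d0.
pose w : 'rV[C]_n := t%:C%C *: delta_mx 0 i.
have wt : normv w = t by rewrite normvZ normv_delta mulr1 cabs_real ger0_norm// ltW.
have wd : normv w < Num.min d d' by rewrite wt /t ltr_pdivrMr// ltr_pMr ?lt_min ?d0//; lra.
move: wd; rewrite lt_min => /andP[/hd h1 /hd' h2].
rewrite -(ler_pM2l t0).
have -> : t * normv (delta_mx 0 i *m L - delta_mx 0 i *m M) = normv (w *m L - w *m M).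
  by rewrite -!scalemxAl -scalerBr normvZ cabs_real ger0_norm// ltW.
have -> : w *m L - w *m M = (f (z + w) - f z - w *m M) - (f (z + w) - f z - w *m L).
  by rewrite opprB [RHS]addrC addrA subrK.
have := normvD (f (z + w) - f z - w *m M) (- (f (z + w) - f z - w *m L)).
rewrite normvN wt in h1 h2 *; lra.
Qed.

Lemma cderiv_eq_near n m (f g : 'rV[C]_n -> 'rV[C]_m) z L (d : R) : 0 < d ->
  (forall w, normv w < d -> f (z + w) = g (z + w)) -> cderiv f z L -> cderiv g z L.
Proof.
move=> d0 fg /cderiv_dif hf; apply/cderiv_dif.
exact: (dif_eq_near (normv_is_norm R n) d0 fg).
Qed.

Lemma cderiv_id n (z : 'rV[C]_n) : cderiv id z 1%:M.
Proof.
apply/cderiv_dif; apply: dif_eq (dif_id z (normv_is_norm R n)) => w.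
by rewrite mulmx1.
Qed.

Lemma holo_on_comp n m p (U : set 'rV[C]_n) (V : set 'rV[C]_m)
    (f : 'rV[C]_n -> 'rV[C]_m) (g : 'rV[C]_m -> 'rV[C]_p) :
  holo_on U f -> holo_on V g -> (forall z, U z -> V (f z)) -> holo_on U (g \o f).
Proof.
move=> hf hg fUV z Uz; have [L hL] := hf z Uz; have [M hM] := hg _ (fUV _ Uz).
by exists (L *m M); exact: cderiv_comp.
Qed.

End Maps.

End HolomorphicMaps.

Section BallAutomorphism.
Variable R : realType.
Local Notation C := (R[i]).
Variable n : nat.
Implicit Types a z : 'rV[C]_n.

Lemma conj_real (x : R) : (x%:C%C)^* = x%:C%C :> C.
Proof. exact: conjc_real. Qed.

Lemma cabs_sqrE (z : C) : (cabs z ^+ 2)%:C%C = z * z^*.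
Proof. by rewrite rmorphXn /= cabsE normCK. Qed.

Definition sqnorm z : R := \sum_(j < n) cabs (z 0 j) ^+ 2.

Lemma sqnormE z : (sqnorm z)%:C%C = \sum_j z 0 j * (z 0 j)^*.
Proof. by rewrite rmorph_sum; apply: eq_bigr => j _; exact: cabs_sqrE. Qed.

Definition hdot z a : C := \sum_j z 0 j * (a 0 j)^*.

Definition mobius_s a : C := (Num.sqrt (1 - sqnorm a))%:C%C.

(* The involutive automorphism of the ball exchanging 0 and a; using
   (1 - s) / |a|^2 = 1 / (1 + s) avoids the projection onto the line of a. *)
Definition mobius a z : 'rV[C]_n :=
  (1 - hdot z a)^-1 *: ((1 - hdot z a / (1 + mobius_s a)) *: a - mobius_s a *: z).

Section Fix_a.
Variable a : 'rV[C]_n.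
Hypothesis ha : sqnorm a < 1.
Local Notation s := (mobius_s a).

Let sr := Num.sqrt (1 - sqnorm a).
Let sr0 : 0 < sr. Proof. by rewrite sqrtr_gt0 subr_gt0. Qed.

Lemma mobius_s2 : \sum_j a 0 j * (a 0 j)^* = 1 - s ^+ 2.
Proof.
have := ha; rewrite -sqnormE /mobius_s -rmorphXn /= => h; rewrite sqr_sqrtr ?subr_ge0 ?ltW//.
by rewrite rmorphB rmorph1 opprB addrC subrK.
Qed.

Lemma mobius_s_neq0 : s != 0.
Proof. by rewrite -cabs_eq0 cabs_real gt_eqF// normr_gt0 gt_eqF. Qed.

Lemma mobius_1s_neq0 : 1 + s != 0.
Proof.
by rewrite -(rmorph1 (real_complex R)) -rmorphD -cabs_eq0 cabs_real gt_eqF// normr_gt0 gt_eqF.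
Qed.

(** The classical formula for 1 - |mobius a z|^2, cleared of its denominator, where s^2 = 1 - |a|^2.
    Written with conjugates it is a rational identity in the two scalar products and s. *)
Lemma mobius_identity z :
  (1 - hdot z a) * (1 - hdot z a)^* -
  \sum_j ((1 - hdot z a / (1 + s)) * a 0 j - s * z 0 j) *
         ((1 - hdot z a / (1 + s)) * a 0 j - s * z 0 j)^* =
  s ^+ 2 * (1 - \sum_j z 0 j * (z 0 j)^*).
Proof.
have s1 := mobius_1s_neq0; have s2 := mobius_s2.
have sc : s^* = s by exact: conj_real.
set al := 1 - hdot z a / (1 + s).
have -> : \sum_j (al * a 0 j - s * z 0 j) * (al * a 0 j - s * z 0 j)^* =
  al * al^* * (\sum_j a 0 j * (a 0 j)^*) - al * s * (hdot z a)^* - s * al^* * hdot z a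
  + s ^+ 2 * (\sum_j z 0 j * (z 0 j)^*).
  rewrite /hdot rmorph_sum !mulr_sumr -!sumrB -big_split/=; apply: eq_bigr => j _.
  rewrite rmorphB !rmorphM /= conjCK sc; ring.
have alc : al^* = 1 - (hdot z a)^* / (1 + s).
  by rewrite /al rmorphB rmorph1 rmorphM /= fmorphV rmorphD rmorph1 /= sc.
have -> : (1 - hdot z a)^* = 1 - (hdot z a)^* by rewrite rmorphB rmorph1.
rewrite s2 alc /al.
move: (\sum_j z 0 j * _) => Z; move: (hdot z a)^* => lac; move: (hdot z a) => la.
by field.
Qed.

(** Positivity of the right-hand side of [mobius_identity] yields both claims: the denominator is
    nonzero, and it dominates the numerator. *)
Lemma mobius_estimate z : sqnorm z < 1 -> 1 - hdot z a != 0 /\ sqnorm (mobius a z) < 1.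
Proof.
move=> hz; pose nu := (1 - hdot z a / (1 + s)) *: a - s *: z.
have key : cabs (1 - hdot z a) ^+ 2 - sqnorm nu = sr ^+ 2 * (1 - sqnorm z).
  apply: (@complexI R).
  have -> : (cabs (1 - hdot z a) ^+ 2 - sqnorm nu)%:C%C =
      (cabs (1 - hdot z a) ^+ 2)%:C%C - (sqnorm nu)%:C%C :> C by rewrite rmorphB.
  have -> : (sr ^+ 2 * (1 - sqnorm z))%:C%C = sr%:C%C ^+ 2 * (1 - (sqnorm z)%:C%C) :> C.
    by rewrite rmorphM rmorphXn rmorphB rmorph1.
  rewrite cabs_sqrE !sqnormE -mobius_identity; congr (_ - _); apply: eq_bigr => j _.
  by rewrite !mxE.
have pos : 0 < sr ^+ 2 * (1 - sqnorm z) by rewrite mulr_gt0 ?exprn_gt0 ?subr_gt0.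
have nu0 : 0 <= sqnorm nu by apply: sumr_ge0 => j _; rewrite sqr_ge0.
have D2 : 0 < cabs (1 - hdot z a) ^+ 2 by lra.
have D0 : 1 - hdot z a != 0.
  by apply/eqP => D0; move: D2; rewrite D0 cabs0 expr0n/= ltxx.
split=> //.
have -> : sqnorm (mobius a z) = sqnorm nu / cabs (1 - hdot z a) ^+ 2.
  rewrite /sqnorm mulr_suml; apply: eq_bigr => j _.
  by rewrite /mobius -/nu mxE cabsM cabsV exprMn exprVn mulrC.
by rewrite ltr_pdivrMr// mul1r; lra.
Qed.

(** This is the denominator met when [mobius a] is applied a second time. *)
Lemma hdot_mobius z : 1 - hdot z a != 0 ->
  1 - hdot (mobius a z) a = s ^+ 2 / (1 - hdot z a).
Proof.
move=> D0; have s1 := mobius_1s_neq0.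
have -> : hdot (mobius a z) a = (1 - hdot z a)^-1 *
   ((1 - hdot z a / (1 + s)) * (\sum_j a 0 j * (a 0 j)^*) - s * hdot z a).
  rewrite /hdot !mulr_sumr -sumrB mulr_sumr; apply: eq_bigr => j _.
  by rewrite /mobius /hdot !mxE; ring.
rewrite mobius_s2; move: (hdot z a) D0 => la D0.
by field; rewrite D0 s1.
Qed.

Lemma mobiusK z : 1 - hdot z a != 0 -> mobius a (mobius a z) = z.
Proof.
move=> D0; have s1 := mobius_1s_neq0; have s0 := mobius_s_neq0.
have e := hdot_mobius D0.
have e' : hdot (mobius a z) a = 1 - s ^+ 2 / (1 - hdot z a).
  by rewrite -e opprB addrC subrK.
apply/rowP => j; rewrite {1}/mobius e e' !mxE.
move: (hdot z a) D0 (a 0 j) (z 0 j) => la D0 aj zj.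
move: (mobius_s a) s1 s0 => s s1 s0.
by field; rewrite D0 s1 s0.
Qed.

Lemma mobius0 : mobius a 0 = a.
Proof.
have h0 : hdot 0 a = 0 by rewrite /hdot big1// => j _; rewrite mxE mul0r.
by rewrite /mobius h0 mul0r !subr0 invr1 !scale1r scaler0 subr0.
Qed.

Lemma mobius_holo : holo_on (unit_ball n) (mobius a).
Proof.
move=> z hz; have [D0 _] := mobius_estimate hz.
apply: coord_cderiv => j; rewrite /mobius.
have hd : hdiff (hdot^~ a) z.
  apply: hdiff_sum => i _; apply: hdiffM; [exact: hdiff_coord|exact: hdiff_cst].
under eq_fun do rewrite !mxE.
apply: hdiffM; first by apply: hdiffV => //; apply: hdiffB => //; exact: hdiff_cst.
apply: hdiffB; apply: hdiffM; try exact: hdiff_cst; last exact: hdiff_coord.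
apply: hdiffB; first exact: hdiff_cst.
by apply: hdiffM => //; exact: hdiff_cst.
Qed.

End Fix_a.

(** The given map F sends p to some a; composing with the involution [mobius a], which exchanges 0
    and a, moves the centre to p. *)
Lemma centered_biholomorphism (U : set 'rV[C]_n) p :
  biholomorphic U (unit_ball n) -> U p ->
  exists Phi Psi : 'rV[C]_n -> 'rV[C]_n,
    [/\ holo_on (unit_ball n) Phi, holo_on U Psi,
        (forall z, unit_ball n z -> U (Phi z) /\ Psi (Phi z) = z),
        (forall w, U w -> unit_ball n (Psi w)) & Phi 0 = p].
Proof.
move=> [F [G [hF hG FU GB [GF FG]]]] Up.
have Fb w : U w -> unit_ball n (F w) by move=> Uw; apply: FU; exists w.
have Gb w : unit_ball n w -> U (G w) by move=> Uw; apply: GB; exists w.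
pose a := F p; have ha : sqnorm a < 1 := Fb p Up.
have mb z : unit_ball n z -> unit_ball n (mobius a z).
  by move=> hz; have [] := mobius_estimate ha hz.
exists (G \o mobius a), (mobius a \o F); split.
- apply: holo_on_comp mb; [exact: mobius_holo|exact: hG].
- apply: holo_on_comp Fb; [exact: hF|exact: mobius_holo].
- move=> z hz; split; first by apply: Gb; exact: mb.
  rewrite /= FG; last exact: mb.
  by rewrite mobiusK//; have [] := mobius_estimate ha hz.
- by move=> w Uw; apply: mb; exact: Fb.
- by rewrite /= mobius0 GF.
Qed.

End BallAutomorphism.

(** * The Bergman inequality *)

Section Compactness.
Variable R : realType.
Local Notation C := (R[i]).
Variable n : nat.

(** A cube in the 2n real coordinates, the shape to which [cube_bisection] applies. *)
Definition polysquare (s : R) : set 'rV[C]_n :=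
  [set z | forall j, `|Re (z 0 j)| <= s /\ `|Im (z 0 j)| <= s].

Let real_coord (z : 'rV[C]_n) (i : 'I_n * bool) : R :=
  if i.2 then Im (z 0 i.1) else Re (z 0 i.1).

Lemma interval_dist (a l x y : R) : a <= x <= a + l -> a <= y <= a + l -> `|x - y| <= l.
Proof. by move=> /andP[? ?] /andP[? ?]; rewrite ler_norml; apply/andP; split; lra. Qed.

Lemma interval_half (a l x : R) (h := (a + l / 2 <= x)%R%:R * (l / 2)) :
  a <= x <= a + l -> a + h <= x <= a + h + l / 2.
Proof.
rewrite /h; case: (leP (a + l / 2) x) => h3 /andP[h1 h2]; rewrite ?mul1r ?mul0r; apply/andP; split; lra.
Qed.

(** Compactness as an induction principle on sets, used instead of finite subcovers: a cube is the
    finite union of its halves in every coordinate. *)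
Lemma polysquare_compact (P : set 'rV[C]_n -> Prop) s : 0 < s ->
  (forall A B, A `<=` B -> P B -> P A) ->
  (forall A B, P A -> P B -> P (A `|` B)) ->
  (forall z, polysquare s z -> exists2 d, 0 < d & P [set w | normv (w - z) < d]) ->
  P (polysquare s).
Proof.
move=> s0 Pmono PU Ploc.
pose Q (a : 'I_n * bool -> R) l := P [set z | cube a l (real_coord z)].
have : Q (fun=> - s) (2 * s).
  apply: cube_bisection; last 2 first.
  - by rewrite mulr_gt0.
  - move=> x hx.
    pose z : 'rV[C]_n := \row_j (x (j, false) +i* x (j, true))%C.
    have zx i : real_coord z i = x i by case: i => j []; rewrite /real_coord mxE.
    have Kz : polysquare s z.
      move=> j; have := hx (j, false); have := hx (j, true).
      by rewrite !mxE /= !ler_norml => /andP[? ?] /andP[? ?]; split; apply/andP; split; lra.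
    have [d d0 hd] := Ploc z Kz.
    (* Two points of a cube of side l are at distance at most 2 n l in the sum norm; the added 1
       keeps the divisor positive for n = 0. *)
    exists (d / (2 * n%:R + 1)); first by rewrite divr_gt0// ltr_wpDl// mulr_ge0.
    move=> a l l0; rewrite ltr_pdivlMr ?ltr_wpDl ?mulr_ge0// => ld ha.
    apply: Pmono hd => w hw /=.
    have : normv (w - z) <= n%:R * (2 * l).
      rewrite (@le_trans _ _ (\sum_(j < n) (2 * l)))//; last first.
        by rewrite sumr_const card_ord -[leLHS]mulr_natl.
      apply: ler_sum => j _; rewrite !mxE (le_trans (cabs_le _))//.
      have hu := interval_dist (hw (j, false)) (ha (j, false)).
      have hv := interval_dist (hw (j, true)) (ha (j, true)).
      move: hu hv; rewrite /real_coord /=; case: (w 0 j) => u v /= hu hv.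
      by rewrite mulr_natl mulr2n lerD.
    move=> h; apply: (le_lt_trans h); lra.
  move=> a l l0 hb.
  have hs (r : seq {ffun 'I_n * bool -> bool}) : P [set z | exists2 b, b \in r & cube (subcube_corner a l b) (l / 2) (real_coord z)].
    elim: r => [|b r IH]; first by apply: Pmono (hb [ffun=> false]) => z [].
    apply: Pmono (PU _ _ (hb b) IH) => z [b']; rewrite inE => /predU1P[->|b'r] hz; first by left.
    by right; exists b'.
  apply: Pmono (hs (enum {: {ffun 'I_n * bool -> bool}})) => z hz.
  exists [ffun i => a i + l / 2 <= real_coord z i]; first by rewrite mem_enum.
  by move=> i; rewrite /subcube_corner ffunE; exact: interval_half (hz i).
apply: Pmono => z hz [j b]; have [h1 h2] := hz j; rewrite /real_coord /=.
by move: h1 h2; rewrite !ler_norml => /andP[? ?] /andP[? ?]; case: b; apply/andP; split; lra.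
Qed.

Lemma polysquare_bounded (u : 'rV[C]_n -> C) s : 0 < s ->
  (forall z, polysquare s z -> exists g, hgrad u z g) ->
  exists2 M : R, 0 <= M & forall z, polysquare s z -> cabs (u z) <= M.
Proof.
move=> s0 hu.
apply: (@polysquare_compact (fun A => exists2 M : R, 0 <= M & forall z, A z -> cabs (u z) <= M)) => //.
- by move=> A B AB [M M0 hM]; exists M => // z /AB /hM.
- move=> A B [M M0 hM] [M' M'0 hM']; exists (M + M'); first exact: addr_ge0.
  by move=> z [/hM h|/hM' h]; lra.
- move=> z /hu[g hg].
  have [d d0 hd] := dif_continuous (normv_is_norm R n) (cabs_is_norm R) hg ltr01.
  exists d => //; exists (cabs (u z) + 1); first by rewrite addr_ge0// cabs_ge0.
  move=> w /= wz; have := hd _ wz; rewrite (addrC z) subrK => h.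
  by have := cabsD (u w - u z) (u z); rewrite subrK; lra.
Qed.

Lemma ball_polysquare (s : R) z : normv z < s -> polysquare s z.
Proof.
move=> zs j; have h := normv_coord z j; split; apply: ltW.
  by apply: le_lt_trans (le_lt_trans h zs); exact: Re_le_cabs.
by apply: le_lt_trans (le_lt_trans h zs); exact: Im_le_cabs.
Qed.

Lemma polysquare_normv (s : R) z : polysquare s z -> normv z <= n%:R * (2 * s).
Proof.
move=> hz; rewrite (@le_trans _ _ (\sum_(j < n) (2 * s)))//; last first.
  by rewrite sumr_const card_ord -[leLHS]mulr_natl.
by apply: ler_sum => j _; have [h1 h2] := hz j; rewrite (le_trans (cabs_le _))//; lra.
Qed.

Lemma normv_unit_ball (z : 'rV[C]_n) : normv z < 1 -> unit_ball n z.
Proof.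
move=> hz; rewrite /unit_ball /= (le_lt_trans _ hz)//; apply: ler_sum => j _.
have := normv_coord z j; have := cabs_ge0 (z 0 j) => h0 h1.
by rewrite expr2 ler_piMl//; lra.
Qed.

Lemma det_le (A : 'M[C]_n) (B : R) : 0 <= B -> (forall i j, cabs (A i j) <= B) ->
  cabs (\det A) <= (n`!)%:R * B ^+ n.
Proof.
move=> B0 hA; rewrite (le_trans (cabs_sum _ _ _))//.
rewrite (@le_trans _ _ (\sum_(s : 'S_n) B ^+ n))//; last first.
  by rewrite sumr_const card_Sn -[leLHS]mulr_natl.
apply: ler_sum => s _; rewrite cabsM cabs_prod.
have -> : @cabs R ((-1) ^+ s) = 1 by rewrite cabsX cabsN cabs1 expr1n.
rewrite mul1r -[X in _ <= _ ^+ X]card_ord -prodr_const.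
by apply: ler_prod => i _; rewrite cabs_ge0 hA.
Qed.

End Compactness.

(** * Difference quotients and the Jacobian determinant *)

Section LimitAtZero.
Variable R : realType.
Local Notation C := (R[i]).

Definition lim0 (u : R -> C) (l : C) := forall e, 0 < e -> exists2 d : R, 0 < d &
  forall s, 0 < s -> s < d -> cabs (u s - l) <= e.

Lemma lim0_cst c : lim0 (fun=> c) c.
Proof. by move=> e e0; exists 1 => // s _ _; rewrite subrr cabs0 ltW. Qed.

Lemma lim0D u v l m : lim0 u l -> lim0 v m -> lim0 (fun s => u s + v s) (l + m).
Proof.
move=> hu hv e e0; have e20 : 0 < e / 2 by lra.
have [d d0 hd] := hu _ e20; have [d' d'0 hd'] := hv _ e20.
exists (Num.min d d'); first by rewrite lt_min d0.
move=> s s0; rewrite lt_min => /andP[/(hd _ s0) h1 /(hd' _ s0) h2].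
have := cabsD (u s - l) (v s - m).
have -> : u s - l + (v s - m) = u s + v s - (l + m) by ring.
lra.
Qed.

Lemma lim0M u v l m : lim0 u l -> lim0 v m -> lim0 (fun s => u s * v s) (l * m).
Proof.
move=> hu hv e e0.
pose q := 1 + cabs l + cabs m; have q0 : 0 < q by have := cabs_ge0 l; have := cabs_ge0 m; rewrite /q; lra.
pose e' := Num.min 1 (e / q); have e'0 : 0 < e' by rewrite lt_min ltr01 divr_gt0.
have [d d0 hd] := hu _ e'0; have [d' d'0 hd'] := hv _ e'0.
exists (Num.min d d'); first by rewrite lt_min d0.
move=> s s0; rewrite lt_min => /andP[/(hd _ s0) h1 /(hd' _ s0) h2].
have -> : u s * v s - l * m = (u s - l) * (v s - m) + (l * (v s - m) + m * (u s - l)) by ring.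
rewrite (le_trans (cabsD _ _))//.
have h3 := cabsD (l * (v s - m)) (m * (u s - l)).
have e1 : e' <= 1 by rewrite ge_min lexx.
have e2 : e' * q <= e by rewrite -ler_pdivlMr// ge_min lexx orbT.
have h4 : cabs ((u s - l) * (v s - m)) <= 1 * e'.
  by rewrite cabsM ler_pM ?cabs_ge0//; lra.
have h5 : cabs (l * (v s - m)) <= cabs l * e' by rewrite cabsM ler_wpM2l ?cabs_ge0.
have h6 : cabs (m * (u s - l)) <= cabs m * e' by rewrite cabsM ler_wpM2l ?cabs_ge0.
have h7 : e' * q = 1 * e' + cabs l * e' + cabs m * e' by rewrite /q; ring.
lra.
Qed.

Lemma lim0_sum I (r : seq I) (u : I -> R -> C) (l : I -> C) :
  (forall i, lim0 (u i) (l i)) -> lim0 (fun s => \sum_(i <- r) u i s) (\sum_(i <- r) l i).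
Proof.
move=> h; elim: r => [|i r IH].
  by rewrite big_nil; under eq_fun do rewrite big_nil; exact: lim0_cst.
by rewrite big_cons; under eq_fun do rewrite big_cons; exact: lim0D.
Qed.

Lemma lim0_prod I (r : seq I) (u : I -> R -> C) (l : I -> C) :
  (forall i, lim0 (u i) (l i)) -> lim0 (fun s => \prod_(i <- r) u i s) (\prod_(i <- r) l i).
Proof.
move=> h; elim: r => [|i r IH].
  by rewrite big_nil; under eq_fun do rewrite big_nil; exact: lim0_cst.
by rewrite big_cons; under eq_fun do rewrite big_cons; exact: lim0M.
Qed.

Lemma lim0_det n (u : R -> 'M[C]_n) (l : 'M[C]_n) :
  (forall i j, lim0 (fun s => u s i j) (l i j)) -> lim0 (fun s => \det (u s)) (\det l).
Proof.
move=> h; apply: lim0_sum => s; apply: lim0M; first exact: lim0_cst.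
by apply: lim0_prod => i; exact: h.
Qed.

Lemma lim0_cabs_sum I (r : seq I) (u : I -> R -> C) (l : I -> C) e : 0 < e ->
  (forall i, lim0 (u i) (l i)) -> exists2 d : R, 0 < d &
  forall s, 0 < s -> s < d -> \sum_(i <- r) cabs (u i s - l i) <= e.
Proof.
move=> e0 h; elim: r e e0 => [|i r IH] e e0.
  by exists 1 => // s _ _; rewrite big_nil ltW.
have e20 : 0 < e / 2 by lra.
have [d d0 hd] := IH _ e20; have [d' d'0 hd'] := h i _ e20.
exists (Num.min d d'); first by rewrite lt_min d0.
move=> s s0; rewrite lt_min => /andP[/(hd _ s0) h1 /(hd' _ s0) h2].
by rewrite big_cons; lra.
Qed.

End LimitAtZero.

Section JacobianMeanValue.
Variable R : realType.
Local Notation C := (R[i]).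
Variable k : nat.
Hypothesis k0 : (0 < k)%N.

(** A polysquare of this half side has sum norm at most 1 / 2, hence lies in the unit ball. *)
Definition box_size : R := 1 / (4 * k%:R).
(** Puts the grid within [box_size / 16] of 0: one factor 1 / 4 makes room for the increments of the
    difference quotients, the other for [ball_taylor]. *)
Definition grid_size : R := box_size / (64 * k%:R).

Let kp : 0 < k%:R :> R. Proof. by rewrite ltr0n. Qed.

Lemma box_size_gt0 : 0 < box_size.
Proof. by rewrite divr_gt0// mulr_gt0. Qed.

Lemma grid_size_gt0 : 0 < grid_size.
Proof. by rewrite divr_gt0 ?box_size_gt0// mulr_gt0. Qed.

Lemma grid_size_small : k%:R * (2 * grid_size) < box_size / 4 / 4.
Proof.
have -> : k%:R * (2 * grid_size) = box_size / 32 by rewrite /grid_size; field; rewrite gt_eqF.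
have := box_size_gt0; lra.
Qed.

Lemma polysquare_unit_ball (z : 'rV[C]_k) : polysquare box_size z -> unit_ball k z.
Proof.
move=> hz; apply: normv_unit_ball; apply: le_lt_trans (polysquare_normv hz) _.
have -> : k%:R * (2 * box_size) = 1 / 2 by rewrite /box_size; field; rewrite gt_eqF.
lra.
Qed.

Variables (Phi : 'rV[C]_k -> 'rV[C]_k) (f : 'rV[C]_k -> C) (D : 'rV[C]_k -> 'M[C]_k).
Hypothesis hD : forall z, unit_ball k z -> cderiv Phi z (D z).
Hypothesis hf : forall z, unit_ball k z -> hdiff (fun w => f (Phi w)) z.

(** The real Jacobian of [Phi] is |det D|^2, so the squared modulus is the density of [L2normsq]
    pulled back to the ball. *)
Definition pullback_density (z : 'rV[C]_k) : C := f (Phi z) * \det (D z).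

Let quot (s : R) (z : 'rV[C]_k) : 'M[C]_k :=
  \matrix_(i, j) ((Phi (z + s%:C%C *: delta_mx 0 i) 0 j - Phi z 0 j) * (s^-1)%:C%C).

Let hs (s : R) (z : 'rV[C]_k) : C := f (Phi z) * \det (quot s z).

Let quot_lim z : unit_ball k z -> lim0 (hs^~ z) (pullback_density z).
Proof.
move=> hz; apply: lim0M; first exact: lim0_cst.
apply: lim0_det => i j e e0.
have hg := cderiv_coord j (hD hz).
have [d d0 hd] := hg.2 _ e0; exists d => // s s0 sd.
have ns : normv (s%:C%C *: delta_mx 0 i : 'rV[C]_k) = s.
  by rewrite normvZ normv_delta mulr1 cabs_real ger0_norm// ltW.
have := hd (s%:C%C *: delta_mx 0 i); rewrite ns pairingZ pairing_delta => /(_ sd) h.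
rewrite mxE; set a := Phi _ 0 j - _ in h *.
have -> : a * (s^-1)%:C%C - D z i j = (a - s%:C%C * D z i j) * (s^-1)%:C%C.
  by rewrite [RHS]mulrBl [X in _ = _ - X]mulrAC -rmorphM /= mulfV ?gt_eqF// rmorph1 mul1r.
rewrite cabsM cabs_real ger0_norm ?invr_ge0 ?(ltW s0)//.
by rewrite -(@ler_pM2r _ s)// -mulrA mulVf ?gt_eqF// mulr1.
Qed.

(* That [\det (D z)] is holomorphic is not available, so the inequality is proved
   with difference quotients [quot s] in place of [D], uniformly in [s]. *)
Lemma jacobian_mean_value : exists E B : R, [/\ 0 <= E, 0 <= B,
  (forall z, normv z < box_size / 2 -> cabs (\det (D z)) <= B) &
  (forall N, (0 < N)%N -> cabs (pullback_density 0) <=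
     2 ^+ k * (((4 * N * N) ^ k)%N%:R^-1 *
        (\sum_(x : {ffun 'I_k -> grid_index N}) cabs (pullback_density (grid_vec grid_size x)))
        + E / N%:R))].
Proof.
have sg := box_size_gt0; set sig := box_size in sg *.
have ub z : normv z < sig -> unit_ball k z.
  by move=> hz; apply: polysquare_unit_ball; exact: ball_polysquare.
have /choice[M1 hM1] : forall j : 'I_k, exists M : R, 0 <= M /\
    forall z, polysquare sig z -> cabs (Phi z 0 j) <= M.
  move=> j.
  have [M M0 hM] := @polysquare_bounded R k (fun z => Phi z 0 j) sig sg
    (fun z hz => ex_intro _ _ (cderiv_coord j (hD (polysquare_unit_ball hz)))).
  by exists M.
have [M2 M20 hM2] := @polysquare_bounded R k (fun z => f (Phi z)) sig sg
    (fun z hz => hf (polysquare_unit_ball hz)).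
pose M := \sum_j M1 j.
have M0 : 0 <= M by apply: sumr_ge0 => j _; have [] := hM1 j.
have hM j z : normv z < sig -> cabs (Phi z 0 j) <= M.
  move=> /ball_polysquare hz; have [_ h] := hM1 j; rewrite (le_trans (h z hz))//.
  by rewrite /M (bigD1 j)//= lerDl sumr_ge0// => i _; have [] := hM1 i.
pose L := 32 * M / sig.
have L0 : 0 <= L by rewrite divr_ge0 ?(ltW sg)// mulr_ge0.
pose B := (k`!)%:R * L ^+ k.
have B0 : 0 <= B by rewrite mulr_ge0// exprn_ge0.
have gD j z : normv (z - 0) < sig -> hgrad (fun w => Phi w 0 j) z (fun i => D z i j).
  by rewrite subr0 => hz; exact: cderiv_coord (hD (ub _ hz)).
have gM j z : normv (z - 0) < sig -> cabs (Phi z 0 j) <= M by rewrite subr0; exact: hM.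
pose M' := M2 * B.
have M'0 : 0 <= M' by rewrite mulr_ge0.
pose r := sig / 4; have r0 : 0 < r by rewrite divr_gt0.
have [K KE K0] : exists2 K : R, K = 2048 * M' / r ^+ 2 & 0 <= K.
  exists (2048 * M' / r ^+ 2); first by [].
  by apply: divr_ge0; [apply: mulr_ge0; [exact: ler0n|exact: M'0]|exact: exprn_ge0 (ltW r0)].
(* The entries are bounded by the Lipschitz constant of [Phi], independently of s; this makes K and
   E uniform. *)
have quot_bd s z : 0 < s -> s < r -> normv z < r -> cabs (\det (quot s z)) <= B.
  move=> s0 sr zr; apply: det_le => // i j; rewrite mxE.
  have ns : normv (s%:C%C *: delta_mx 0 i : 'rV[C]_k) = s.
    by rewrite normvZ normv_delta mulr1 cabs_real ger0_norm// ltW.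
  have z1 : normv (z - 0) < sig / 2 by rewrite subr0 (lt_trans zr)// /r; lra.
  have z2 : normv (z + s%:C%C *: delta_mx 0 i - 0) < sig / 2.
    rewrite subr0 (le_lt_trans (normvD _ _))// ns.
    have -> : sig / 2 = r + r by rewrite /r; field.
    exact: ltrD.
  have := ball_lip sg (gD j) (gM j) z1 z2; rewrite ns => h.
  rewrite cabsM cabs_real ger0_norm ?invr_ge0 ?(ltW s0)//.
  by rewrite ler_pdivrMr// mulrC.
have hs_bd s z : 0 < s -> s < r -> normv z < r -> cabs (hs s z) <= M'.
  move=> s0 sr zr; rewrite cabsM ler_pM ?cabs_ge0//; last exact: quot_bd.
  by apply: hM2; apply: ball_polysquare; rewrite (lt_trans zr)// /r; lra.
have hs_hol s z : 0 < s -> s < r -> normv z < r -> hdiff (hs s) z.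
  move=> s0 sr zr; have zs : normv z < sig by rewrite (lt_trans zr)// /r; lra.
  apply: hdiffM; first exact: hf (ub _ zs).
  apply: hdiff_det => i j.
  under eq_fun do rewrite mxE.
  apply: hdiffM; last exact: hdiff_cst.
  apply: hdiffB; last by exists (fun i => D z i j); apply: gD; rewrite subr0.
  apply: (hdiff_shift (h := fun w => Phi w 0 j)).
  have ns : normv (s%:C%C *: delta_mx 0 i : 'rV[C]_k) = s.
    by rewrite normvZ normv_delta mulr1 cabs_real ger0_norm// ltW.
  eexists; apply: cderiv_coord; apply: hD; apply: ub.
  rewrite (le_lt_trans (normvD _ _))// ns (lt_trans (ltrD zr sr))// /r; lra.
pose E := 4 * K * grid_size ^+ 2.
have E0 : 0 <= E.
  apply: mulr_ge0; last exact: exprn_ge0 (ltW grid_size_gt0).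
  by apply: mulr_ge0.
exists E, B; split => //.
  move=> z hz; apply: det_le => // i j.
  by apply: (ball_grad_bound sg (gD j) (gM j)); rewrite subr0.
move=> N N0.
have gs := grid_size_gt0.
have mv s : 0 < s -> s < r -> cabs (hs s 0) <=
     2 ^+ k * (((4 * N * N) ^ k)%N%:R^-1 *
        (\sum_(x : {ffun 'I_k -> grid_index N}) cabs (hs s (grid_vec grid_size x))) + E / N%:R).
  move=> s0 sr.
  have /choice[G hG] : forall z : 'rV[C]_k, exists g,
      normv (z - 0) < r -> hgrad (hs s) z g.
    move=> z.
    have [zr|zr] := ltP (normv (z - 0)) r; last by exists (fun=> 0).
    by have := hs_hol s z s0 sr; rewrite -{1}(subr0 z) => /(_ zr)[g hg]; exists g.
  have hM3 z : normv (z - 0) < r -> cabs (hs s z) <= M' by rewrite subr0; exact: hs_bd.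
  have := @grid_mean_value_several R k N N0 (hs s) G (r / 4) grid_size K (ltW gs) K0.
  apply.
  - exact: grid_size_small.
  - move=> z hz; apply: hG; rewrite subr0 (lt_trans hz)//.
    by rewrite ltr_pdivrMr// ltr_pMr// ltr1n.
  - move=> z v hz hzv; have := ball_taylor r0 hG hM3 (z := z) (v := v).
    by rewrite !subr0 -KE; exact.
apply/ler_addgt0Pr => e e0.
set n := ((4 * N * N) ^ k)%N%:R in mv *.
have n1 : 1 <= n :> R by rewrite ler1n expn_gt0 !muln_gt0 N0.
have n0 : 0 < n by lra.
have p1 : 1 <= 2 ^+ k :> R by rewrite exprn_ege1// ler1n.
(* The error is e' at the origin and 2^k e' from the average, each at most e / 2. *)
pose e' := e / (2 * 2 ^+ k); have e'0 : 0 < e' by rewrite divr_gt0// mulr_gt0//; lra.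
have gub (x : {ffun 'I_k -> grid_index N}) : unit_ball k (grid_vec grid_size x).
  apply: ub; rewrite (le_lt_trans (grid_vec_bound _ (ltW gs)))//.
  by rewrite (lt_trans grid_size_small)// -/sig; lra.
have z0b : unit_ball k (0 : 'rV[C]_k) by apply: ub; rewrite normv0.
(* N is fixed at this point, so the grid is finite and a single s serves all its points. *)
have [d d0 hd] := lim0_cabs_sum (index_enum {ffun 'I_k -> grid_index N}) e'0
   (fun x => quot_lim (gub x)).
have [d' d'0 hd'] := quot_lim z0b e'0.
pose s := Num.min r (Num.min d d') / 2.
have mm : 0 < Num.min r (Num.min d d') by rewrite !lt_min r0 d0.
have s0 : 0 < s by rewrite divr_gt0.
have smin : s < Num.min r (Num.min d d') by rewrite /s; lra.
move: smin; rewrite !lt_min => /and3P[sr sd sd'].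
have h1 := mv _ s0 sr; have h2 := hd _ s0 sd; have h3 := hd' _ s0 sd'.
have h4 := cabs_sub_le (pullback_density 0) (hs s 0); rewrite cabsBC in h4.
pose Sh := \sum_(x : {ffun 'I_k -> grid_index N}) cabs (hs s (grid_vec grid_size x)).
pose S := \sum_(x : {ffun 'I_k -> grid_index N}) cabs (pullback_density (grid_vec grid_size x)).
have h5 : Sh <= S + e'.
  rewrite -lerBlDl (le_trans _ h2)// /Sh /S -sumrB; apply: ler_sum => x _.
  exact: cabs_sub_le.
rewrite -/Sh in h1; rewrite -/S.
have h6 : n^-1 * Sh <= n^-1 * S + e'.
  rewrite (le_trans (ler_wpM2l _ h5))// ?invr_ge0 ?(ltW n0)// mulrDr lerD2l ler_piMl ?(ltW e'0)//.
  by rewrite invf_le1.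
have h7 : 2 ^+ k * (n^-1 * Sh + E / N%:R) <= 2 ^+ k * (n^-1 * S + E / N%:R) + 2 ^+ k * e'.
  rewrite -mulrDr; apply: ler_wpM2l; first by rewrite (le_trans _ p1).
  by clear -h6; lra.
have h8 : e' <= 2 ^+ k * e' by rewrite ler_peMl// ltW.
have h9 : 2 ^+ k * e' = e / 2 by rewrite /e'; field; rewrite expf_neq0.
by clear -h1 h3 h4 h7 h8 h9; lra.
Qed.

End JacobianMeanValue.

(** * Affine cells of uniform size *)

Section UniformRadius.
Variable R : realType.
Local Notation C := (R[i]).
Variable k : nat.
Hypothesis k0 : (0 < k)%N.
Variables (U : set 'rV[C]_k) (Phi Psi : 'rV[C]_k -> 'rV[C]_k) (f : 'rV[C]_k -> C).
Variable D : 'rV[C]_k -> 'M[C]_k.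
Hypothesis Uopen : Defs.openC U.
Hypothesis hD : forall z, unit_ball k z -> cderiv Phi z (D z).
Hypothesis hPsi : holo_on U Psi.
Hypothesis PhiU : forall z, unit_ball k z -> U (Phi z) /\ Psi (Phi z) = z.
Hypothesis PsiU : forall w, U w -> unit_ball k (Psi w).
Hypothesis hf : forall w, U w -> hdiff f w.

Let kp : 0 < k%:R :> R. Proof. by rewrite ltr0n. Qed.

Lemma derivative_inverse z L : normv z < 1 -> cderiv Psi (Phi z) L -> D z *m L = 1%:M.
Proof.
move=> hz hL; have h := cderiv_comp (hD (normv_unit_ball hz)) hL.
apply: (cderiv_unique h).
have d0 : 0 < 1 - normv z by rewrite subr_gt0.
apply: (cderiv_eq_near d0 _ (cderiv_id z)) => w wd /=.
have zw : normv (z + w) < 1 by have := normvD z w; lra.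
by have [_ ->] := PhiU (normv_unit_ball zw).
Qed.

Lemma unit_ball_coord (z : 'rV[C]_k) j : unit_ball k z -> cabs (z 0 j) <= 1.
Proof.
rewrite /unit_ball /= (bigD1 j)//= => h.
have h2 : 0 <= \sum_(i < k | i != j) cabs (z 0 i) ^+ 2 by apply: sumr_ge0 => i _; exact: sqr_ge0.
by rewrite -(@ler_pXn2r _ 2) ?nnegrE ?cabs_ge0// expr1n; lra.
Qed.

(** Cells are affine images of small balls, whose volume is computable. The bound on [Psi] will make
    cells at different grid points disjoint, and the bound on [f] allows it to be replaced by its
    value at the centre. *)
Definition good_radius (e r0 : R) (z : 'rV[C]_k) := forall u, normv u < r0 ->
  [/\ U (Phi z + u *m D z), normv (Psi (Phi z + u *m D z) - z) <= 2 * normv u &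
      cabs (f (Phi z + u *m D z) - f (Phi z)) <= e].

(** Since [D z] inverts the derivative of [Psi] at [Phi z], Psi (Phi z + u D z) = z + u + O(|u|^2).
    The constants are uniform for z near x, as they come from Cauchy estimates for [Psi], bounded by
    1 near [Phi x], and for [Phi] near x. *)
Lemma good_radius_local (e : R) (x : 'rV[C]_k) : 0 < e -> normv x < 1 ->
  exists2 d, 0 < d & exists2 r0 : R, 0 < r0 &
    forall z, normv (z - x) < d -> good_radius e r0 z.
Proof.
move=> e0 x1; have k_gt0 := kp.
have [Ux Psix] := PhiU (normv_unit_ball x1).
have [R0 R00 hR0] := Uopen Ux.
have /choice[DPsi hDPsi] : forall w, exists L, U w -> cderiv Psi w L.
  move=> w; have [Uw|nU] := pselect (U w); last by exists 0.
  by have [L hL] := hPsi Uw; exists L.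
have gPsi j w : normv (w - Phi x) < R0 -> hgrad (fun y => Psi y 0 j) w (fun i => DPsi w i j).
  by move=> /hR0 /hDPsi hw; exact: cderiv_coord.
have mPsi j w : normv (w - Phi x) < R0 -> cabs (Psi w 0 j) <= 1.
  by move=> /hR0 /PsiU; exact: unit_ball_coord.
have [gf hgf] := hf Ux; have e20 : 0 < e / 2 by lra.
have [df df0 hdf] := dif_continuous (normv_is_norm R k) (cabs_is_norm R) hgf e20.
(* Phi z and Phi z + v are within 2 rho of Phi x: inside the ball R0 / 4 of [ball_taylor], and where
   f varies by less than e / 2. *)
pose rho := Num.min (R0 / 8) (df / 2).
have rho0 : 0 < rho by rewrite lt_min !divr_gt0.
have rho1 : rho <= R0 / 8 by rewrite ge_min lexx.
have rho2 : rho <= df / 2 by rewrite ge_min lexx orbT.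
have rhoR : rho + rho <= R0 / 4 by lra.
have rhodf : rho + rho <= df by lra.
have rho_dbl : rho < rho + rho by lra.
have R04 : R0 / 4 < R0 by lra.
have hPx : dif (@normv R k) (@normv R k) Phi x (fun w => w *m D x).
  by apply/cderiv_dif; exact: hD (normv_unit_ball x1).
have [d1 d10 hd1] := dif_continuous (normv_is_norm R k) (normv_is_norm R k) hPx rho0.
pose d2 := Num.min d1 (1 - normv x).
have d20 : 0 < d2 by rewrite lt_min d10 subr_gt0.
have near1 z : normv (z - x) < d2 -> normv z < 1 /\ normv (Phi z - Phi x) < rho.
  rewrite lt_min => /andP[h1 h2]; split.
    by have := normvD (z - x) x; rewrite subrK; lra.
  by have := hd1 (z - x); rewrite (addrC x) subrK; apply.
pose M := normv (Phi x) + rho.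
have M0 : 0 <= M by rewrite addr_ge0 ?normv_ge0 ?(ltW rho0).
have gPhi j z : normv (z - x) < d2 -> hgrad (fun y => Phi y 0 j) z (fun i => D z i j).
  by move=> /near1[h _]; apply: cderiv_coord; apply: hD; exact: normv_unit_ball.
have mPhi j z : normv (z - x) < d2 -> cabs (Phi z 0 j) <= M.
  move=> /near1[_ h]; rewrite (le_trans (normv_coord _ _))//.
  by have := normvD (Phi z - Phi x) (Phi x); rewrite subrK /M; lra.
have [Q Q0 hQ] : exists2 Q : R, 0 <= Q & forall z, normv (z - x) < d2 / 2 ->
    forall u, normv (u *m D z) <= normv u * Q.
  pose L := 32 * M / d2.
  have L0 : 0 <= L by rewrite divr_ge0 ?(ltW d20)// mulr_ge0.
  exists (\sum_(i < k) \sum_(j < k) L).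
    by do 2![apply: sumr_ge0 => ? _].
  move=> z hz u; rewrite (le_trans (normv_mul _ _))// ler_wpM2l ?normv_ge0//.
  apply: ler_sum => i _; apply: ler_sum => j _.
  exact: (ball_grad_bound d20 (gPhi j) (mPhi j)).
have [K KE K0] : exists2 K : R, K = 2048 * 1 / R0 ^+ 2 & 0 <= K.
  exists (2048 * 1 / R0 ^+ 2); first by [].
  by apply: divr_ge0; [apply: mulr_ge0; [exact: ler0n|exact: ler01]|exact: exprn_ge0 (ltW R00)].
pose W := k%:R * K * Q ^+ 2.
have W0 : 0 <= W by rewrite mulr_ge0 ?exprn_ge0// mulr_ge0// ltW.
have Q1 : 0 < Q + 1 by lra.
have W1 : 0 < W + 1 by lra.
(* The first bound keeps |u D z| below rho; the second makes the quadratic remainder W |u|^2 at most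
   |u|, whence the factor 2 in [good_radius]. *)
pose r0 := Num.min (rho / (Q + 1)) (1 / (W + 1)).
have r00 : 0 < r0 by rewrite lt_min !divr_gt0.
exists (d2 / 2); first by rewrite divr_gt0.
exists r0 => // z hz u; rewrite lt_min !ltr_pdivlMr// => /andP[hu1 hu2].
have u0 := normv_ge0 u.
have hz2 : normv (z - x) < d2 by rewrite (lt_trans hz)// ltr_pdivrMr// ltr_pMr// ltr1n.
have [z1 Pz] := near1 _ hz2.
set v := u *m D z; have hv : normv v <= normv u * Q := hQ _ hz u.
have vrho : normv v < rho by rewrite (le_lt_trans hv)// (le_lt_trans _ hu1)// ler_wpM2l// lerDl.
have Pzv : normv (Phi z + v - Phi x) < rho + rho.
  have -> : Phi z + v - Phi x = (Phi z - Phi x) + v by rewrite addrAC.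
  by rewrite (le_lt_trans (normvD _ _))// ltrD.
have Pzv4 := lt_le_trans Pzv rhoR; have Pz4 := lt_le_trans (lt_trans Pz rho_dbl) rhoR.
split.
- by apply: hR0; exact: lt_trans Pzv4 R04.
- have inv : D z *m DPsi (Phi z) = 1%:M.
    by apply: derivative_inverse => //; apply: hDPsi; apply: hR0; exact: lt_trans Pz4 R04.
  have [_ PPz] := PhiU (normv_unit_ball z1).
  have rem : normv (Psi (Phi z + v) - z - u) <= k%:R * (K * normv v ^+ 2).
    rewrite (@le_trans _ _ (\sum_(j < k) (K * normv v ^+ 2)))//; last first.
      by rewrite sumr_const card_ord -[leLHS]mulr_natl.
    apply: ler_sum => j _; rewrite KE.
    have := ball_taylor R00 (gPsi j) (mPsi j) Pz4 Pzv4; apply: le_trans.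
    rewrite le_eqVlt; apply/orP; left; apply/eqP; rewrite !mxE PPz; congr (cabs (_ - _)).
    have : (v *m DPsi (Phi z)) 0 j = u 0 j by rewrite /v -mulmxA inv mulmx1.
    by rewrite mxE => <-.
  have hvv : normv v ^+ 2 <= (normv u * Q) ^+ 2.
    by rewrite ler_pXn2r ?nnegrE ?normv_ge0 ?mulr_ge0.
  have rem2 : k%:R * (K * normv v ^+ 2) <= normv u.
    rewrite (le_trans (y := k%:R * (K * (normv u * Q) ^+ 2)))//.
      by rewrite ler_wpM2l ?(ltW k_gt0)// ler_wpM2l.
    have -> : k%:R * (K * (normv u * Q) ^+ 2) = normv u * (normv u * W) by rewrite /W; ring.
    by rewrite ler_piMr// (le_trans _ (ltW hu2))// ler_wpM2l// lerDl.
  have := normvD (Psi (Phi z + v) - z - u) u; rewrite subrK => h.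
  by rewrite (le_trans h)// mulr_natl mulr2n lerD2r (le_trans rem rem2).
- have h1 := lt_le_trans (lt_trans Pz rho_dbl) rhodf.
  have h2 := lt_le_trans Pzv rhodf.
  have := hdf _ h1; have := hdf _ h2; rewrite !(addrC (Phi x)) !subrK => h3 h4.
  have := cabsB (f (Phi z + v) - f (Phi x)) (f (Phi z) - f (Phi x)).
  have -> : f (Phi z + v) - f (Phi x) - (f (Phi z) - f (Phi x)) = f (Phi z + v) - f (Phi z) by ring.
  by move=> h; rewrite (le_trans h)// [leRHS](splitr e) lerD// ltW.
Qed.

Lemma good_radius_uniform (e : R) : 0 < e -> exists2 r0 : R, 0 < r0 &
  forall z, polysquare (box_size R k) z -> good_radius e r0 z.
Proof.
move=> e0; have bs := box_size_gt0 R k0.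
apply: (@polysquare_compact R k (fun A => exists2 r0 : R, 0 < r0 & forall z, A z -> good_radius e r0 z)) => //.
- by move=> A B AB [r0 r00 h]; exists r0 => // z /AB /h.
- move=> A B [r1 r10 h1] [r2 r20 h2]; exists (Num.min r1 r2); first by rewrite lt_min r10.
  by move=> z [/h1 h|/h2 h] u; rewrite lt_min => /andP[u1 u2]; apply: h.
- move=> x hx; apply: good_radius_local => //.
  apply: le_lt_trans (polysquare_normv hx) _.
  have -> : k%:R * (2 * box_size R k) = 1 / 2.
    by rewrite /box_size; field; rewrite gt_eqF// kp.
  lra.
Qed.

End UniformRadius.

(** * Summation over disjoint cells *)

Section BergmanInequality.
Variable R : realType.
Local Notation C := (R[i]).
Variable k : nat.
Hypothesis k0 : (0 < k)%N.
Variables (U : set 'rV[C]_k) (Phi Psi : 'rV[C]_k -> 'rV[C]_k) (f : 'rV[C]_k -> C).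
Variable D : 'rV[C]_k -> 'M[C]_k.
Hypothesis Uopen : Defs.openC U.
Hypothesis hD : forall z, unit_ball k z -> cderiv Phi z (D z).
Hypothesis hPsi : holo_on U Psi.
Hypothesis PhiU : forall z, unit_ball k z -> U (Phi z) /\ Psi (Phi z) = z.
Hypothesis PsiU : forall w, U w -> unit_ball k (Psi w).
Hypothesis hf : forall w, U w -> hdiff f w.

Let kp : 0 < k%:R :> R. Proof. by rewrite ltr0n. Qed.

(** The (4 N^2)^k cells of size [grid_size] / (8 N) contribute this 2k-th power times 4^k; the 4^k
    cancels against the square of the mean value constant 2^k, and 1 / 4 pays for the approximation
    errors. *)
Definition bergman_const : R := (grid_size R k / (16 * k%:R ^+ 2)) ^+ (2 * k) / 4.

Lemma bergman_const_gt0 : 0 < bergman_const.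
Proof.
by rewrite divr_gt0// exprn_gt0// divr_gt0 ?grid_size_gt0// mulr_gt0// exprn_gt0 ?kp.
Qed.

(* The cells, images under [Phi + u *m D] of [|u| < eta], are pairwise disjoint
   because [Psi] sends them into disjoint balls around the grid points. *)
Lemma bergman_inequality (Om : set 'rV[C]_k) : U `<=` Om ->
  ((bergman_const * cabs (pullback_density Phi f D 0) ^+ 2)%:E <= L2normsq Om f)%E.
Proof.
move=> UOm; set tau := cabs _; have k_gt0 := kp.
pose dens (y : nat -> R) : \bar R := ((toC k y \in Om)%:R * cabs (f (toC k y)) ^+ 2)%:E.
have dens0 y : (0 <= dens y)%E by rewrite lee_fin mulr_ge0// sqr_ge0.
have [tau0|taun] := eqVneq tau 0.
  by rewrite tau0 expr0n/= mulr0; exact: iint_ge0.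
have taup : 0 < tau by rewrite lt_neqAle eq_sym taun cabs_ge0.
have hfPhi z : unit_ball k z -> hdiff (fun w => f (Phi w)) z.
  by move=> hz; apply: hdiff_comp (hD hz) _; apply: hf; have [] := PhiU hz.
have [E [B [E0 B0 hB hmv]]] := jacobian_mean_value k0 hD hfPhi.
pose p := 2 ^+ k : R; have p0 : 0 < p by rewrite exprn_gt0.
(* Replacing f by m then costs at most e B <= tau / (4 p) on average. *)
pose e := tau / (4 * p * (B + 1)).
have B1 : 0 < B + 1 by lra.
have e0 : 0 < e by rewrite divr_gt0// !mulr_gt0.
have [r0 r00 hr0] := good_radius_uniform k0 Uopen hD hPsi PhiU PsiU hf e0.
have gs := grid_size_gt0 R k0.
(* N > q ensures both E / N <= tau / (4 p) and eta <= r0. *)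
pose q := 4 * p * E / tau + grid_size R k / (8 * r0).
have q0 : 0 <= q by rewrite addr_ge0 ?divr_ge0 ?mulr_ge0// ltW.
pose N := Num.bound q; have qN : q < N%:R := archi_boundP q0.
have Np : 0 < N%:R :> R by rewrite (le_lt_trans q0).
have N0 : (0 < N)%N by rewrite -(ltr0n R).
have qN1 : E / N%:R <= tau / (4 * p).
  have h : 4 * p * E / tau <= N%:R.
    by rewrite (le_trans _ (ltW qN))// lerDl divr_ge0 ?mulr_ge0// ltW.
  rewrite ler_pdivrMr// mulrAC ler_pdivlMr ?mulr_gt0//.
  by move: h; rewrite ler_pdivrMr//; lra.
(* Grid points are 4 eta apart, and [Psi] maps a cell to within less than 2 eta of its grid
   point. *)
pose eta := grid_size R k / (8 * N%:R).
have eta0 : 0 < eta by rewrite divr_gt0// mulr_gt0.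
have etar : eta <= r0.
  have h : grid_size R k / (8 * r0) <= N%:R.
    by rewrite (le_trans _ (ltW qN))// lerDr divr_ge0 ?mulr_ge0// ltW.
  rewrite ler_pdivrMr ?mulr_gt0//; move: h; rewrite ler_pdivrMr ?mulr_gt0//; lra.
pose X := {ffun 'I_k -> grid_index N}.
pose Z (x : X) : 'rV[C]_k := grid_vec (grid_size R k) x.
have Zb (x : X) : normv (Z x) < box_size R k / 4 / 4.
  exact: le_lt_trans (grid_vec_bound _ (ltW gs)) (grid_size_small R k0).
have bs := box_size_gt0 R k0.
have Zsq (x : X) : polysquare (box_size R k) (Z x).
  by apply: ball_polysquare; have := Zb x; lra.
have Zdet (x : X) : cabs (\det (D (Z x))) <= B by apply: hB; have := Zb x; lra.
pose cell (x : X) : set 'rV[C]_k := [set w | exists2 u, normv u < eta & w = Phi (Z x) + u *m D (Z x)].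
have cellU x w : cell x w -> U w.
  by move=> [u hu ->]; have [] := hr0 _ (Zsq x) u (lt_le_trans hu etar).
have cell_disj x y w : cell x w -> cell y w -> x = y.
  move=> [u hu wu] [u' hu' wu']; apply/eqP/negPn/negP => xy.
  have [_ h1 _] := hr0 _ (Zsq x) u (lt_le_trans hu etar).
  have [_ h2 _] := hr0 _ (Zsq y) u' (lt_le_trans hu' etar).
  rewrite -wu in h1; rewrite -wu' in h2.
  have h3 := grid_vec_separated (ltW gs) xy.
  have h4 : normv (Z x - Z y) <= normv (Psi w - Z y) + normv (Psi w - Z x).
    have -> : Z x - Z y = (Psi w - Z y) - (Psi w - Z x) by rewrite opprB [RHS]addrC addrA subrK.
    by rewrite (le_trans (normvD _ _))// normvN.
  have h5 : grid_size R k / (2 * N%:R) = 4 * eta by rewrite /eta; field; rewrite gt_eqF.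
  rewrite -/(Z x) -/(Z y) in h3; lra.
pose m (x : X) : R := Num.max (cabs (f (Phi (Z x))) - e) 0.
have m0 x : 0 <= m x by rewrite le_max lexx orbT.
have mf x w : cell x w -> m x <= cabs (f w).
  move=> [u hu ->]; have [_ _ h] := hr0 _ (Zsq x) u (lt_le_trans hu etar).
  rewrite ge_max cabs_ge0 andbT.
  by have := cabs_sub_le (f (Phi (Z x))) (f (Phi (Z x) + u *m D (Z x))); rewrite cabsBC; lra.
pose g (x : X) (y : nat -> R) : \bar R := ((toC k y \in cell x)%:R * m x ^+ 2)%:E.
have g0 x y : (0 <= g x y)%E by rewrite lee_fin mulr_ge0// sqr_ge0.
have step1 : (\sum_x iint (2 * k) (g x) <= L2normsq Om f)%E.
  apply: (le_trans (iint_sum _ _ g0)); apply: iint_mono.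
    by move=> y; apply: sume_ge0.
  move=> y; rewrite -/(dens y).
  have [[x hx]|nx] := pselect (exists x, cell x (toC k y)).
    rewrite (bigD1 x)//= big1 ?adde0; last first.
      move=> x' xx'; rewrite /g; case: (boolP (_ \in _)) => [|_]; last by rewrite mul0r.
      by rewrite inE => hx'; rewrite (cell_disj _ _ _ hx' hx) eqxx in xx'.
    rewrite /g /dens !mem_set//; last exact: UOm (cellU _ _ hx).
    by rewrite !mul1r lee_fin ler_pXn2r ?nnegrE ?cabs_ge0// (mf _ _ hx).
  rewrite big1// => x _; rewrite /g; case: (boolP (_ \in _)) => [|_]; last by rewrite mul0r.
  by rewrite inE => hx; exfalso; apply: nx; exists x.
pose kap := (eta / (2 * k%:R ^+ 2)) ^+ (2 * k).
have step2 : ((\sum_x (m x ^+ 2 * (kap * cabs (\det (D (Z x))) ^+ 2)))%:E <= \sum_x iint (2 * k) (g x))%E.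
  rewrite -sumEFin; apply: lee_sum => x _.
  apply: (@iint_parallelepiped R k (D (Z x)) (Phi (Z x)) eta) => //; first exact: sqr_ge0.
  move=> y u hu yE; rewrite /g mem_set ?mul1r//.
  by exists u.
apply: le_trans step1; apply: le_trans step2; rewrite lee_fin.
pose y (x : X) := m x * cabs (\det (D (Z x))).
have -> : \sum_x (m x ^+ 2 * (kap * cabs (\det (D (Z x))) ^+ 2)) = kap * \sum_x y x ^+ 2.
  by rewrite mulr_sumr; apply: eq_bigr => x _; rewrite /y; ring.
pose n : R := ((4 * N * N) ^ k)%N%:R.
have n0 : 0 < n by rewrite ltr0n expn_gt0 !muln_gt0 N0.
(* What remains of tau / p after two errors of tau / (4 p). *)
pose beta := tau / (2 * p).
have eB : e * B <= tau / (4 * p).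
  have -> : tau / (4 * p) = e * (B + 1) by rewrite /e; field; rewrite !gt_eqF.
  by rewrite ler_wpM2l ?(ltW e0)//; lra.
have sumy : n * beta <= \sum_x y x.
  have := hmv N N0; rewrite -/tau -/p -/n; set S := \sum_(x : {ffun 'I_k -> grid_index N}) _ => h.
  have h1 : tau / p <= n^-1 * S + E / N%:R by rewrite ler_pdivrMr// mulrC.
  have h2 : S - n * (e * B) <= \sum_x y x.
    have -> : n * (e * B) = \sum_(x : X) (e * B).
      by rewrite sumr_const card_grid_vec -[RHS]mulr_natl.
    rewrite /S -sumrB; apply: ler_sum => x _; rewrite cabsM /y.
    have h3 : cabs (f (Phi (Z x))) - e <= m x by rewrite le_max lexx.
    have := Zdet x; have := cabs_ge0 (\det (D (Z x))).
    rewrite -/(Z x); move: (cabs (\det _)) => dt dt0 dtB.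
    have h4 := ler_wpM2r dt0 h3; have h5 := ler_wpM2l (ltW e0) dtB.
    by rewrite mulrBl in h4; lra.
  have h6 : tau / p = tau / (4 * p) + tau / (4 * p) + beta by rewrite /beta; field; rewrite gt_eqF.
  have h7 : beta <= n^-1 * S - e * B by lra.
  rewrite (le_trans _ h2)//.
  have -> : S - n * (e * B) = n * (n^-1 * S - e * B) by rewrite mulrBr mulVKf ?gt_eqF.
  by rewrite ler_pM2l.
have beta0 : 0 <= beta by rewrite divr_ge0 ?mulr_ge0// ltW.
have sumy2 : n * beta ^+ 2 <= \sum_x y x ^+ 2.
  (* Cauchy-Schwarz in the form (y - beta)^2 >= 0, summed over the grid. *)
  have h1 : \sum_x (2 * beta * y x - beta ^+ 2) <= \sum_x y x ^+ 2.
    apply: ler_sum => x _; rewrite -subr_ge0.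
    have -> : y x ^+ 2 - (2 * beta * y x - beta ^+ 2) = (y x - beta) ^+ 2 by ring.
    exact: sqr_ge0.
  rewrite (le_trans _ h1)// sumrB -mulr_sumr sumr_const card_grid_vec.
  have h2 := ler_wpM2l beta0 sumy.
  have -> : beta ^+ 2 *+ ((4 * N * N) ^ k) = n * beta ^+ 2 by rewrite mulr_natl.
  by rewrite expr2; lra.
have kap0 : 0 <= kap by rewrite exprn_ge0// divr_ge0 ?(ltW eta0)// mulr_ge0// exprn_ge0// ltW.
rewrite (le_trans _ (ler_wpM2l kap0 sumy2))//.
have kn : kap * n = (grid_size R k / (16 * k%:R ^+ 2)) ^+ (2 * k) * p ^+ 2.
  rewrite /kap /n /p natrX -exprM (mulnC k) !exprM -!exprMn; congr (_ ^+ _).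
  by rewrite /eta !natrM; field; rewrite !gt_eqF.
rewrite [leRHS]mulrA kn /bergman_const /beta le_eqVlt; apply/orP; left; apply/eqP.
by field; rewrite gt_eqF.
Qed.

End BergmanInequality.

(** * Vanishing of the Kobayashi metric *)

Section KobayashiVanishing.
Variable R : realType.
Local Notation C := (R[i]).
Variables (k : nat) (Om : nat -> set 'rV[C]_k).
Hypothesis k0 : (0 < k)%N.
Hypothesis Om_open : forall i, Defs.openC (Om i).
Hypothesis Om_incr : forall i, Om i `<=` Om i.+1.

Let Om_mono i j : (i <= j)%N -> Om i `<=` Om j.
Proof.
move=> /subnKC <-; elim: (j - i)%N => [|d IH]; first by rewrite addn0.
by rewrite addnS; apply: subset_trans IH _; exact: Om_incr.
Qed.

(** The shrunk disc is a compact square around 0; its image is covered by the open stages, which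
    increase, so one of them contains it. *)
Lemma disc_in_stage (phi : 'rV[C]_1 -> 'rV[C]_k) :
  holo_on unit_disc phi -> phi @` unit_disc `<=` \bigcup_i Om i ->
  exists i, forall z, polysquare (1 / 4) z -> Om i (phi z).
Proof.
move=> hphi phiO.
have sub z : polysquare (1 / 4) z -> unit_ball 1 z.
  move=> hz; apply: normv_unit_ball; have := polysquare_normv hz; lra.
apply: (@polysquare_compact R 1 (fun A => exists i, forall z, A z -> Om i (phi z))).
- by rewrite divr_gt0.
- by move=> A B AB [i hi]; exists i => z /AB /hi.
- move=> A B [i hi] [j hj]; exists (maxn i j) => z [/hi|/hj]; apply: Om_mono.
    exact: leq_maxl.
  exact: leq_maxr.
- move=> z /sub zd.
  have [i _ Oi] : (\bigcup_i Om i) (phi z) by apply: phiO; exists z.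
  have [r r0 hr] := Om_open Oi.
  have [L /cderiv_dif hL] := hphi z zd.
  have [d d0 hd] := dif_continuous (normv_is_norm R 1) (normv_is_norm R k) hL r0.
  exists d => //; exists i => w /= wz; apply: hr.
  by have := hd _ wz; rewrite (addrC z) subrK.
Qed.

(** Each basis vector has its own disc and thus its own stage. The bound for a direction holds at
    all later stages too, so the largest of the k stages serves every row of L, whatever [Psi]
    is. *)
Lemma kobayashi_derivative p : (forall v, kobayashi (\bigcup_i Om i) p v = 0%E) ->
  forall e : R, 0 < e -> exists i, Om i p /\
    forall Psi L, holo_on (Om i) Psi -> (forall w, Om i w -> unit_ball k (Psi w)) ->
      cderiv Psi p L -> forall a b, cabs (L a b) <= e.
Proof.
move=> hkob e e0.
have key (a : 'I_k) : exists i, Om i p /\ forall j, (i <= j)%N ->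
    forall Psi L, holo_on (Om j) Psi -> (forall w, Om j w -> unit_ball k (Psi w)) ->
      cderiv Psi p L -> forall b, cabs (L a b) <= e.
  (* 64 = 16 * 1 / (1 / 4) is the Cauchy bound for the derivative at 0 of a coordinate of
     [Psi \o phi], bounded by 1 on the disc of radius 1 / 4. *)
  have e640 : 0 < e / 64 by rewrite divr_gt0.
  have : (kobayashi (\bigcup_i Om i) p (delta_mx 0 a)%R < (e / 64)%:E)%E by rewrite hkob lte_fin.
  move=> /ereal_inf_lt[_ [al [al0 [phi [hphi phiO phi0 [L1 [hL1 L1E]]]]] <-]].
  rewrite lte_fin => ale.
  have [i hi] := disc_in_stage hphi phiO.
  have q0 : polysquare (1 / 4) (0 : 'rV[C]_1) by apply: ball_polysquare; rewrite normv0 divr_gt0.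
  exists i; split; first by rewrite -phi0; exact: hi.
  move=> j ij Psi L hPsi PsiB hL b.
  have L1b : cabs ((L1 *m L) 0 b) <= 16 * 1 / (1 / 4).
    apply: (grad_bound (h := fun z => Psi (phi z) 0 b) (z := 0) (g := fun i => (L1 *m L) i b)).
    - by rewrite divr_gt0.
    - move=> w; rewrite subr0 => hw.
      have wq : polysquare (1 / 4) w := ball_polysquare hw.
      have Oj : Om j (phi w) by apply: (Om_mono ij); exact: hi.
      have [A hA] := hphi w (normv_unit_ball (lt_trans hw (ltac:(lra) : 1 / 4 < 1 :> R))).
      have [A' hA'] := hPsi _ Oj.
      split; last exact: unit_ball_coord (PsiB _ Oj).
      by exists (fun i => (A *m A') i b); exact: cderiv_coord (cderiv_comp hA hA').
    - by apply: cderiv_coord; apply: cderiv_comp hL1 _; rewrite phi0.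
  have -> : L a b = al%:C%C * (L1 *m L) 0 b.
    have : ((delta_mx 0 a : 'rV[C]_k) *m L) 0 b = ((al%:C%C *: L1) *m L) 0 b by rewrite L1E.
    by rewrite -rowE [LHS]mxE -scalemxAl [RHS]mxE.
  rewrite cabsM cabs_real ger0_norm ?(ltW al0)//.
  have c0 := cabs_ge0 ((L1 *m L) 0 b).
  have h := ler_pM (ltW al0) c0 (ltW ale) L1b.
  by rewrite (le_trans h)// le_eqVlt; apply/orP; left; apply/eqP; field.
have /choice[idx hidx] := key.
exists (\max_(a < k) idx a); split.
  have [Oa _] := hidx (Ordinal k0); apply: Om_mono Oa.
  exact: (@leq_bigmax _ idx).
move=> Psi L hPsi PsiB hL a b; have [_ h] := hidx a.
exact: (h _ (leq_bigmax (F := idx) a) Psi L hPsi PsiB hL b).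
Qed.

Hypothesis Om_ball : forall i, biholomorphic (Om i) (@unit_ball R k).

Lemma bergman_vanishing p f : (\bigcup_i Om i) p ->
  (forall v, kobayashi (\bigcup_i Om i) p v = 0%E) ->
  bergman (\bigcup_i Om i) f -> f p = 0.
Proof.
move=> Op hkob [hf fL2].
apply/eqP/negPn/negP => fp; have tau0 : 0 < cabs (f p) by rewrite cabs_gt0.
pose c := bergman_const R k; have c0 : 0 < c := bergman_const_gt0 R k0.
have L2pos : (0 <= L2normsq (\bigcup_i Om i) f)%E.
  by apply: iint_ge0 => x; rewrite lee_fin mulr_ge0// sqr_ge0.
pose V := fine (L2normsq (\bigcup_i Om i) f).
have VE : L2normsq (\bigcup_i Om i) f = V%:E by rewrite fineK// ge0_fin_numE.
have V0 : 0 <= V by rewrite fine_ge0.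
pose F : R := (k`!)%:R; have F0 : 0 < F by rewrite ltr0n fact_gt0.
(* Because e <= 1, |det L| <= F e^k <= F e and (F e)^2 <= F^2 e. The second term makes V F^2 e
   smaller than c |f p|^2, against the Bergman inequality; V + 1 covers the case V = 0. *)
pose e := Num.min 1 (c * cabs (f p) ^+ 2 / (2 * F ^+ 2 * (V + 1))).
have V1 : 0 < V + 1 by lra.
have F2 : 0 < F ^+ 2 by rewrite exprn_gt0.
have ct : 0 < c * cabs (f p) ^+ 2 by rewrite mulr_gt0// exprn_gt0.
have e0 : 0 < e by rewrite lt_min ltr01 divr_gt0// !mulr_gt0.
have [i [Oip hi]] := kobayashi_derivative hkob e0.
have [Phi [Psi [hPhi hPsi PhiU PsiU Phi0]]] := centered_biholomorphism (Om_ball i) Oip.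
have /choice[D hD] : forall z, exists L, unit_ball k z -> cderiv Phi z L.
  move=> z; have [bz|nz] := pselect (unit_ball k z); last by exists 0.
  by have [L hL] := hPhi z bz; exists L.
have hfi w : Om i w -> hdiff f w.
  move=> Ow; have [L hL] := hf w (ex_intro2 _ _ i I Ow).
  exists (L^~ 0); have := cderiv_coord 0 hL.
  by under eq_fun do rewrite mxE.
have ineq := bergman_inequality k0 (@Om_open i) hD hPsi PhiU PsiU hfi
  (bigcup_sup I : Om i `<=` \bigcup_i Om i).
rewrite VE lee_fin -/c /pullback_density Phi0 cabsM exprMn mulrA in ineq.
have [L hL] := hPsi p Oip.
have z1 : normv (0 : 'rV[C]_k) < 1 by rewrite normv0.
have inv : D 0 *m L = 1%:M.
  by apply: (derivative_inverse hD PhiU z1); rewrite Phi0.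
have dets : cabs (\det (D 0)) * cabs (\det L) = 1.
  by rewrite -cabsM -det_mulmx inv det1 cabs1.
have e1 : e <= 1 by rewrite ge_min lexx.
have dL : cabs (\det L) <= F * e.
  rewrite (le_trans (det_le (ltW e0) (hi Psi L hPsi PsiU hL)))// ler_wpM2l ?(ltW F0)//.
  by rewrite -[leRHS]expr1 ler_wiXn2l// ltW.
have h1 : c * cabs (f p) ^+ 2 <= V * cabs (\det L) ^+ 2.
  have := ler_wpM2r (sqr_ge0 (cabs (\det L))) ineq.
  apply: le_trans; rewrite le_eqVlt; apply/orP; left; apply/eqP.
  transitivity (c * cabs (f p) ^+ 2 * (cabs (\det (D 0)) * cabs (\det L)) ^+ 2); last by ring.
  by rewrite dets expr1n mulr1.
have h2 : cabs (\det L) ^+ 2 <= F ^+ 2 * e.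
  rewrite (le_trans (y := (F * e) ^+ 2))//.
    by rewrite ler_pXn2r ?nnegrE ?cabs_ge0// mulr_ge0 ?(ltW F0) ?(ltW e0).
  by rewrite exprMn ler_wpM2l ?(ltW F2)// expr2 ler_piMl// ltW.
have h3 : e * (2 * F ^+ 2 * (V + 1)) <= c * cabs (f p) ^+ 2.
  by rewrite -ler_pdivlMr ?mulr_gt0// ge_min lexx orbT.
have h4 := ler_wpM2l V0 h2.
have h5 : 0 < F ^+ 2 * e by rewrite mulr_gt0.
have h6 : 0 <= V * (F ^+ 2 * e) by rewrite mulr_ge0// ltW.
have h7 : e * (2 * F ^+ 2 * (V + 1)) = 2 * (V * (F ^+ 2 * e)) + 2 * (F ^+ 2 * e) by ring.
by clear -h1 h3 h4 h5 h6 h7; lra.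
Qed.

End KobayashiVanishing.

Theorem theorem1p1 (R : realType) (k : nat) (Om : nat -> set 'rV[R[i]]_k) :
  (2 <= k)%N ->
  (forall i, domainC (Om i) /\ biholomorphic (Om i) (@unit_ball R k)) ->
  (forall i, Om i `<=` Om i.+1) ->
  (forall p, (\bigcup_i Om i) p ->
     forall v, kobayashi (\bigcup_i Om i) p v = 0%E) ->
  volC (\bigcup_i Om i) = +oo%E /\
  (forall f, bergman (\bigcup_i Om i) f ->
     forall z, (\bigcup_i Om i) z -> f z = 0).
Proof.
move=> k2 hOm Om_incr hkob.
have k0 : (0 < k)%N by exact: leq_trans k2.
have Om_open i : Defs.openC (Om i) by have [[_ []]] := hOm i.
have Om_ball i : biholomorphic (Om i) (@unit_ball R k) by have [] := hOm i.
have van f : bergman (\bigcup_i Om i) f -> forall z, (\bigcup_i Om i) z -> f z = 0.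
  move=> hf z Oz.
  exact: (bergman_vanishing k0 Om_open Om_incr Om_ball Oz (hkob z Oz) hf).
split=> //; apply/eqP/negPn/negP => volfin.
have [[[p Op] _] _] := hOm 0%N.
have Bp : (\bigcup_i Om i) p by exists 0%N.
suff /van/(_ p Bp)/eqP : bergman (\bigcup_i Om i) (fun=> 1) by rewrite oner_eq0.
split.
  move=> z _; apply: coord_cderiv => j.
  by under eq_fun do rewrite mxE; exact: hdiff_cst.
suff -> : L2normsq (\bigcup_i Om i) (fun=> 1) = volC (\bigcup_i Om i).
  by rewrite ltey.
congr iint; apply/funext => x.
by rewrite cabs1 expr1n mulr1.
Qed.
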